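(* Let $G$ be a simple Eulerian graph that is a join of two graphs each having at least two vertices. Then $G$ is strongly even-cycle decomposable if and only if $G$ is (up to isomorphism) neither $K_5$ nor $K_5$ with an edge subdivided.
   Context: All graphs are finite. An Eulerian graph is a (not necessarily connected) graph in which every vertex has even degree. The join of graphs $G_1$ and $G_2$ is obtained from their disjoint union by adding an edge $uv$ for all $u\in V(G_1)$ and $v\in V(G_2)$. ''$K_5$ with an edge subdivided'' is the 6-vertex graph obtained from $K_5$ by replacing one edge by a path of length $2$. A graph is even-cycle decomposable if its edge set can be partitioned into (edge sets of) cycles of even length. A subdivision of a graph is obtained by replacing each edge by a path of length at least $1$ with the same ends (so a graph is a subdivision of itself). A graph $G$ is strongly even-cycle decomposable if every subdivision of $G$ with an even number of edges is even-cycle decomposable. Equivalently, for every $\Sigma\subseteq E(G)$ with $|\Sigma|$ even, $E(G)$ can be partitioned into cycles each containing an even number of edges of $\Sigma$. *)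

(* Defs.v *)
From mathcomp Require Import all_boot.

Set Implicit Arguments.
Unset Strict Implicit.
Unset Printing Implicit Defensive.

Record sgraph := SGraph {
  vertex :> finType;
  adj : rel vertex;
  adj_sym : symmetric adj;
  adj_irr : irreflexive adj }.

Definition degree (G : sgraph) (x : G) : nat := #|[set y : G | adj x y]|.

Definition eulerian (G : sgraph) : Prop := forall x : G, ~~ odd (degree x).

Definition isomorphic (G H : sgraph) : Prop :=
  exists2 f : G -> H, bijective f & forall x y : G, adj (f x) (f y) = adj x y.

Section Join.
Variables G1 G2 : sgraph.

Definition join_adj (x y : G1 + G2) : bool :=
  match x, y with
  | inl a, inl b => adj a b
  | inr a, inr b => adj a b
  | _, _ => true
  end.

Fact join_adj_sym : symmetric join_adj.
Proof. by case=> a [] b //=; apply: adj_sym. Qed.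

Fact join_adj_irr : irreflexive join_adj.
Proof. by case=> a /=; apply: adj_irr. Qed.

Definition join : sgraph := SGraph join_adj_sym join_adj_irr.
End Join.

Section SubdivideEdge.
Variables (G : sgraph) (a b : G).

(* The edge [ab] is replaced by a path of length 2 whose middle vertex is     *)
(* [None]. This is only meaningful when [adj a b].                            *)
Definition subdivide_edge_adj (x y : option G) : bool :=
  match x, y with
  | Some u, Some v => adj u v && ([set u; v] != [set a; b])
  | Some u, None | None, Some u => u \in [set a; b]
  | None, None => false
  end.

Fact subdivide_edge_adj_sym : symmetric subdivide_edge_adj.
Proof. by case=> [u|] [v|] //=; rewrite adj_sym setUC. Qed.

Fact subdivide_edge_adj_irr : irreflexive subdivide_edge_adj.
Proof. by case=> [u|] //=; rewrite adj_irr. Qed.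

Definition subdivide_edge : sgraph :=
  SGraph subdivide_edge_adj_sym subdivide_edge_adj_irr.
End SubdivideEdge.

Section Complete.
Variable n : nat.

Definition complete_adj (x y : 'I_n) : bool := x != y.

Fact complete_adj_sym : symmetric complete_adj.
Proof. by move=> x y; rewrite /complete_adj eq_sym. Qed.

Fact complete_adj_irr : irreflexive complete_adj.
Proof. by move=> x; rewrite /complete_adj eqxx. Qed.

Definition complete : sgraph := SGraph complete_adj_sym complete_adj_irr.
End Complete.

Definition K5 : sgraph := complete 5.

Definition K5_subdivided : sgraph :=
  @subdivide_edge K5 (ord0 : 'I_5) (ord_max : 'I_5).

Definition edges (G : sgraph) : {set {set G}} :=
  [set e : {set G} | [exists x, exists y, adj x y && (e == [set x; y])]].

(* A cycle is given by its vertices in cyclic order; they are distinct, and   *)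
(* there are at least three of them.                                          *)
Definition is_cycle (G : sgraph) (c : seq G) : Prop :=
  2 < size c /\ ucycle (@adj G) c.

Definition cycle_edges (G : sgraph) (c : seq G) : {set {set G}} :=
  [set [set x; next c x] | x in c].

Definition even_cycle_decomposable (G : sgraph) : Prop :=
  exists2 P : {set {set {set G}}}, partition P (edges G) &
    forall B, B \in P ->
      exists c : seq G, [/\ is_cycle c, ~~ odd (size c) & B = cycle_edges c].

(* [f] embeds the vertices of [G] in those of [H], and each edge [uv] of [G]  *)
(* is replaced by the path [f u :: rcons (P u v) (f v)], of length            *)
(* [(size (P u v)).+1]; [P u v] lists the internal vertices in order from     *)
(* [u] to [v], and its value is irrelevant when [uv] is not an edge.          *)
Record subdivision_via (G H : sgraph) (f : G -> H) (P : G -> G -> seq H) :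
    Prop := SubdivisionVia {
  subdiv_inj : injective f;
  subdiv_rev : forall u v, adj u v -> P v u = rev (P u v);
  subdiv_uniq : forall u v, adj u v -> uniq (P u v);
  subdiv_new : forall u v w, adj u v -> f w \notin P u v;
  subdiv_disjoint : forall u v u' v' x, adj u v -> adj u' v' ->
    x \in P u v -> x \in P u' v' -> [set u; v] = [set u'; v'];
  subdiv_vertex : forall x : H,
    (exists u, x = f u) \/ (exists u v, adj u v /\ x \in P u v);
  subdiv_adj : forall x y : H, adj x y <->
    exists u v, adj u v /\ infix [:: x; y] (f u :: rcons (P u v) (f v)) }.

Definition subdivision (G H : sgraph) : Prop :=
  exists (f : G -> H) (P : G -> G -> seq H), subdivision_via f P.

Definition strongly_even_cycle_decomposable (G : sgraph) : Prop :=
  forall H : sgraph, subdivision G H -> ~~ odd #|edges H| ->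
    even_cycle_decomposable H.

(* Main.v *)
(* Sign each edge of G by the parity of the length of the path that replaces
   it: E(G), of even total parity, must be decomposed into cycles of even parity.
   Even cycles can be removed at once. If all cycles of an Eulerian graph are odd,
   no two of them form a theta graph, so any two edge-disjoint cycles meet in at
   most one vertex, and an end of a longest path lies on a cycle with two vertices
   that lie on no other cycle.

   Fix two vertices b, b' of one side of the join. The rows b-a-b', for the
   vertices a of the other side, pair off into even cycles when their parities
   agree, and rows through suitable vertices of an odd cycle, or of two odd cycles,
   can be combined with these cycles into even ones. Hence an Eulerian graph on the
   other side decomposes together with an even number of rows, the only exception
   being a triangle with four rows, which is K5 with an edge subdivided. If both
   sides are even, the vertices b, b' are split off in pairs. If A is the odd side,
   then all degrees inside B are odd, and pairs of leaves of B are split off together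
   with a path linking them; when A is a triangle, two of its vertices serve as
   terminals instead.

   Conversely, K5 has 10 edges and its even cycles have 4; K5 with an edge replaced
   by a path of length 3 has 12 edges, and its even cycles have 6 edges if they use
   that path and 4 otherwise. *)
Require Import Defs.
From mathcomp Require Import all_boot zify.

Set Implicit Arguments.
Unset Strict Implicit.
Unset Printing Implicit Defensive.

(** The obstacle that shapes the proof is the exception itself, a triangle with four rows. Every
    reduction deletes a cycle, a path or two vertices and must not leave this configuration behind;
    hence the side conditions of the form [size R = 4 -> size H != 3]. They cover K5 as well, since
    there the edge between the two terminals is the fourth row. When a side of four vertices carries
    just a triangle and the other side is larger, two terminals would again meet the exception, so
    four vertices of the other side are taken at once. Edge sets are lists up to permutation. A
    piece is split off by a [perm_eq], and the parity of the remainder follows by cancelling that of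
    the piece. In the local configurations the paths between the relevant vertices have unknown
    lengths, but only their parities matter. Each configuration is therefore a fixed multigraph
    whose edges stand for paths, and one finite check over the parity vectors settles all its
    realizations. *)

Lemma perm_flatten_map (T1 T2 : eqType) (f : T1 -> seq T2) (s t : seq T1) :
  perm_eq s t -> perm_eq (flatten (map f s)) (flatten (map f t)).
Proof. by move=> st; apply/perm_flatten/perm_map. Qed.

(** * Decompositions of signed edge lists into closed walks *)

Section Walks.
Variable V : finType.
Implicit Types (x y z u v w : V) (s t c : seq V) (E H : seq {set V}).

(* [pe x s] lists the edges of the walk [x :: s], and [ce c] those of the closed
   walk [c]. *)
Definition pe x s : seq {set V} := pairmap (fun u v => [set u; v]) x s.
Arguments pe : simpl never.

(** Starting from the last vertex puts the closing edge first, so the list is a single [pairmap]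
    along [c] and has exactly the length of [c]. *)
Definition ce c : seq {set V} := if c is x :: _ then pe (last x c) c else [::].
Arguments ce : simpl never.

Lemma pe_cat x s t : pe x (s ++ t) = pe x s ++ pe (last x s) t.
Proof. exact: pairmap_cat. Qed.

Lemma pe_rcons x s y : pe x (rcons s y) = rcons (pe x s) [set last x s; y].
Proof. by rewrite -cats1 pe_cat cats1. Qed.

Lemma size_pe x s : size (pe x s) = size s.
Proof. exact: size_pairmap. Qed.

Lemma size_ce c : size (ce c) = size c.
Proof. by case: c => //= x s; rewrite size_pe. Qed.

Lemma pe_rev x s y : perm_eq (pe y (rcons (rev s) x)) (pe x (rcons s y)).
Proof.
elim: s x => [|z s IH] x /=; first by rewrite /pe /= setUC.
rewrite rev_cons pe_rcons last_rcons perm_rcons [[set z; x]]setUC perm_cons.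
exact: IH.
Qed.

Lemma ce_cat x s y t :
  ce ((x :: s) ++ (y :: t)) = pe (last y t) (x :: s) ++ pe (last x s) (y :: t).
Proof. by rewrite -[RHS](pe_cat (last y t) (x :: s) (y :: t)) /ce /= last_cat. Qed.

Lemma ce_rot n c : perm_eq (ce (rot n c)) (ce c).
Proof.
rewrite /rot -[in X in perm_eq _ X](cat_take_drop n c); move: (take n c) (drop n c) => s t.
case: s => [|x s]; first by rewrite cats0.
case: t => [|y t]; first by rewrite cats0.
by rewrite !ce_cat perm_catC.
Qed.

Lemma ce_rcons x s : ce (rcons s x) = pe x (rcons s x).
Proof. by case: s => [|y s] //; rewrite /ce /= last_rcons. Qed.

Lemma ce_cons x s : perm_eq (ce (x :: s)) (pe x (rcons s x)).
Proof. by rewrite -ce_rcons -rot1_cons perm_sym ce_rot. Qed.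

Section Signed.
Variable sg : pred {set V}.

Definition par E := odd (count sg E).

Lemma par_cat E H : par (E ++ H) = par E (+) par H.
Proof. by rewrite /par count_cat oddD. Qed.

Lemma par_perm E H : perm_eq E H -> par E = par H.
Proof. by move/permP=> eEH; rewrite /par eEH. Qed.

(* The closed walks may have one or two vertices; when [E] is a duplicate-free list
   of edges of a simple graph they are cycles. *)
Definition good E := exists2 cs : seq (seq V),
  all (fun c => uniq c && ~~ par (ce c)) cs & perm_eq (flatten (map ce cs)) E.

Lemma good_perm E H : perm_eq E H -> good E -> good H.
Proof. by move=> eEH [cs ev p]; exists cs => //; apply: perm_trans p _. Qed.

Lemma good_cat E H : good E -> good H -> good (E ++ H).
Proof.
move=> [cs ev p] [ds ev' p']; exists (cs ++ ds); first by rewrite all_cat ev ev'.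
by rewrite map_cat flatten_cat perm_cat.
Qed.

Lemma good_nil : good [::].
Proof. by exists [::]. Qed.

Lemma good_cycle c : uniq c -> ~~ par (ce c) -> good (ce c).
Proof. by move=> uc ec; exists [:: c]; rewrite /= ?uc ?ec ?cats0. Qed.

Lemma good_par E : good E -> ~~ par E.
Proof.
case=> cs ev p; rewrite -(par_perm p); elim: cs ev {p} => //= c cs IH.
by case/andP=> /andP[_ ec] IHc; rewrite par_cat (negbTE ec) IH.
Qed.

End Signed.

End Walks.

Arguments pe {V} x s : simpl never.
Arguments ce {V} c : simpl never.

(** * Certified decompositions of small graphs *)

(* A multigraph on the branch vertices 0, ..., n.-1 is given by the list T of
   the end pairs of its arcs; a closed walk in it is given by the list of the
   indices of its arcs, the first of which is traversed forwards. *)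
Section Template.
Variables (n : nat) (T : seq (nat * nat)).

(** An entry holds the arc, whether it is run forwards, and the vertex reached. An arc whose first
    end is not the current vertex is run backwards; [chained] checks that this is legitimate. *)
Fixpoint steps (i : nat) (ks : seq nat) : seq (nat * bool * nat) :=
  if ks is k :: ks' then
    let a := nth (0, 0) T k in let b := a.1 == i in
    let j := if b then a.2 else a.1 in
    (k, b, j) :: steps j ks'
  else [::].

Fixpoint chained (i : nat) (ks : seq nat) (j : nat) : bool :=
  if ks is k :: ks' then
    let a := nth (0, 0) T k in
    if a.1 == i then chained a.2 ks' j else (a.2 == i) && chained a.1 ks' j
  else i == j.

Definition start ks := (nth (0, 0) T (head 0 ks)).1.

(** The vertices reached include the final return to the start, so their distinctness says that no
    branch vertex is passed twice. *)
Definition closed_template ks :=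
  [&& ks != [::], chained (start ks) ks (start ks),
      uniq (map snd (steps (start ks) ks)) &
      all (fun j => j < n) (map snd (steps (start ks) ks))].

Definition template (d : seq (seq nat)) :=
  perm_eq (flatten d) (iota 0 (size T)) && all closed_template d.

Definition even_template (v : seq bool) (d : seq (seq nat)) :=
  all (fun ks => ~~ odd (count (nth false v) ks)) d.

Lemma map_steps i ks : map (fun r => r.1.1) (steps i ks) = ks.
Proof. by elim: ks i => //= k ks IH i; rewrite IH. Qed.

End Template.

Section Realize.
Variables (V : finType) (sg : pred {set V}) (x0 : V).
Variables (T : seq (nat * nat)) (bs : seq V) (Ps : seq (seq V)).

Definition link (i j : nat) (P : seq V) :=
  pe (nth x0 bs i) (rcons P (nth x0 bs j)).

Definition arcs := [seq link tP.1.1 tP.1.2 tP.2 | tP <- zip T Ps].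

Hypothesis sizeP : size Ps = size T.
Hypothesis uniqP : uniq (bs ++ flatten Ps).

Let vx := nth x0 bs.
Let P := nth [::] Ps.
Let ak k := nth [::] arcs k.

Lemma nth_arcs k : k < size T ->
  ak k = link (nth (0, 0) T k).1 (nth (0, 0) T k).2 (P k).
Proof.
move=> lt_k; rewrite /ak /arcs (nth_map ((0, 0), [::])) ?size_zip ?sizeP ?minnn //.
by rewrite nth_zip // sizeP.
Qed.

Definition seg (r : nat * bool * nat) : seq V :=
  rcons (if r.1.2 then P r.1.1 else rev (P r.1.1)) (vx r.2).

Definition chain rs : seq V := flatten (map seg rs).

Lemma last_chain x i ks : ks != [::] ->
  last x (chain (steps T i ks)) = vx (last i (map snd (steps T i ks))).
Proof.
elim: ks i x => //= k ks IH i x _; rewrite /chain /= last_cat /seg last_rcons.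
by case: ks IH => [|k' ks] IH //=; rewrite IH.
Qed.

Lemma last_chained i ks j : chained T i ks j ->
  last i (map snd (steps T i ks)) = j.
Proof.
elim: ks i => [|k ks IH] i /=; first by move/eqP.
by case: ifP => _ => [/IH|/andP[_ /IH]].
Qed.

Lemma pe_chain i ks j : all (fun k => k < size T) ks -> chained T i ks j ->
  perm_eq (pe (vx i) (chain (steps T i ks))) (flatten (map ak ks)).
Proof.
elim: ks i => [|k ks IH] i //= /andP[lt_k lt_ks] ch.
rewrite /chain /= pe_cat {1}/seg last_rcons; apply: perm_cat; last first.
  by apply: IH => //; move: ch; case: ifP => // _ /andP[].
rewrite nth_arcs // /seg /=; move: ch; case: ifP => [/eqP <- _ //|_ /andP[/eqP <- _]].
exact: pe_rev.
Qed.

Lemma count_chain a rs : count a (chain rs) =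
  count a (map vx (map snd rs))
    + count a (flatten (map P (map (fun r => r.1.1) rs))).
Proof.
elim: rs => //= r rs IH; rewrite /chain /= !count_cat IH /seg -cats1 count_cat /=.
by case: ifP => _; rewrite ?count_rev addn0 [_ + a _]addnC addnACA.
Qed.

Lemma uniq_flatten_nth (ks : seq nat) : uniq ks ->
  all (fun k => k < size Ps) ks -> uniq (flatten Ps) -> uniq (flatten (map P ks)).
Proof.
move=> uk /allP lt_k; rewrite -{1}[Ps](mkseq_nth [::]) /mkseq -/P => uP.
(* Complete [ks] by the missing indices; the interiors of all arcs together are a permutation of
   [flatten Ps]. *)
suff: uniq (flatten (map P ks) ++
            flatten (map P [seq k <- iota 0 (size Ps) | k \notin ks])).
  by rewrite cat_uniq => /andP[].
rewrite -flatten_cat -map_cat.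
rewrite (perm_uniq (_ : perm_eq _ (flatten (map P (iota 0 (size Ps)))))) //.
apply: perm_flatten_map; apply: uniq_perm; rewrite ?iota_uniq //.
  rewrite cat_uniq uk filter_uniq ?iota_uniq // andbT.
  by apply/hasPn => k; rewrite mem_filter => /andP[].
move=> k; rewrite mem_cat mem_filter mem_iota /= add0n.
by case: (boolP (k \in ks)) => // /lt_k ->.
Qed.

Lemma uniq_chain ks i : uniq ks -> all (fun k => k < size T) ks ->
  uniq (map snd (steps T i ks)) ->
  all (fun j => j < size bs) (map snd (steps T i ks)) ->
  uniq (chain (steps T i ks)).
Proof.
move=> uk lt_k ut lt_t; move: uniqP; rewrite cat_uniq => /and3P[ub dis uPs].
have uvx : uniq (map vx (map snd (steps T i ks))).
  rewrite map_inj_in_uniq // => j j' /(allP lt_t) lt_j /(allP lt_t) lt_j' /eqP.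
  by rewrite nth_uniq // => /eqP.
have uPk : uniq (flatten (map P ks)) by apply: uniq_flatten_nth; rewrite ?sizeP.
rewrite -(perm_uniq (_ : perm_eq (map vx (map snd (steps T i ks)) ++ flatten (map P ks)) _)).
  rewrite cat_uniq uvx uPk andbT; apply/hasPn => x /flattenP[s /mapP[k k_in ->] xs].
  apply/negP => /mapP[j /(allP lt_t) lt_j xj]; case/hasP: dis; exists x.
    apply/flattenP; exists (P k) => //; apply: mem_nth.
    by rewrite sizeP; apply: (allP lt_k).
  by rewrite xj mem_nth.
by apply/permP => a; rewrite count_chain count_cat map_steps.
Qed.

(** Different arcs have disjoint interiors, so a cycle of the multigraph becomes a cycle of the
    graph whose parity is the sum of the parities of its arcs. The parity vector alone decides which
    listed decomposition is taken. *)
Lemma realize ds : all (template (size bs) T) ds ->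
  has (even_template (map (par sg) arcs)) ds -> good sg (flatten arcs).
Proof.
move=> /allP tds /hasP[d /tds /andP[perm_d cl_d] ev_d].
have sizeA : size arcs = size T by rewrite size_map size_zip sizeP minnn.
have arcsE : arcs = map ak (iota 0 (size T)).
  by rewrite -sizeA -{1}[arcs](mkseq_nth [::]).
have [lt_d u_d] : all (fun k => k < size T) (flatten d) /\ uniq (flatten d).
  split; last by rewrite (perm_uniq perm_d) iota_uniq.
  by apply/allP => k; rewrite (perm_mem perm_d) mem_iota.
apply: good_perm (_ : good sg (flatten (map ak (flatten d)))).
  by rewrite arcsE; apply: perm_flatten_map.
elim: d cl_d ev_d lt_d u_d {perm_d} => [|ks d IH] /=; first by move=> *; apply: good_nil.
case/andP=> /and4P[ks0 ch ut lt_t] cl_d /andP[ev_k ev_d].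
rewrite all_cat cat_uniq => /andP[lt_k lt_d] /and3P[uk _ ud].
rewrite map_cat flatten_cat; apply: good_cat; last exact: IH.
set c := chain (steps T (start T ks) ks).
have pc : perm_eq (ce c) (flatten (map ak ks)).
  apply: perm_trans (pe_chain lt_k ch).
  have <- : last x0 c = vx (start T ks) by rewrite last_chain // (last_chained ch).
  by rewrite /c; case: (chain _).
apply: good_perm (pc) _; apply: good_cycle; first exact: uniq_chain.
rewrite (par_perm _ pc); apply: contra ev_k.
have -> : odd (count (nth false (map (par sg) arcs)) ks)
            = par sg (flatten (map ak ks)) => //.
elim: ks lt_k {ks0 ch ut lt_t uk c pc} => //= k ks IHk /andP[lt_k /IHk].
by rewrite par_cat oddD => ->; rewrite (nth_map [::]) ?sizeA // oddb.
Qed.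

End Realize.

Fixpoint allbits n (f : seq bool -> bool) : bool :=
  if n is m.+1 then
    allbits m (fun s => f (true :: s)) && allbits m (fun s => f (false :: s))
  else f [::].

Lemma allbitsP n f s : allbits n f -> size s = n -> f s.
Proof.
elim: n f s => [|n IH] f [|[] s] //= /andP[ft ff] [sz].
  exact: IH _ _ ft sz.
exact: IH _ _ ff sz.
Qed.

Section Degrees.
Variable V : finType.
Implicit Types (x y : V) (s c : seq V) (E : seq {set V}).

Definition simple2 E := all (fun e : {set V} => #|e| == 2) E.

(** Each visit to [x] inside the walk contributes two edges, so only the two ends of the walk count;
    [simple2] rules out steps that stay put. *)
Lemma degree_pe x y s : simple2 (pe y s) ->
  odd (count (fun e : {set V} => x \in e) (pe y s)) = (y == x) (+) (last y s == x).
Proof.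
elim: s y => [|z s IH] y /=; first by rewrite addbb.
rewrite cards2 eqSS eqb1 => /andP[yz /IH IHs].
rewrite oddD IHs oddb !inE ![x == _]eq_sym.
have [xy|_] := eqVneq y x; last by rewrite addbA addbb.
by rewrite -xy eq_sym (negbTE yz).
Qed.

Lemma even_degree_ce x c : simple2 (ce c) -> ~~ odd (count (fun e : {set V} => x \in e) (ce c)).
Proof. by case: c => // y s sc; rewrite degree_pe //= addbb. Qed.

End Degrees.

(** * Parallel paths with common ends *)

Section Parallel.
Variables (V : finType) (sg : pred {set V}).
Implicit Types (b x : V) (P Q : seq V) (Rs : seq (seq V)).

Definition row b b' P := pe b (rcons P b').

Lemma good_row_pair b b' P Q : uniq [:: b, b' & P ++ Q] ->
  par sg (row b b' P) = par sg (row b b' Q) ->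
  good sg (row b b' P ++ row b b' Q).
Proof.
move=> u e.
have := @realize V sg b [:: (0, 1); (0, 1)] [:: b; b'] [:: P; Q] erefl _ [:: [:: [:: 0; 1]]].
rewrite /arcs /link /= !cats0; apply => //.
by rewrite /= /even_template /= -/(row b b' P) -/(row b b' Q) e; case: par.
Qed.

(** Of any three rows two have equal parity and close up to an even cycle; the last two rows agree
    because the total is even. *)
Lemma good_parallel b b' Rs : uniq [:: b, b' & flatten Rs] -> ~~ odd (size Rs) ->
  ~~ par sg (flatten (map (row b b') Rs)) -> good sg (flatten (map (row b b') Rs)).
Proof.
have [n] := ubnP (size Rs); elim: n Rs => // n IH [|P [|Q Rs]] //.
  by move=> *; apply: good_nil.
(* Two rows of equal parity, wherever they stand, are moved to the front and split off, and the
   induction takes the rest. *)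
have pair P1 P2 Rs' : perm_eq [:: P, Q & Rs] [:: P1, P2 & Rs'] ->
    par sg (row b b' P1) = par sg (row b b' P2) ->
    size [:: P, Q & Rs] < n.+1 -> uniq [:: b, b' & flatten [:: P, Q & Rs]] ->
    ~~ odd (size [:: P, Q & Rs]) ->
    ~~ par sg (flatten (map (row b b') [:: P, Q & Rs])) ->
    good sg (flatten (map (row b b') [:: P, Q & Rs])).
  move=> pR e12; rewrite (perm_size pR).
  have -> : uniq [:: b, b' & flatten [:: P, Q & Rs]]
          = uniq [:: b, b' & flatten [:: P1, P2 & Rs']].
    by apply: perm_uniq; rewrite !perm_cons; apply: perm_flatten.
  have pf := perm_flatten_map (row b b') pR; rewrite (par_perm _ pf).
  move=> sz u od ev; apply: (good_perm (E := flatten (map (row b b') [:: P1, P2 & Rs']))).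
    by rewrite perm_sym.
  rewrite /= catA; move: ev; rewrite /= catA par_cat; set A := row b b' P1 ++ _.
  have gA : good sg A.
    apply: good_row_pair => //; apply: subseq_uniq u; rewrite /= !eqxx catA.
    exact: prefix_subseq.
  rewrite (negbTE (good_par gA)) => ev; apply: good_cat gA _; apply: IH => //.
  - by move: sz; rewrite /= ltnS => /ltnW.
  - apply: subseq_uniq u; rewrite /= !eqxx catA; exact: suffix_subseq.
  - by move: od; rewrite /= negbK.
have [e|ne] := eqVneq (par sg (row b b' P)) (par sg (row b b' Q)).
  exact: pair (perm_refl _) e.
case: Rs pair => [_ _ _ _|S Rs pair].
  by rewrite /= cats0 par_cat; case: par ne; case: par.
have [e|ne'] := eqVneq (par sg (row b b' P)) (par sg (row b b' S)).
  by apply: (pair P S (Q :: Rs)) => //; apply/permP => a /=; rewrite [a Q + _]addnCA.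
apply: (pair Q S (P :: Rs)).
  by apply/permP => a /=; rewrite addnCA [a P + _]addnCA.
by move: ne ne'; do 3 case: par.
Qed.

End Parallel.

Section CycleArcs.
Variables (V : finType) (sg : pred {set V}).
Implicit Types (x y z : V) (s t : seq V).

Lemma pe_split x s y t : pe x (s ++ y :: t) = pe x (rcons s y) ++ pe y t.
Proof. by rewrite -cat_rcons pe_cat last_rcons. Qed.

Lemma ce_arcs2 x s y t :
  perm_eq (ce (x :: s ++ y :: t)) (pe x (rcons s y) ++ pe y (rcons t x)).
Proof. by apply: perm_trans (ce_cons _ _) _; rewrite rcons_cat pe_split. Qed.

Lemma ce_arcs3 x s y t z u : perm_eq (ce (x :: s ++ y :: t ++ z :: u))
  (pe x (rcons s y) ++ pe y (rcons t z) ++ pe z (rcons u x)).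
Proof. by apply: perm_trans (ce_arcs2 _ _ _ _) _; rewrite rcons_cat pe_split. Qed.

Lemma ce_arcs5 x1 s1 x2 s2 x3 s3 x4 s4 x5 s5 :
  perm_eq (ce (x1 :: s1 ++ x2 :: s2 ++ x3 :: s3 ++ x4 :: s4 ++ x5 :: s5))
  (pe x1 (rcons s1 x2) ++ pe x2 (rcons s2 x3) ++ pe x3 (rcons s3 x4)
   ++ pe x4 (rcons s4 x5) ++ pe x5 (rcons s5 x1)).
Proof.
apply: perm_trans (ce_arcs3 _ _ _ _ _ _) _.
by rewrite !rcons_cat !rcons_cons !rcons_cat !pe_split.
Qed.

Lemma par_ce2 x s y t : par sg (ce (x :: s ++ y :: t))
  = par sg (pe x (rcons s y)) (+) par sg (pe y (rcons t x)).
Proof. by rewrite (par_perm _ (ce_arcs2 _ _ _ _)) par_cat. Qed.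

Lemma par_ce3 x s y t z u : par sg (ce (x :: s ++ y :: t ++ z :: u))
  = par sg (pe x (rcons s y)) (+)
    (par sg (pe y (rcons t z)) (+) par sg (pe z (rcons u x))).
Proof. by rewrite (par_perm _ (ce_arcs3 _ _ _ _ _ _)) !par_cat. Qed.

Lemma par_ce5 x1 s1 x2 s2 x3 s3 x4 s4 x5 s5 :
  par sg (ce (x1 :: s1 ++ x2 :: s2 ++ x3 :: s3 ++ x4 :: s4 ++ x5 :: s5))
  = par sg (pe x1 (rcons s1 x2)) (+) (par sg (pe x2 (rcons s2 x3)) (+)
     (par sg (pe x3 (rcons s3 x4)) (+) (par sg (pe x4 (rcons s4 x5)) (+)
      par sg (pe x5 (rcons s5 x1))))).
Proof. by rewrite (par_perm _ (ce_arcs5 _ _ _ _ _ _ _ _ _ _)) !par_cat. Qed.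

End CycleArcs.

Section UseTemplate.
Variables (V : finType) (sg : pred {set V}).

(** [cond] is the translation of the parity hypotheses of an application into a condition on the
    parity vector of the arcs. *)
Lemma use_template x0 T bs Ps ds (cond : pred (seq bool)) E :
  allbits (size T) (fun v => cond v ==> has (even_template v) ds) ->
  all (template (size bs) T) ds -> size Ps = size T ->
  uniq (bs ++ flatten Ps) -> cond (map (par sg) (arcs x0 T bs Ps)) ->
  perm_eq (flatten (arcs x0 T bs Ps)) E -> good sg E.
Proof.
move=> chk tds sP u c pE; apply: good_perm pE _; apply: (realize sP u tds).
apply: implyP c; apply: (allbitsP chk).
by rewrite !size_map size_zip sP minnn.
Qed.

End UseTemplate.

(** * Rows between two terminals, and small configurations of odd cycles with rows *)

Section Rows.
Variables (V : finType) (sg : pred {set V}) (b b' : V).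

(* The row of [Some x] is the path b-x-b', and that of [None] is the edge bb'. *)
Definition prow (o : option V) : seq {set V} := row b b' (seq_of_opt o).
Definition prows R := flatten (map prow R).

Lemma prowsE R : prows R = flatten (map prow R).
Proof. by []. Qed.

Lemma par_prow x :
  par sg (prow (Some x)) = par sg (pe b [:: x]) (+) par sg (pe x [:: b']).
Proof. by rewrite /prow /row /= -par_cat. Qed.

End Rows.

Ltac template_perm :=
  apply/permP => ?; rewrite !count_cat
    ?(permP (ce_arcs5 _ _ _ _ _ _ _ _ _ _)) ?(permP (ce_arcs3 _ _ _ _ _ _))
    ?(permP (ce_arcs2 _ _ _ _)) ?count_cat;
  rewrite /arcs /link /prows /prow /row /= ?count_cat ?addn0 ?addnA.

(* The decompositions in the [_check] lemmas come from a computer search; for each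
   admissible parity vector of the arcs, one of those listed is even. *)
Section Templates.
Variables (V : finType) (sg : pred {set V}) (b b' : V).
Implicit Types (x p q c : V) (P Q U : seq V) (o d : option V).

Local Notation prow := (prow b b').
Local Notation prows := (prows b b').
Local Notation S o := (par sg (prow o)).

Definition merge_disjoint_cond v := let p := nth false v in
[&& p 0 (+) p 1, p 2 (+) p 3, (p 4 (+) p 5) == (p 6 (+) p 7) & (p 8 (+) p 9)
    == (p 10 (+) p 11)].

Lemma merge_disjoint_check : allbits 12 (fun v => merge_disjoint_cond v ==>
  has (even_template v)
   [:: [:: [:: 0; 6; 8; 2; 11; 5]; [:: 1; 4; 10; 3; 9; 7]];
    [:: [:: 0; 6; 8; 3; 11; 5]; [:: 1; 4; 10; 2; 9; 7]]]).
Proof. by vm_compute. Qed.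

(** Both decompositions link the two cycles through [b] and [b']. They differ by exchanging [Q] and
    [Q'], which have opposite parities; as the total is even, one of them has two even cycles. *)
Lemma merge_disjoint p p' q q' P P' Q Q' :
  uniq ([:: b; b'; p; p'; q; q'] ++ P ++ P' ++ Q ++ Q') ->
  par sg (ce (p :: P ++ p' :: P')) ->
  par sg (ce (q :: Q ++ q' :: Q')) ->
  S (Some p) = S (Some p') ->
  S (Some q) = S (Some q') ->
  good sg (ce (p :: P ++ p' :: P') ++ ce (q :: Q ++ q' :: Q') ++ prows [:: Some
    p; Some p'; Some q; Some q']).
Proof.
move=> u; rewrite !(par_ce5, par_ce3, par_ce2) !par_prow /prow /row => o0 o1 eP eQ.
apply: (use_template (x0 := b) (T := [:: (2, 3); (3, 2); (4, 5); (5, 4); (0,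
  2); (2, 1); (0, 3); (3, 1); (0, 4); (4, 1); (0, 5); (5, 1)]) (bs := [:: b;
  b'; p; p'; q; q']) (Ps := [:: P; P'; Q; Q'; [::]; [::]; [::]; [::]; [::];
  [::]; [::]; [::]]) merge_disjoint_check isT erefl).
- by rewrite /= ?cats0.
- by rewrite /merge_disjoint_cond /link /= o0 o1 eP eQ !eqxx.
- by template_perm.
Qed.

Definition merge_shared_cond v := let p := nth false v in
[&& p 0 (+) (p 1 (+) p 2), p 3 (+) (p 4 (+) p 5), (p 6 (+) p 7) == (p 8 (+) p
    9) & (p 10 (+) p 11) == (p 12 (+) p 13)].

Lemma merge_shared_check : allbits 14 (fun v => merge_shared_cond v ==>
  has (even_template v)
   [:: [:: [:: 0; 1; 8; 10; 11; 13; 5]; [:: 2; 3; 4; 12; 6; 7; 9]];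
    [:: [:: 0; 1; 8; 10; 3]; [:: 2; 5; 12; 6; 7; 9]; [:: 4; 13; 11]];
    [:: [:: 0; 1; 8; 10; 4; 5]; [:: 2; 3; 11; 9]; [:: 6; 7; 13; 12]];
    [:: [:: 0; 1; 9; 11; 3]; [:: 2; 5; 12; 8]; [:: 4; 13; 7; 6; 10]]]).
Proof. by vm_compute. Qed.

(** The common vertex [x] is none of the four vertices whose rows are used. Exchanging the arcs of
    one cycle, as for disjoint cycles, could make a closed walk pass [x] twice, so other
    decompositions are needed. *)
Lemma merge_shared x p p' q q' P P' P'' Q Q' Q'' :
  uniq ([:: b; b'; x; p; p'; q; q'] ++ P ++ P' ++ P'' ++ Q ++ Q' ++ Q'') ->
  par sg (ce (x :: P ++ p :: P' ++ p' :: P'')) ->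
  par sg (ce (x :: Q ++ q :: Q' ++ q' :: Q'')) ->
  S (Some p) = S (Some p') ->
  S (Some q) = S (Some q') ->
  good sg (ce (x :: P ++ p :: P' ++ p' :: P'') ++ ce (x :: Q ++ q :: Q' ++ q' ::
    Q'') ++ prows [:: Some p; Some p'; Some q; Some q']).
Proof.
move=> u; rewrite !(par_ce5, par_ce3, par_ce2) !par_prow /prow /row => o0 o1 eP eQ.
apply: (use_template (x0 := b) (T := [:: (2, 3); (3, 4); (4, 2); (2, 5); (5,
  6); (6, 2); (0, 3); (3, 1); (0, 4); (4, 1); (0, 5); (5, 1); (0, 6); (6, 1)])
  (bs := [:: b; b'; x; p; p'; q; q']) (Ps := [:: P; P'; P''; Q; Q'; Q''; [::];
  [::]; [::]; [::]; [::]; [::]; [::]; [::]]) merge_shared_check isT erefl).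
- by rewrite /= ?cats0.
- by rewrite /merge_shared_cond /link /= o0 o1 eP eQ !eqxx.
- by template_perm.
Qed.

Definition merge_private_cond v := let p := nth false v in
[&& p 0 (+) p 1, p 2 (+) (p 3 (+) p 4), (p 5 (+) p 6) == (p 7 (+) p 8) & (p 9
    (+) p 10) == (p 11 (+) p 12)].

Lemma merge_private_check : allbits 13 (fun v => merge_private_cond v ==>
  has (even_template v)
   [:: [:: [:: 0; 7; 5]; [:: 1; 2; 3; 12; 8]; [:: 4; 6; 10; 9; 11]];
    [:: [:: 0; 7; 5]; [:: 1; 4; 11; 9; 10; 8]; [:: 2; 3; 12; 6]];
    [:: [:: 0; 7; 9; 3; 4]; [:: 1; 6; 8]; [:: 2; 10; 12; 11; 5]];
    [:: [:: 0; 7; 11; 12; 10; 2]; [:: 1; 6; 8]; [:: 3; 4; 5; 9]]]).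
Proof. by vm_compute. Qed.

(** Here the common vertex is [p], one of the two chosen on the first cycle; it has degree six, two
    from each cycle and two from its row. *)
Lemma merge_private p p' q q' P P' Q Q' Q'' :
  uniq ([:: b; b'; p; p'; q; q'] ++ P ++ P' ++ Q ++ Q' ++ Q'') ->
  par sg (ce (p :: P ++ p' :: P')) ->
  par sg (ce (p :: Q ++ q :: Q' ++ q' :: Q'')) ->
  S (Some p) = S (Some p') ->
  S (Some q) = S (Some q') ->
  good sg (ce (p :: P ++ p' :: P') ++ ce (p :: Q ++ q :: Q' ++ q' :: Q'') ++
    prows [:: Some p; Some p'; Some q; Some q']).
Proof.
move=> u; rewrite !(par_ce5, par_ce3, par_ce2) !par_prow /prow /row => o0 o1 eP eQ.
apply: (use_template (x0 := b) (T := [:: (2, 3); (3, 2); (2, 4); (4, 5); (5,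
  2); (0, 2); (2, 1); (0, 3); (3, 1); (0, 4); (4, 1); (0, 5); (5, 1)]) (bs :=
  [:: b; b'; p; p'; q; q']) (Ps := [:: P; P'; Q; Q'; Q''; [::]; [::]; [::];
  [::]; [::]; [::]; [::]; [::]]) merge_private_check isT erefl).
- by rewrite /= ?cats0.
- by rewrite /merge_private_cond /link /= o0 o1 eP eQ !eqxx.
- by template_perm.
Qed.

Definition merge_meeting_cond v := let p := nth false v in
[&& p 0 (+) p 1, p 2 (+) p 3 & (p 4 (+) p 5) == (p 6 (+) p 7)].

Lemma merge_meeting_check : allbits 8 (fun v => merge_meeting_cond v ==>
  has (even_template v)
   [:: [:: [:: 0; 4; 6; 2]; [:: 1; 3; 7; 5]];
    [:: [:: 0; 4; 6; 3]; [:: 1; 2; 7; 5]]]).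
Proof. by vm_compute. Qed.

(** For cycles through a common [x] one row each is enough: exchanging the two arcs of the second
    cycle between [x] and [q] flips both parities. *)
Lemma merge_meeting x p q P P' Q Q' :
  uniq ([:: b; b'; x; p; q] ++ P ++ P' ++ Q ++ Q') ->
  par sg (ce (x :: P ++ p :: P')) ->
  par sg (ce (x :: Q ++ q :: Q')) ->
  S (Some p) = S (Some q) ->
  good sg (ce (x :: P ++ p :: P') ++ ce (x :: Q ++ q :: Q') ++ prows [:: Some p;
    Some q]).
Proof.
move=> u; rewrite !(par_ce5, par_ce3, par_ce2) !par_prow /prow /row => o0 o1 eP.
apply: (use_template (x0 := b) (T := [:: (2, 3); (3, 2); (2, 4); (4, 2); (0,
  3); (3, 1); (0, 4); (4, 1)]) (bs := [:: b; b'; x; p; q]) (Ps := [:: P; P';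
  Q; Q'; [::]; [::]; [::]; [::]]) merge_meeting_check isT erefl).
- by rewrite /= ?cats0.
- by rewrite /merge_meeting_cond /link /= o0 o1 eP !eqxx.
- by template_perm.
Qed.

Definition absorb_two_rows_cond v := let p := nth false v in
[&& p 0 (+) p 1, (p 2 (+) p 3) == (p 4 (+) p 5) & p 6 != p 7].

Lemma absorb_two_rows_check : allbits 8 (fun v => absorb_two_rows_cond v ==>
  has (even_template v)
   [:: [:: [:: 0; 4; 6; 3]; [:: 1; 2; 7; 5]];
    [:: [:: 0; 4; 7; 3]; [:: 1; 2; 6; 5]]]).
Proof. by vm_compute. Qed.

(** Exchanging the unequal rows [d] and [d'] flips the parities of both cycles, and the total is
    even. *)
Lemma absorb_two_rows p p' d d' P P' :
  uniq ([:: b; b'; p; p'] ++ P ++ P' ++ seq_of_opt d ++ seq_of_opt d') ->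
  par sg (ce (p :: P ++ p' :: P')) ->
  S (Some p) = S (Some p') ->
  S d != S d' ->
  good sg (ce (p :: P ++ p' :: P') ++ prows [:: Some p; Some p'; d; d']).
Proof.
move=> u; rewrite !(par_ce5, par_ce3, par_ce2) !par_prow /prow /row => o0 eP nd.
apply: (use_template (x0 := b) (T := [:: (2, 3); (3, 2); (0, 2); (2, 1); (0,
  3); (3, 1); (0, 1); (0, 1)]) (bs := [:: b; b'; p; p']) (Ps := [:: P; P';
  [::]; [::]; [::]; [::]; (seq_of_opt d); (seq_of_opt d')])
  absorb_two_rows_check isT erefl).
- by rewrite /= ?cats0.
- by rewrite /absorb_two_rows_cond /link /= o0 eP eqxx.
- by template_perm.
Qed.

Definition absorb_three_rows_cond v := let p := nth false v in
[&& p 0 (+) (p 1 (+) p 2), (p 3 (+) p 4) == (p 5 (+) p 6), (p 3 (+) p 4) == (p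
    7 (+) p 8), p 9 != (p 3 (+) p 4), p 10 != (p 3 (+) p 4) & p 11 != (p 3 (+)
    p 4)].

Lemma absorb_three_rows_check : allbits 12 (fun v => absorb_three_rows_cond v ==>
  has (even_template v)
   [:: [:: [:: 0; 1; 7; 9; 4]; [:: 2; 3; 5; 6; 8]; [:: 10; 11]];
    [:: [:: 0; 5; 3]; [:: 1; 8; 6]; [:: 2; 4; 9; 7]; [:: 10; 11]];
    [:: [:: 0; 5; 9; 4]; [:: 1; 7; 10; 6]; [:: 2; 3; 11; 8]]]).
Proof. by vm_compute. Qed.

(** All rows on the cycle agree and all others have the opposite parity, so no two rows off the
    cycle differ and an exchange of two such rows achieves nothing. *)
Lemma absorb_three_rows p q r d d' d'' P Q R :
  uniq ([:: b; b'; p; q; r] ++ P ++ Q ++ R ++ seq_of_opt d ++ seq_of_opt d' ++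
    seq_of_opt d'') ->
  par sg (ce (p :: P ++ q :: Q ++ r :: R)) ->
  S (Some p) = S (Some q) ->
  S (Some p) = S (Some r) ->
  S d != S (Some p) ->
  S d' != S (Some p) ->
  S d'' != S (Some p) ->
  good sg (ce (p :: P ++ q :: Q ++ r :: R) ++ prows [:: Some p; Some q; Some r;
    d; d'; d'']).
Proof.
move=> u; rewrite !(par_ce5, par_ce3, par_ce2) !par_prow /prow /row => o0 eq er nd nd' nd''.
apply: (use_template (x0 := b) (T := [:: (2, 3); (3, 4); (4, 2); (0, 2); (2,
  1); (0, 3); (3, 1); (0, 4); (4, 1); (0, 1); (0, 1); (0, 1)]) (bs := [:: b;
  b'; p; q; r]) (Ps := [:: P; Q; R; [::]; [::]; [::]; [::]; [::]; [::];
  (seq_of_opt d); (seq_of_opt d'); (seq_of_opt d'')]) absorb_three_rows_check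
  isT erefl).
- by rewrite /= ?cats0.
- by rewrite /absorb_three_rows_cond /link /= o0 -eq -er !eqxx nd nd'.
- by template_perm.
Qed.

Definition absorb_five_rows_cond v := let p := nth false v in
[&& p 0 (+) (p 1 (+) (p 2 (+) (p 3 (+) p 4))), (p 5 (+) p 6) == (p 7 (+) p 8),
    (p 5 (+) p 6) == (p 9 (+) p 10), (p 5 (+) p 6) == (p 11 (+) p 12), (p 5
    (+) p 6) == (p 13 (+) p 14) & p 15 != (p 5 (+) p 6)].

Lemma absorb_five_rows_check : allbits 16 (fun v => absorb_five_rows_cond v ==>
  has (even_template v)
   [:: [:: [:: 0; 1; 2; 3; 13; 15; 6]; [:: 4; 5; 7; 8; 14]; [:: 9; 10; 12; 11]];
    [:: [:: 0; 1; 2; 11; 5]; [:: 3; 14; 12]; [:: 4; 6; 15; 13]; [:: 7; 8; 10; 9]];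
    [:: [:: 0; 1; 2; 11; 15; 6]; [:: 3; 4; 5; 7; 8; 12]; [:: 9; 10; 14; 13]]]).
Proof. by vm_compute. Qed.

(** With five rows on the cycle a single row of the other parity is enough; with three on the cycle
    and one off it, the configuration is the exceptional one. *)
Lemma absorb_five_rows p q r s t d P Q R U W :
  uniq ([:: b; b'; p; q; r; s; t] ++ P ++ Q ++ R ++ U ++ W ++ seq_of_opt d) ->
  par sg (ce (p :: P ++ q :: Q ++ r :: R ++ s :: U ++ t :: W)) ->
  S (Some p) = S (Some q) ->
  S (Some p) = S (Some r) ->
  S (Some p) = S (Some s) ->
  S (Some p) = S (Some t) ->
  S d != S (Some p) ->
  good sg (ce (p :: P ++ q :: Q ++ r :: R ++ s :: U ++ t :: W) ++ prows [:: Some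
    p; Some q; Some r; Some s; Some t; d]).
Proof.
move=> u; rewrite !(par_ce5, par_ce3, par_ce2) !par_prow /prow /row => o0 eq er es et nd.
apply: (use_template (x0 := b) (T := [:: (2, 3); (3, 4); (4, 5); (5, 6); (6,
  2); (0, 2); (2, 1); (0, 3); (3, 1); (0, 4); (4, 1); (0, 5); (5, 1); (0, 6);
  (6, 1); (0, 1)]) (bs := [:: b; b'; p; q; r; s; t]) (Ps := [:: P; Q; R; U; W;
  [::]; [::]; [::]; [::]; [::]; [::]; [::]; [::]; [::]; [::]; (seq_of_opt d)])
  absorb_five_rows_check isT erefl).
- by rewrite /= ?cats0.
- by rewrite /absorb_five_rows_cond /link /= o0 -eq -er -es -et !eqxx.
- by template_perm.
Qed.

End Templates.

(** * Odd cycles and rows between two terminals *)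

Section SplitSeq.
Variable V : finType.
Implicit Types (x p q : V) (C s : seq V).

Lemma rot_cycle_to x C : x \in C ->
  exists s, perm_eq C (x :: s) /\ perm_eq (ce C) (ce (x :: s)).
Proof.
case/rot_to => i s eC; exists s; rewrite -eC; split.
  by rewrite perm_sym perm_rot.
by rewrite perm_sym ce_rot.
Qed.

Lemma split_mem x s : x \in s -> exists t u, s = t ++ x :: u.
Proof. by case/splitPr => t u; exists t, u. Qed.

Lemma rot_cycle_to2 x y C : uniq C -> x \in C -> y \in C -> x != y ->
  exists s t, perm_eq C (x :: s ++ y :: t) /\ perm_eq (ce C) (ce (x :: s ++ y :: t)).
Proof.
move=> uC xC yC xy; have [s [pC pce]] := rot_cycle_to xC.
have ys : y \in s by move: yC; rewrite (perm_mem pC) inE eq_sym (negbTE xy).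
by have [t [u es]] := split_mem ys; exists t, u; rewrite -es.
Qed.

Lemma split_mem2 x y s : x \in s -> y \in s -> x != y ->
  (exists t u v, s = t ++ x :: u ++ y :: v) \/
  (exists t u v, s = t ++ y :: u ++ x :: v).
Proof.
move=> xs ys xy; have [t [u es]] := split_mem xs; move: ys.
rewrite es mem_cat inE eq_sym (negbTE xy) /= => /orP[] /split_mem [v [w ->]].
  by right; exists v, w, u; rewrite -catA.
by left; exists t, v, w.
Qed.

End SplitSeq.

(* [lia] is very slow in the presence of many irrelevant hypotheses and large
   atoms. *)
Ltac count_lia :=
  repeat match goal with H : ?T |- _ =>
    match type of T with Prop => clear H end end;
  repeat match goal with |- context [count ?a ?s] =>
    let n := fresh in set n := count a s; clearbody n end;
  repeat match goal with |- context [nat_of_bool ?c] =>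
    let n := fresh in set n := nat_of_bool c; clearbody n end;
  lia.

Ltac perm_count :=
  apply/permP => ?; rewrite /=; repeat rewrite count_cat /=;
  count_lia.

Section Merge.
Variables (V : finType) (sg : pred {set V}) (b b' : V).
Implicit Types (x p q : V) (C D : seq V) (d : option V).

Local Notation prow := (prow b b').
Local Notation prows := (prows b b').
Local Notation S o := (par sg (prow o)).

Definition odd_cycle C := [&& uniq (b :: b' :: C) & par sg (ce C)].

Definition meet1 C D :=
  forall x y, x \in C -> x \in D -> y \in C -> y \in D -> x = y.

Lemma prows_perm R R' : perm_eq R R' -> perm_eq (prows R) (prows R').
Proof. exact: perm_flatten_map. Qed.

Lemma prows_cat R R' : prows (R ++ R') = prows R ++ prows R'.
Proof. by rewrite !prowsE map_cat flatten_cat. Qed.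

Lemma odd_cycleE C : odd_cycle C ->
  [/\ uniq C, par sg (ce C), b != b', b \notin C & b' \notin C].
Proof.
rewrite /odd_cycle /= inE negb_or => /andP[/and3P[/andP[-> ->] -> ->] ->].
by split.
Qed.

Lemma uniq_terminals C D s : odd_cycle C -> odd_cycle D ->
  {subset s <= C ++ D} -> uniq s -> uniq [:: b, b' & s].
Proof.
move=> /odd_cycleE[_ _ bb bC b'C] /odd_cycleE[_ _ _ bD b'D] sub us.
rewrite /= us inE negb_or bb andbT /=.
by apply/andP; split; apply: contra (sub _) _; rewrite mem_cat negb_or ?bC ?b'C.
Qed.

Lemma prows_cons o R : prows (o :: R) = prow o ++ prows R.
Proof. by []. Qed.

Lemma meet1_uniq x C D s t : odd_cycle C -> odd_cycle D -> meet1 C D ->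
  perm_eq C (x :: s) -> perm_eq D (x :: t) -> uniq [:: b, b', x & s ++ t].
Proof.
move=> cC cD m pC pD; apply: (uniq_terminals cC cD) => [y|].
  rewrite mem_cat (perm_mem pC) (perm_mem pD) !inE mem_cat.
  by case/or3P=> ->; rewrite ?orbT.
have [uC _ _ _ _] := odd_cycleE cC; have [uD _ _ _ _] := odd_cycleE cD.
rewrite -cat_cons cat_uniq -(perm_uniq pC) uC /=.
have:= uD; rewrite (perm_uniq pD) /= => /andP[xt ->]; rewrite andbT.
apply/hasPn => y yt; apply: contra xt => ys.
rewrite (m x y) ?(perm_mem pC) ?(perm_mem pD) ?mem_head //.
by rewrite inE yt orbT.
Qed.

Lemma odd_cycle_at2 x y C : odd_cycle C -> x \in C -> y \in C -> x != y ->
  exists s t, [/\ perm_eq C (x :: s ++ y :: t),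
    perm_eq (ce C) (ce (x :: s ++ y :: t)) & par sg (ce (x :: s ++ y :: t))].
Proof.
case/odd_cycleE=> uC oC _ _ _ xC yC xy.
have [s [t [p pce]]] := rot_cycle_to2 uC xC yC xy.
by exists s, t; split; rewrite // -(par_perm _ pce).
Qed.

Lemma merge_at x p q C D : odd_cycle C -> odd_cycle D -> meet1 C D ->
  x \in C -> x \in D -> p \in C -> q \in D -> x != p -> x != q ->
  S (Some p) = S (Some q) -> good sg (ce C ++ ce D ++ prows [:: Some p; Some q]).
Proof.
move=> cC cD m xC xD pC qD px qx eS.
have [s [s' [pc pce oc]]] := odd_cycle_at2 cC xC pC px.
have [t [t' [pd pde od]]] := odd_cycle_at2 cD xD qD qx.
apply: good_perm (_ : good sg (ce _ ++ ce _ ++ _)).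
  by rewrite perm_sym; apply: perm_cat pce (perm_cat pde (perm_refl _)).
apply: merge_meeting => //.
rewrite -(perm_uniq (s1 := [:: b, b', x & (s ++ p :: s') ++ t ++ q :: t'])).
  exact: meet1_uniq pc pd.
by perm_count.
Qed.

(** The order in which [y] and [z] follow [x] depends on the cycle, hence the renaming to [y1] and
    [z1]. *)
Lemma odd_cycle_at3 x y z C : odd_cycle C ->
  x \in C -> y \in C -> z \in C -> x != y -> x != z -> y != z ->
  exists y1 z1 s t u, [/\ perm_eq [:: y; z] [:: y1; z1],
    perm_eq C (x :: s ++ y1 :: t ++ z1 :: u),
    perm_eq (ce C) (ce (x :: s ++ y1 :: t ++ z1 :: u)) &
    par sg (ce (x :: s ++ y1 :: t ++ z1 :: u))].
Proof.
case/odd_cycleE=> uC oC _ _ _ xC yC zC xy xz yz.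
have [s [p pce]] := rot_cycle_to xC.
have inS w : w \in C -> x != w -> w \in s.
  by rewrite (perm_mem p) inE eq_sym => /orP[->|].
have [ys zs] : y \in s /\ z \in s by split; apply: inS.
have oce := oC; rewrite (par_perm _ pce) in oce.
have [[t [u [v es]]]|[t [u [v es]]]] := split_mem2 ys zs yz.
  by exists y, z, t, u, v; rewrite -es.
exists z, y, t, u, v; rewrite -es; split => //.
by perm_count.
Qed.

Lemma merge_no_meet p p' q q' C D : odd_cycle C -> odd_cycle D ->
  ~~ has (mem C) D -> p \in C -> p' \in C -> q \in D -> q' \in D ->
  p != p' -> q != q' -> S (Some p) = S (Some p') -> S (Some q) = S (Some q') ->
  good sg (ce C ++ ce D ++ prows [:: Some p; Some p'; Some q; Some q']).
Proof.
move=> cC cD dis pC p'C qD q'D pp qq eS eS'.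
have [s [s' [pc pce oc]]] := odd_cycle_at2 cC pC p'C pp.
have [t [t' [pd pde od]]] := odd_cycle_at2 cD qD q'D qq.
apply: good_perm (_ : good sg (ce _ ++ ce _ ++ _)).
  by rewrite perm_sym; apply: perm_cat pce (perm_cat pde (perm_refl _)).
apply: merge_disjoint => //.
rewrite -(perm_uniq (s1 := [:: b, b' & (p :: s ++ p' :: s') ++ (q :: t ++ q' :: t')])).
  apply: (uniq_terminals cC cD) => [y|].
    by rewrite !mem_cat (perm_mem pc) (perm_mem pd).
  have [uC _ _ _ _] := odd_cycleE cC; have [uD _ _ _ _] := odd_cycleE cD.
  rewrite -(perm_uniq (perm_cat pc pd)) cat_uniq uC uD andbT.
  exact: dis.
by perm_count.
Qed.

Lemma merge_at_outside x p p' q q' C D : odd_cycle C -> odd_cycle D -> meet1 C D ->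
  x \in C -> x \in D -> p \in C -> p' \in C -> q \in D -> q' \in D ->
  uniq [:: x; p; p'] -> uniq [:: x; q; q'] ->
  S (Some p) = S (Some p') -> S (Some q) = S (Some q') ->
  good sg (ce C ++ ce D ++ prows [:: Some p; Some p'; Some q; Some q']).
Proof.
move=> cC cD m xC xD pC p'C qD q'D.
rewrite /= !inE !negb_or !andbT => /andP[/andP[xp xp'] pp] /andP[/andP[xq xq'] qq] eS eS'.
have [p1 [p1' [s [t [u [pp1 pc pce oc]]]]]] := odd_cycle_at3 cC xC pC p'C xp xp' pp.
have [q1 [q1' [s' [t' [u' [qq1 pd pde od]]]]]] := odd_cycle_at3 cD xD qD q'D xq xq' qq.
have eSp : S (Some p1) = S (Some p1').
  have : p1 \in [:: p; p'] by rewrite (perm_mem pp1) mem_head.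
  have : p1' \in [:: p; p'] by rewrite (perm_mem pp1) !inE eqxx orbT.
  by rewrite !inE => /pred2P[]-> /pred2P[]->; rewrite ?eS.
have eSq : S (Some q1) = S (Some q1').
  have : q1 \in [:: q; q'] by rewrite (perm_mem qq1) mem_head.
  have : q1' \in [:: q; q'] by rewrite (perm_mem qq1) !inE eqxx orbT.
  by rewrite !inE => /pred2P[]-> /pred2P[]->; rewrite ?eS'.
apply: (good_perm (E := ce _ ++ ce _ ++ prows [:: Some p1; Some p1'; Some q1; Some q1'])); last
  first.
  apply: merge_shared eSp eSq => //; last 2 first; [exact: oc|exact: od|].
  rewrite -(perm_uniq (s1 := [:: b, b', x & (s ++ p1 :: t ++ p1' :: u) ++ (s' ++ q1 :: t' ++ q1'
    :: u')])).
    exact: meet1_uniq pc pd.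
  by perm_count.
rewrite perm_sym; apply: perm_cat pce (perm_cat pde _); apply: prows_perm.
exact: (perm_cat (perm_map Some pp1) (perm_map Some qq1)).
Qed.

Lemma merge_at_private p p' q q' C D : odd_cycle C -> odd_cycle D -> meet1 C D ->
  p \in C -> p \in D -> p' \in C -> q \in D -> q' \in D ->
  p != p' -> uniq [:: p; q; q'] ->
  S (Some p) = S (Some p') -> S (Some q) = S (Some q') ->
  good sg (ce C ++ ce D ++ prows [:: Some p; Some p'; Some q; Some q']).
Proof.
move=> cC cD m pC pD p'C qD q'D pp'.
rewrite /= !inE !negb_or !andbT => /andP[/andP[xq xq'] qq] eS eS'.
have [s [s' [pc pce oc]]] := odd_cycle_at2 cC pC p'C pp'.
have [q1 [q1' [t [t' [t'' [qq1 pd pde od]]]]]] := odd_cycle_at3 cD pD qD q'D xq xq' qq.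
have eSq : S (Some q1) = S (Some q1').
  have : q1 \in [:: q; q'] by rewrite (perm_mem qq1) mem_head.
  have : q1' \in [:: q; q'] by rewrite (perm_mem qq1) !inE eqxx orbT.
  by rewrite !inE => /pred2P[]-> /pred2P[]->; rewrite ?eS'.
apply: (good_perm (E := ce _ ++ ce _ ++ prows [:: Some p; Some p'; Some q1; Some q1'])); last first.
  apply: merge_private eS eSq => //; last 2 first; [exact: oc|exact: od|].
  rewrite -(perm_uniq (s1 := [:: b, b', p & (s ++ p' :: s') ++ (t ++ q1 :: t' ++ q1' :: t'')])).
    exact: meet1_uniq pc pd.
  by perm_count.
rewrite perm_sym; apply: perm_cat pce (perm_cat pde _); apply: prows_perm.
by rewrite !perm_cons; apply: (perm_map Some qq1).
Qed.

Lemma meet1C C D : meet1 C D -> meet1 D C.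
Proof. by move=> m x y xD xC yD yC; apply: m. Qed.

(** The cycles have at most one common vertex; the cases are whether it exists and whether it is one
    of the four chosen vertices. *)
Lemma merge_pair p p' q q' C D : odd_cycle C -> odd_cycle D -> meet1 C D ->
  p \in C -> p' \in C -> q \in D -> q' \in D -> uniq [:: p; p'; q; q'] ->
  S (Some p) = S (Some p') -> S (Some q) = S (Some q') ->
  good sg (ce C ++ ce D ++ prows [:: Some p; Some p'; Some q; Some q']).
Proof.
move=> cC cD m pC p'C qD q'D u eS eS'; have cm := meet1C m.
have := u; rewrite /= !inE !negb_or !andbT => /and3P[/and3P[pp pq pq'] /andP[p'q p'q'] qq].
have [/hasP[x xD /= xC]|dis] := boolP (has (mem C) D); last exact: merge_no_meet.
have [epx|px] := eqVneq p x.
  by subst p; apply: merge_at_private => //=; rewrite !inE !negb_or pq pq' qq.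
have [epx|p'x] := eqVneq p' x.
  subst p'; apply: (good_perm (E := ce C ++ ce D ++ prows [:: Some x; Some p; Some q; Some q'])).
    by perm_count.
  by apply: merge_at_private => //=; rewrite 1?eq_sym // !inE !negb_or p'q p'q' qq.
have [epx|qx] := eqVneq q x.
  subst q; apply: (good_perm (E := ce D ++ ce C ++ prows [:: Some x; Some q'; Some p; Some p'])).
    by perm_count.
  by apply: merge_at_private => //=; rewrite !inE !negb_or ![x == _]eq_sym pq p'q pp.
have [epx|q'x] := eqVneq q' x.
  subst q'; apply: (good_perm (E := ce D ++ ce C ++ prows [:: Some x; Some q; Some p; Some p'])).
    by perm_count.
  by apply: merge_at_private => //=; rewrite 1?eq_sym // !inE !negb_or ![x == _]eq_sym pq' p'q' pp.
apply: (merge_at_outside cC cD m xC xD) => //=.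
  by rewrite !inE !negb_or ![x == _]eq_sym px p'x pp.
by rewrite !inE !negb_or ![x == _]eq_sym qx q'x qq.
Qed.

End Merge.

Section CyclePoints.
Variables (V : finType) (a : pred V).
Implicit Types (C s : seq V).

Lemma split_first s : 0 < count a s -> exists t x u,
  [/\ s = t ++ x :: u, a x & count a s = (count a u).+1].
Proof.
elim: s => //= y s IH; case: (boolP (a y)) => [ay _|_ /IH [t [x [u [-> ax e]]]]].
  by exists [::], y, s.
by exists (y :: t), x, u; rewrite e.
Qed.

Lemma cycle_point C : 0 < count a C -> exists p s, [/\ a p,
  perm_eq C (p :: s), perm_eq (ce C) (ce (p :: s)) & count a C = (count a s).+1].
Proof.
rewrite -has_count => /hasP[x xC ax]; have [s [p pce]] := rot_cycle_to xC.
by exists x, s; rewrite (permP p) /= ax.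
Qed.

Lemma cycle_points3 C : 2 < count a C -> exists p q r s t u, [/\ a p, a q, a r,
  perm_eq C (p :: s ++ q :: t ++ r :: u) &
  perm_eq (ce C) (ce (p :: s ++ q :: t ++ r :: u))].
Proof.
move=> lt2; have [|p [s0 [ap pC pce e]]] := @cycle_point C; first by case: (count a C) lt2.
rewrite e in lt2.
have [|s [q [s1 [es1 aq e1]]]] := @split_first s0; first by case: (count a s0) lt2.
rewrite e1 in lt2.
have [|t [r [u [eu ar _]]]] := @split_first s1; first by case: (count a s1) lt2.
by exists p, q, r, s, t, u; rewrite -eu -es1.
Qed.

Lemma cycle_points5 C : 4 < count a C -> exists p1 p2 p3 p4 p5 s1 s2 s3 s4 s5,
  [/\ [/\ a p1, a p2, a p3, a p4 & a p5],
  perm_eq C (p1 :: s1 ++ p2 :: s2 ++ p3 :: s3 ++ p4 :: s4 ++ p5 :: s5) &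
  perm_eq (ce C) (ce (p1 :: s1 ++ p2 :: s2 ++ p3 :: s3 ++ p4 :: s4 ++ p5 :: s5))].
Proof.
move=> lt4; have [|p [s0 [ap pC pce e]]] := @cycle_point C; first by case: (count a C) lt4.
rewrite e in lt4.
have [|s1 [p2 [u1 [eu1 ap2 e2]]]] := @split_first s0; first by case: (count a s0) lt4.
rewrite e2 in lt4.
have [|s2 [p3 [u2 [eu2 ap3 e3]]]] := @split_first u1; first by case: (count a u1) lt4.
rewrite e3 in lt4.
have [|s3 [p4 [u3 [eu3 ap4 e4]]]] := @split_first u2; first by case: (count a u2) lt4.
rewrite e4 in lt4.
have [|s4 [p5 [u4 [eu4 ap5 _]]]] := @split_first u3; first by case: (count a u3) lt4.
exists p, p2, p3, p4, p5, s1, s2, s3, s4, u4; rewrite -eu4 -eu3 -eu2 -eu1.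
by do !split.
Qed.

Lemma pick_three (T : eqType) (c : pred T) (s : seq T) : 2 < count c s -> uniq s ->
  exists x y z r, [/\ c x, c y, c z & perm_eq s [:: x, y, z & r]].
Proof.
rewrite -size_filter => lt2 us.
have /permPl := perm_filterC c s; rewrite perm_sym.
have : all c (filter c s) by apply: filter_all.
move: lt2; case: (filter c s) => [|x [|y [|z r]]] //= _ /and4P[cx cy cz _] p.
by exists x, y, z, (r ++ filter (predC c) s).
Qed.

End CyclePoints.

Lemma perm_subset (T : eqType) (s t : seq T) : uniq s -> {subset s <= t} ->
  exists u, perm_eq t (s ++ u).
Proof.
elim: s t => [|x s IH] t /=; first by exists t.
case/andP=> xs us sub; have xt : x \in t by apply: sub; rewrite mem_head.
have [|u pu] := IH (rem x t) us.
  move=> y ys; have yt : y \in t by apply: sub; rewrite inE ys orbT.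
  rewrite (perm_mem (perm_to_rem xt)) inE in yt.
  by case/orP: yt => // /eqP eyx; rewrite -eyx ys in xs.
by exists u; rewrite (perm_trans (perm_to_rem xt)) // perm_cons.
Qed.

(** * One odd cycle with an even number of rows *)

Section Absorb.
Variables (V : finType) (sg : pred {set V}) (b b' : V).
Implicit Types (x p q : V) (C D : seq V) (d o : option V) (R : seq (option V)).

Local Notation prow := (prow b b').
Local Notation prows := (prows b b').
Local Notation S o := (par sg (prow o)).
Local Notation odd_cycle := (odd_cycle sg b b').

(** Wrapping the terminals in [Some] makes one [uniq] say that the rows are distinct, the terminals
    are distinct and no terminal occurs as a row. *)
Definition rows_ok R := uniq [:: Some b, Some b' & R].

Lemma rows_ok_perm R R' : perm_eq R R' -> rows_ok R -> rows_ok R'.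
Proof.
move=> pR; rewrite /rows_ok (perm_uniq (_ : perm_eq _ [:: Some b, Some b' & R'])) //.
by rewrite !perm_cons.
Qed.

Lemma rows_ok_sub R R' : rows_ok (R ++ R') -> rows_ok R'.
Proof. by apply: subseq_uniq; rewrite /= !eqxx suffix_subseq. Qed.

Lemma rows_ok_subset R R' : rows_ok R -> {subset R' <= R} -> uniq R' -> rows_ok R'.
Proof.
move=> okR sub uR'; have [U] := perm_subset uR' sub.
rewrite perm_sym perm_catC perm_sym => pU.
exact: rows_ok_sub (rows_ok_perm pU okR).
Qed.

Lemma rows_okE R : rows_ok R -> [/\ uniq R, Some b \notin R & Some b' \notin R].
Proof. by rewrite /rows_ok /= inE negb_or => /and3P[/andP[_ ->] -> ->]. Qed.

Lemma mem_rows x R : (x \in flatten (map (@seq_of_opt V) R)) = (Some x \in R).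
Proof.
by elim: R => //= -[y|] R IH; rewrite inE /= IH.
Qed.

Lemma uniq_rows R : uniq R -> uniq (flatten (map (@seq_of_opt V) R)).
Proof.
elim: R => //= -[y|] R IH /andP[yR uR] /=; rewrite ?IH // andbT.
by rewrite mem_rows.
Qed.

Lemma odd_parity_rows R : par sg (prows R) = odd (count (fun o => S o) R).
Proof.
by elim: R => //= o R IH; rewrite prowsE /= par_cat oddD oddb -IH.
Qed.

Lemma good_rows R : rows_ok R -> ~~ odd (size R) -> ~~ par sg (prows R) ->
  good sg (prows R).
Proof.
move=> okR; rewrite -(size_map (@seq_of_opt V)) prowsE.
have -> : map prow R = map (row b b') (map (@seq_of_opt V) R) by rewrite -map_comp.
apply: good_parallel; have [uR bR b'R] := rows_okE okR.
have bb : b != b' by move: okR; rewrite /rows_ok /= inE negb_or => /andP[/andP[]].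
by rewrite /= inE !mem_rows negb_or bb uniq_rows // bR b'R.
Qed.

(** The rows outside [R'] are even in number and in total parity, so they pair off. Hence only the
    few rows that a cycle really uses have to be found. *)
Lemma good_extend_rows E R R' : rows_ok R -> ~~ odd (size R) ->
  {subset R' <= R} -> uniq R' -> ~~ odd (size R') ->
  ~~ par sg (E ++ prows R) -> good sg (E ++ prows R') -> good sg (E ++ prows R).
Proof.
move=> okR ev sub uR' ev' evp gE; have [U pR] := perm_subset uR' sub.
have pE : perm_eq ((E ++ prows R') ++ prows U) (E ++ prows R).
  by rewrite -catA perm_cat2l -prows_cat prows_perm // perm_sym.
apply: good_perm (pE) _; apply: good_cat => //; apply: good_rows.
- exact: rows_ok_sub (rows_ok_perm pR okR).
- by move: ev; rewrite (perm_size pR) size_cat oddD (negbTE ev').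
- by move: evp; rewrite -(par_perm _ pE) par_cat (negbTE (good_par gE)).
Qed.

(** The roles are turned around: with [p] and [q] as terminals, the two arcs of the cycle and the
    paths through [b] and through [b'] are four parallel rows of even total parity. *)
Lemma absorb_unequal p q C : odd_cycle C -> p \in C -> q \in C ->
  S (Some p) != S (Some q) -> good sg (ce C ++ prows [:: Some p; Some q]).
Proof.
move=> cC pC qC neS; have [uC oC bb bC b'C] := odd_cycleE cC.
have pq : p != q by apply: contraNneq neS => ->.
have [s [t [pc pce oc]]] := odd_cycle_at2 cC pC qC pq.
have pr : perm_eq (flatten (map (row p q) [:: s; rev t; [:: b]; [:: b']]))
                  (ce C ++ prows [:: Some p; Some q]).
  apply: (perm_trans (y := ce (p :: s ++ q :: t) ++ prows [:: Some p; Some q])).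
    apply/permP => a; rewrite !count_cat (permP (ce_arcs2 _ _ _ _)) !count_cat.
    rewrite /= /row (permP (pe_rev q t p)) [[set p; b]]setUC [[set q; b']]setUC.
    count_lia.
  by rewrite perm_cat2r perm_sym.
apply: good_perm (pr) _; apply: good_parallel => //.
  rewrite (perm_uniq (s2 := b :: b' :: p :: s ++ q :: t)); last first.
    apply/permP => a; rewrite /= !count_cat /= ?count_cat /= count_rev; count_lia.
  by rewrite 2!cons_uniq inE negb_or bb -!(perm_mem pc) bC b'C -(perm_uniq pc).
rewrite (par_perm _ pr) par_cat oC odd_parity_rows /= addn0 oddD !oddb.
by move: neS; do 2 case: par.
Qed.

Definition on_cycle C o := if o is Some x then x \in C else false.

Lemma count_on_cycle C R : uniq C -> uniq R ->
  count (fun x => Some x \in R) C = count (on_cycle C) R.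
Proof.
move=> uC uR; rewrite -!size_filter -(size_map Some); apply/perm_size/uniq_perm.
- by rewrite map_inj_uniq ?filter_uniq // => x y [].
- exact: filter_uniq.
case=> [x|]; rewrite mem_filter /=; last by apply/mapP => -[].
by rewrite mem_map ?mem_filter 1?andbC // => y z [].
Qed.

Lemma uniq_cycle_rows C D R : odd_cycle C -> perm_eq C D -> rows_ok R ->
  ~~ has (on_cycle C) R ->
  uniq ([:: b; b'] ++ D ++ flatten (map (@seq_of_opt V) R)).
Proof.
move=> /odd_cycleE[uC _ bb bC b'C] pD /rows_okE[uR bR b'R] /hasPn dis.
rewrite /= !inE negb_or bb !mem_cat !mem_rows -!(perm_mem pD) !negb_or.
rewrite bC b'C bR b'R cat_uniq -(perm_uniq pD) uC uniq_rows //= andbT.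
by apply/hasPn => x; rewrite mem_rows /= -(perm_mem pD) => /dis.
Qed.

(* The bad configuration is [K5] with an edge subdivided: the cycle is a
   triangle [p q r] and the remaining row is the subdivided edge. *)
Lemma absorb_rows p q C R : odd_cycle C -> p \in C -> q \in C -> p != q ->
  rows_ok R -> Some p \in R -> Some q \in R -> ~~ odd (size R) ->
  ~~ par sg (ce C ++ prows R) -> (size R = 4 -> count (on_cycle C) R != 3) ->
  good sg (ce C ++ prows R).
Proof.
move=> cC pC qC pq okR pR qR evR ev nbad.
have [uC oC bb bC b'C] := odd_cycleE cC; have [uR bR b'R] := rows_okE okR.
have extend R' : {subset R' <= R} -> uniq R' -> ~~ odd (size R') ->
    good sg (ce C ++ prows R') -> good sg (ce C ++ prows R).
  by move=> *; apply: (@good_extend_rows _ R R').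
have oddR : odd (count (fun o => S o) R).
  by move: ev; rewrite par_cat oC odd_parity_rows negbK.
have [|] := boolP (has (fun o => on_cycle C o && (S o != S (Some p))) R).
  case/hasP=> -[x|] // xR /andP[xC ne]; apply: extend (absorb_unequal cC xC pC ne) => //.
    by move=> o; rewrite !inE => /orP[]/eqP->.
  by rewrite /= inE andbT; apply: contraNneq ne => ->.
move/hasPn => eqS.
have {}eqS o : o \in R -> on_cycle C o -> S o = S (Some p).
  by move=> /eqS; case: on_cycle => //=; rewrite negbK => /eqP.
pose other o := S o != S (Some p).
(* The rows are even in number and the odd ones among them are odd in number, so both parities occur
   an odd number of times. *)
have odd_other : odd (count other R).
  rewrite /other; case: (S (Some p)); last first.
    by rewrite (eq_count (a2 := fun o => S o)) // => o; case: (S o).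
  rewrite (eq_count (a2 := predC (fun o => S o))); last by move=> o /=; case: (S o).
  by move: evR; rewrite -(count_predC (fun o => S o)) oddD oddR /= negbK.
have /hasP[d dR nd] : has other R by rewrite has_count; case: count odd_other.
have on_other o : o \in R -> other o -> ~~ on_cycle C o.
  by move=> oR; rewrite /other; apply: contra => oC'; rewrite (eqS o).
(* A row off the cycle with the parity of [p], together with [d], gives two unequal rows that can be
   exchanged. *)
have [|] := boolP (has (fun o => ~~ on_cycle C o && ~~ other o) R).
  case/hasP=> d' d'R /andP[d'C]; rewrite /other negbK => /eqP ed'.
  have [s [t [pc pce oc]]] := odd_cycle_at2 cC pC qC pq.
  apply: (extend [:: Some p; Some q; d; d']) => //.
  - by move=> o; rewrite !inE => /or4P[]/eqP->.
  - have := on_other d dR nd; rewrite /= !inE !negb_or => dC.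
    have dd : d != d' by apply: contraNneq nd => ->; rewrite /other ed' eqxx.
    have [pd qd] : Some p != d /\ Some q != d.
      by split; apply: contraNneq dC => <-.
    have [pd' qd'] : Some p != d' /\ Some q != d'.
      by split; apply: contraNneq d'C => <-.
    by rewrite (inj_eq (@Some_inj _)) pq dd pd qd pd' qd'.
  apply: (good_perm (E := ce (p :: s ++ q :: t) ++ prows [:: Some p; Some q; d; d'])).
    by rewrite perm_cat2r perm_sym.
  have dd : d != d' by apply: contraNneq nd => ->; rewrite /other ed' eqxx.
  apply: absorb_two_rows => //.
  - have sub : {subset [:: d; d'] <= R} by move=> o; rewrite !inE => /orP[]/eqP->.
    have uD : uniq [:: d; d'] by rewrite /= inE dd.
    rewrite -(perm_uniq (s1 := [:: b; b'] ++ (p :: s ++ q :: t)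
                               ++ flatten (map (@seq_of_opt V) [:: d; d']))).
      apply: uniq_cycle_rows cC pc (rows_ok_subset okR sub uD) _.
      by rewrite /= orbF negb_or on_other.
    by perm_count.
  - by rewrite (eqS (Some q)).
  - by rewrite ed'.
(* From here on the rows on the cycle are exactly those with the parity of [p]. Their number is odd
   and more than one, hence three or at least five. *)
move/hasPn => same_on.
have sameE o : o \in R -> on_cycle C o = ~~ other o.
  move=> oR; case: (boolP (other o)) => [/(on_other o oR)/negbTE->//|no].
  by have := same_on o oR; rewrite no andbT negbK.
have cntC : count (on_cycle C) R = size R - count other R.
  rewrite -(count_predC other) addKn; apply: eq_in_count => o oR.
  by rewrite /= sameE.
have le_other : count other R <= size R by apply: count_size.
have {}cntC : count (on_cycle C) R + count other R = size R by rewrite cntC subnK.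
have oddC : odd (count (on_cycle C) R).
  by move: evR; rewrite -cntC oddD odd_other addbT negbK.
have lt1 : 1 < count (on_cycle C) R.
  have [R' pR'] : exists R', perm_eq R ([:: Some p; Some q] ++ R').
    apply: perm_subset; first by rewrite /= inE (inj_eq (@Some_inj _)) pq.
    by move=> o; rewrite !inE => /orP[]/eqP->.
  by rewrite (permP pR') /= pC qC.
have aS x : Some x \in R -> x \in C -> S (Some x) = S (Some p).
  by move=> xR xC; apply: (eqS (Some x)).
have [lt4|ge4] := ltnP 4 (count (on_cycle C) R).
  rewrite -count_on_cycle // in lt4.
  have [p1 [p2 [p3 [p4 [p5 [s1 [s2 [s3 [s4 [s5 [[a1 a2 a3 a4 a5] pc pce]]]]]]]]]]] :=
    cycle_points5 lt4.
  have inC x : x \in p1 :: s1 ++ p2 :: s2 ++ p3 :: s3 ++ p4 :: s4 ++ p5 :: s5 -> x \in C.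
    by rewrite (perm_mem pc).
  have [i1 i2 i3 i4 i5] : [/\ p1 \in C, p2 \in C, p3 \in C, p4 \in C & p5 \in C].
    by split; apply: inC; rewrite !(mem_cat, inE) eqxx ?orbT.
  have dC := on_other d dR nd.
  have uq := uniq_cycle_rows cC pc (rows_ok_subset okR (R' := [:: d]) _ isT).
  apply: (extend [:: Some p1; Some p2; Some p3; Some p4; Some p5; d]) => //.
  - by move=> o; rewrite !inE =>
    /orP[/eqP->//|/orP[/eqP->//|/orP[/eqP->//|/orP[/eqP->//|/orP[/eqP->//|/eqP->//]]]]].
  - have ud x : x \in C -> Some x != d by move=> xC; apply: contraNneq dC => <-.
    have : uniq [:: p1; p2; p3; p4; p5].
      have := uC; rewrite (perm_uniq pc) (perm_uniq (s2 := [:: p1; p2; p3; p4; p5] ++ s1 ++ s2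
        ++ s3 ++ s4 ++ s5)).
        by rewrite cat_uniq => /andP[].
      by perm_count.
    by rewrite -(map_inj_uniq (@Some_inj _)) /= !inE !negb_or !(ud, i1, i2, i3, i4, i5) // !andbT.
  apply: (good_perm (E := ce (p1 :: s1 ++ p2 :: s2 ++ p3 :: s3 ++ p4 :: s4 ++ p5 :: s5) ++ prows
    [:: Some p1; Some p2; Some p3; Some p4; Some p5; d])).
    by rewrite perm_cat2r perm_sym.
  apply: absorb_five_rows; rewrite -?(par_perm _ pce) ?(aS p1) ?(aS p2) ?(aS p3) ?(aS p4) ?(aS
    p5) //.
  rewrite -(perm_uniq (s1 := [:: b; b'] ++ (p1 :: s1 ++ p2 :: s2 ++ p3 :: s3 ++ p4 :: s4 ++ p5
    :: s5) ++ flatten [:: seq_of_opt d])).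
    by apply: uq; [move=> o; rewrite inE => /eqP->|rewrite /= orbF].
  by perm_count.
have cnt3 : count (on_cycle C) R = 3.
  by move: (count _ R) lt1 ge4 oddC => [|[|[|[|[]]]]].
(* A single row of the other parity would make four rows, three of them on the cycle, which [nbad]
   excludes; the number is odd. *)
have lt2 : 2 < count other R.
  case: (ltngtP (count other R) 1) => [|lt|e1].
  - by case: (count other R) odd_other.
  - by move: lt odd_other; case: (count other R) => [|[|[]]].
  - by have := nbad; rewrite -cntC cnt3 e1 => /(_ erefl).
have [d1 [d2 [d3 [R' [o1 o2 o3 pR']]]]] := pick_three lt2 uR.
have [d1R d2R d3R] : [/\ d1 \in R, d2 \in R & d3 \in R].
  by rewrite !(perm_mem pR') !inE !eqxx ?orbT.
have u3 : uniq [:: d1; d2; d3].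
  by have := uR; rewrite (perm_uniq pR') -/([:: d1; d2; d3] ++ R') cat_uniq => /andP[].
have sub3 : {subset [:: d1; d2; d3] <= R}.
  by move=> o; rewrite !inE => /or3P[]/eqP->.
have : 2 < count (fun x => Some x \in R) C by rewrite count_on_cycle // cnt3.
case/cycle_points3 => p1 [p2 [p3 [s1 [s2 [s3 [a1 a2 a3 pc pce]]]]]].
have inC x : x \in p1 :: s1 ++ p2 :: s2 ++ p3 :: s3 -> x \in C.
  by rewrite (perm_mem pc).
have [i1 i2 i3] : [/\ p1 \in C, p2 \in C & p3 \in C].
  by split; apply: inC; rewrite !(mem_cat, inE) eqxx ?orbT.
have [c1 c2 c3] : [/\ ~~ on_cycle C d1, ~~ on_cycle C d2 & ~~ on_cycle C d3].
  by split; apply: on_other.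
apply: (extend [:: Some p1; Some p2; Some p3; d1; d2; d3]) => //.
- by move=> o; rewrite !inE => /orP[/eqP->//|/orP[/eqP->//|/orP[/eqP->//|/or3P[]/eqP->//]]].
- have ud x o : x \in C -> ~~ on_cycle C o -> Some x != o.
    by move=> xC; apply: contraNneq => <-.
  rewrite -/([:: Some p1; Some p2; Some p3] ++ [:: d1; d2; d3]) cat_uniq u3 andbT.
  apply/andP; split.
    have : uniq [:: p1; p2; p3].
      have := uC; rewrite (perm_uniq pc) (perm_uniq (s2 := [:: p1; p2; p3] ++ s1 ++ s2 ++ s3)).
        by rewrite cat_uniq => /andP[].
      by perm_count.
    by rewrite -(map_inj_uniq (@Some_inj _)).
  by rewrite /= !inE ![_ == Some _]eq_sym !(negbTE (ud _ _ _ _)).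
apply: (good_perm (E := ce (p1 :: s1 ++ p2 :: s2 ++ p3 :: s3) ++ prows [:: Some p1; Some p2;
  Some p3; d1; d2; d3])).
  by rewrite perm_cat2r perm_sym.
apply: absorb_three_rows; rewrite -?(par_perm _ pce) ?(aS p1) ?(aS p2) ?(aS p3) //.
rewrite -(perm_uniq (s1 := [:: b; b'] ++ (p1 :: s1 ++ p2 :: s2 ++ p3 :: s3) ++ flatten (map
  (@seq_of_opt V) [:: d1; d2; d3]))).
  apply: uniq_cycle_rows cC pc (rows_ok_subset okR sub3 u3) _.
  by rewrite /= orbF !negb_or c1 c2 c3.
by perm_count.
Qed.

End Absorb.

(** * Several odd cycles with private vertices *)

Section Core.
Variables (V : finType) (sg : pred {set V}) (b b' : V).
Implicit Types (x p q : V) (C D : seq V) (d o : option V) (R : seq (option V)).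

Local Notation prow := (prow b b').
Local Notation prows := (prows b b').
Local Notation S o := (par sg (prow o)).
Local Notation odd_cycle := (odd_cycle sg b b').
Local Notation rows_ok := (rows_ok b b').

(* A cycle together with two vertices of it whose rows it may use. *)
Definition rooted := (seq V * V * V)%type.
Implicit Types (T : rooted) (L : seq rooted).

Definition linked T := [&& odd_cycle T.1.1, T.1.2 \in T.1.1 & T.2 \in T.1.1].
Definition balanced T := S (Some T.1.2) == S (Some T.2).
Definition private T : seq (option V) := [:: Some T.1.2; Some T.2].
Definition cycles L : seq {set V} := flatten [seq ce T.1.1 | T <- L].
Definition privates L := flatten (map private L).
Definition meeting L :=
  {in L &, forall T T', T != T' -> meet1 T.1.1 T'.1.1}.

Lemma uniq_privates L : uniq (privates L) -> uniq L.
Proof.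
elim: L => //= T L IH; rewrite /privates /= => /and3P[h _ /IH ->]; rewrite andbT.
apply: contra h => TL; rewrite inE; apply/orP; right.
by apply/flattenP; exists (private T); rewrite ?map_f // mem_head.
Qed.

Lemma size_privates L : ~~ odd (size (privates L)).
Proof. by elim: L => //= T L; rewrite negbK. Qed.

Lemma perm_cycles L L' : perm_eq L L' -> perm_eq (cycles L) (cycles L').
Proof. exact: perm_flatten_map. Qed.

Lemma perm_privates L L' : perm_eq L L' -> perm_eq (privates L) (privates L').
Proof. exact: perm_flatten_map. Qed.

Lemma cycles_cat L L' : cycles (L ++ L') = cycles L ++ cycles L'.
Proof. by rewrite /cycles map_cat flatten_cat. Qed.

Lemma privates_cat L L' : privates (L ++ L') = privates L ++ privates L'.
Proof. by rewrite /privates map_cat flatten_cat. Qed.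

Lemma good_two T T' : linked T -> linked T' -> balanced T -> balanced T' ->
  meet1 T.1.1 T'.1.1 -> uniq (private T ++ private T') ->
  good sg (ce T.1.1 ++ ce T'.1.1 ++ prows (private T ++ private T')).
Proof.
move=> /and3P[cC pC qC] /and3P[cD pD qD] /eqP eS /eqP eS' m u.
exact: merge_pair.
Qed.

Lemma good_balanced_even L : ~~ odd (size L) -> all linked L -> all balanced L ->
  meeting L -> uniq (privates L) -> good sg (cycles L ++ prows (privates L)).
Proof.
have [n] := ubnP (size L); elim: n L => // n IH [|T [|T' L]] //=.
  by move=> *; apply: good_nil.
rewrite !ltnS negbK => ltn ev /and3P[lT lT' lL] /and3P[bT bT' bL] m u.
have nTT' : T != T' by have /= := @uniq_privates [:: T, T' & L] u; rewrite inE negb_or =>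
  /andP[/andP[]].
have u' : uniq ((private T ++ private T') ++ privates L) by exact: u.
move: u'; rewrite cat_uniq => /and3P[u1 _ u2].
have g1 : good sg (ce T.1.1 ++ ce T'.1.1 ++ prows (private T ++ private T')).
  by apply: good_two => //; apply: m; rewrite ?inE ?eqxx ?orbT.
have g2 : good sg (cycles L ++ prows (privates L)).
  apply: IH => //; first exact: ltnW.
  by move=> T1 T2 h1 h2; apply: m; rewrite !inE ?h1 ?h2 !orbT.
apply: good_perm (good_cat g1 g2); rewrite /cycles /privates /= -!/(cycles L).
by rewrite -!/(privates L) (prows_cat _ _ (private T ++ private T') (privates L)); perm_count.
Qed.

Lemma linked_cycle T : linked T -> odd_cycle T.1.1.
Proof. by case/and3P. Qed.

Lemma linked_p T : linked T -> T.1.2 \in T.1.1.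
Proof. by case/and3P. Qed.

Lemma linked_q T : linked T -> T.2 \in T.1.1.
Proof. by case/and3P. Qed.

Lemma good_rest E F R : good sg E -> rows_ok R -> ~~ odd (size R) ->
  perm_eq F (E ++ prows R) -> ~~ par sg F -> good sg F.
Proof.
move=> gE okR evR pF evF; apply: (good_perm (E := E ++ prows R)).
  by rewrite perm_sym.
apply: good_cat (gE) _; apply: good_rows => //.
by move: evF; rewrite (par_perm _ pF) par_cat (negbTE (good_par gE)).
Qed.

(** The second and third cycles use up their private rows, and the first absorbs its own two and the
    spare rows [R0]. The excluded case is the one where this leaves four rows with three of them on
    the first cycle. *)
Lemma good_three_leftover T1 T2 T3 R0 :
  linked T1 -> linked T2 -> linked T3 -> balanced T2 -> balanced T3 ->
  meet1 T2.1.1 T3.1.1 ->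
  rows_ok (private T1 ++ private T2 ++ private T3 ++ R0) -> ~~ odd (size R0) ->
  ~~ par sg (cycles [:: T1; T2; T3] ++ prows (private T1 ++ private T2 ++ private T3 ++ R0)) ->
  (size R0 = 2 -> count (on_cycle T1.1.1) R0 != 1) ->
  good sg (cycles [:: T1; T2; T3] ++ prows (private T1 ++ private T2 ++ private T3 ++ R0)).
Proof.
move=> l1 l2 l3 b2 b3 m okR ev evp nbad; have [uR _ _] := rows_okE okR.
have g23 : good sg (ce T2.1.1 ++ ce T3.1.1 ++ prows (private T2 ++ private T3)).
  apply: good_two => //; move: uR; rewrite cat_uniq => /and3P[_ _].
  by rewrite catA cat_uniq => /andP[].
have ok1 : rows_ok (private T1 ++ R0).
  apply: (@rows_ok_sub _ _ _ (private T2 ++ private T3)).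
  by apply: rows_ok_perm okR; perm_count.
have pE : perm_eq ((ce T2.1.1 ++ ce T3.1.1 ++ prows (private T2 ++ private T3))
    ++ (ce T1.1.1 ++ prows (private T1 ++ R0)))
    (cycles [:: T1; T2; T3] ++ prows (private T1 ++ private T2 ++ private T3 ++ R0)).
  by rewrite !prows_cat /cycles /=; perm_count.
apply: good_perm (pE) _; apply: good_cat => //.
have [u1 _ _] := rows_okE ok1.
apply: (absorb_rows (p := T1.1.2) (q := T1.2)) => //.
- exact: linked_cycle.
- exact: linked_p.
- exact: linked_q.
- by move: u1; rewrite cat_uniq => /andP[]; rewrite /= inE andbT.
- by rewrite inE eqxx.
- by rewrite !inE eqxx orbT.
- by rewrite size_cat oddD.
- by move: evp; rewrite -(par_perm _ pE) par_cat (negbTE (good_par g23)).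
rewrite size_cat count_cat /= linked_p ?linked_q //= => -[e].
by rewrite !addSn !eqSS nbad.
Qed.

(** The row of the common vertex [x] gives a way out of the exception. If it differs from the first
    private row of one of the two cycles, that cycle absorbs just these two rows and the other two
    cycles are merged. Otherwise the first two cycles merge at [x] with one private row each, and
    the third is left with at least six rows. *)
Lemma good_three_at x T1 T2 T3 R0 :
  linked T1 -> linked T2 -> linked T3 -> balanced T1 -> balanced T2 -> balanced T3 ->
  meet1 T1.1.1 T2.1.1 -> meet1 T1.1.1 T3.1.1 -> meet1 T2.1.1 T3.1.1 ->
  x \in T1.1.1 -> x \in T2.1.1 -> Some x \in R0 ->
  rows_ok (private T1 ++ private T2 ++ private T3 ++ R0) -> ~~ odd (size R0) ->
  ~~ par sg (cycles [:: T1; T2; T3] ++ prows (private T1 ++ private T2 ++ private T3 ++ R0)) ->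
  good sg (cycles [:: T1; T2; T3] ++ prows (private T1 ++ private T2 ++ private T3 ++ R0)).
Proof.
move=> l1 l2 l3 b1 b2 b3 m12 m13 m23 x1 x2 xR okR ev evp.
have [R1 pR] : exists R1, perm_eq R0 (Some x :: R1).
  by exists (rem (Some x) R0); apply: perm_to_rem.
have sR : odd (size R1) by move: ev; rewrite (perm_size pR) /= negbK.
have pF : perm_eq (cycles [:: T1; T2; T3] ++ prows (private T1 ++ private T2 ++ private T3 ++ R0))
    (cycles [:: T1; T2; T3] ++ prows (private T1 ++ private T2 ++ private T3 ++ Some x :: R1)).
  by rewrite perm_cat2l; apply: prows_perm; rewrite !perm_cat2l.
have {}okR : rows_ok (private T1 ++ private T2 ++ private T3 ++ Some x :: R1).
  by apply: rows_ok_perm okR; rewrite !perm_cat2l.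
have [uR _ _] := rows_okE okR.
have [u12 u13 u23] : [/\ uniq (private T1 ++ private T2), uniq (private T1 ++ private T3)
    & uniq (private T2 ++ private T3)].
  split.
  - by move: uR; rewrite catA cat_uniq => /andP[].
  - move: uR; rewrite (perm_uniq (s2 := (private T1 ++ private T3) ++ private T2 ++ Some x ::
    R1)); last by perm_count.
    by rewrite cat_uniq => /andP[].
  - move: uR; rewrite (perm_uniq (s2 := (private T2 ++ private T3) ++ private T1 ++ Some x ::
    R1)); last by perm_count.
    by rewrite cat_uniq => /andP[].
have [ne1|e1] := eqVneq (S (Some T1.1.2)) (S (Some x)); last first.
  apply: (good_rest (E := (ce T1.1.1 ++ prows [:: Some T1.1.2; Some x]) ++
    (ce T2.1.1 ++ ce T3.1.1 ++ prows (private T2 ++ private T3))) (R := Some T1.2 :: R1)) => //.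
  - by apply: good_cat; [apply: absorb_unequal; rewrite ?linked_cycle ?linked_p|apply: good_two].
  - apply: (@rows_ok_sub _ _ _ ([:: Some T1.1.2; Some x] ++ private T2 ++ private T3)).
    by apply: rows_ok_perm okR; perm_count.
  - by rewrite /= sR.
  apply: perm_trans pF _; rewrite !(prows_cat, prows_cons) /cycles /=.
  by perm_count.
have [ne2|e2] := eqVneq (S (Some T2.1.2)) (S (Some x)); last first.
  apply: (good_rest (E := (ce T2.1.1 ++ prows [:: Some T2.1.2; Some x]) ++
    (ce T1.1.1 ++ ce T3.1.1 ++ prows (private T1 ++ private T3))) (R := Some T2.2 :: R1)) => //.
  - by apply: good_cat; [apply: absorb_unequal; rewrite ?linked_cycle ?linked_p|apply: good_two].
  - apply: (@rows_ok_sub _ _ _ ([:: Some T2.1.2; Some x] ++ private T1 ++ private T3)).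
    by apply: rows_ok_perm okR; perm_count.
  - by rewrite /= sR.
  apply: perm_trans pF _; rewrite !(prows_cat, prows_cons) /cycles /=.
  by perm_count.
have px o : o \in private T1 ++ private T2 -> o != Some x.
  move=> oT; move: uR; rewrite !catA cat_uniq => /and3P[_ + _] => /hasPn /(_ (Some x)).
  rewrite mem_head => /(_ isT); apply: contraNneq => <-.
  by rewrite mem_cat oT.
have g12 : good sg (ce T1.1.1 ++ ce T2.1.1 ++ prows [:: Some T1.1.2; Some T2.1.2]).
  apply: (merge_at (x := x)); rewrite ?linked_cycle ?linked_p //.
  - by have := px (Some T1.1.2); rewrite mem_head eq_sym => /(_ isT).
  - by have := px (Some T2.1.2); rewrite !inE eqxx !orbT eq_sym => /(_ isT).
  - by rewrite ne1 ne2.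
have ok3 : rows_ok (private T3 ++ [:: Some T1.2, Some T2.2, Some x & R1]).
  apply: (@rows_ok_sub _ _ _ [:: Some T1.1.2; Some T2.1.2]).
  by apply: rows_ok_perm okR; perm_count.
have pE : perm_eq ((ce T1.1.1 ++ ce T2.1.1 ++ prows [:: Some T1.1.2; Some T2.1.2])
    ++ (ce T3.1.1 ++ prows (private T3 ++ [:: Some T1.2, Some T2.2, Some x & R1])))
    (cycles [:: T1; T2; T3] ++ prows (private T1 ++ private T2 ++ private T3 ++ R0)).
  rewrite perm_sym; apply: perm_trans pF _; rewrite !(prows_cat, prows_cons) /cycles /=.
  by perm_count.
apply: good_perm (pE) _; apply: good_cat => //.
have [u1 _ _] := rows_okE ok3.
apply: (absorb_rows (p := T3.1.2) (q := T3.2)) => //.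
- exact: linked_cycle.
- exact: linked_p.
- exact: linked_q.
- by move: u1; rewrite cat_uniq => /andP[]; rewrite /= inE andbT.
- by rewrite inE eqxx.
- by rewrite !inE eqxx orbT.
- by rewrite /= sR.
- by move: evp; rewrite -(par_perm _ pE) par_cat (negbTE (good_par g12)).
Qed.

(** Each cycle in turn is tried as the one that absorbs the spare rows. If all three fail, there are
    two spare rows and each cycle contains exactly one of their vertices, so two cycles share one
    and [good_three_at] applies. *)
Lemma good_three T1 T2 T3 R0 :
  all linked [:: T1; T2; T3] -> all balanced [:: T1; T2; T3] ->
  meet1 T1.1.1 T2.1.1 -> meet1 T1.1.1 T3.1.1 -> meet1 T2.1.1 T3.1.1 ->
  rows_ok (privates [:: T1; T2; T3] ++ R0) -> ~~ odd (size R0) ->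
  ~~ par sg (cycles [:: T1; T2; T3] ++ prows (privates [:: T1; T2; T3] ++ R0)) ->
  good sg (cycles [:: T1; T2; T3] ++ prows (privates [:: T1; T2; T3] ++ R0)).
Proof.
rewrite /= !andbT => /and3P[l1 l2 l3] /and3P[b1 b2 b3] m12 m13 m23 okR ev evp.
have [m21 m31 m32] : [/\ meet1 T2.1.1 T1.1.1, meet1 T3.1.1 T1.1.1 & meet1 T3.1.1 T2.1.1].
  by split; apply: meet1C.
have permute S1 S2 S3 : perm_eq [:: S1; S2; S3] [:: T1; T2; T3] ->
  (rows_ok (private S1 ++ private S2 ++ private S3 ++ R0) ->
   ~~ par sg (cycles [:: S1; S2; S3] ++ prows (private S1 ++ private S2 ++ private S3 ++ R0)) ->
   good sg (cycles [:: S1; S2; S3] ++ prows (private S1 ++ private S2 ++ private S3 ++ R0))) ->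
  good sg (cycles [:: T1; T2; T3] ++ prows (privates [:: T1; T2; T3] ++ R0)).
  move=> pS gS; have pR : perm_eq (private S1 ++ private S2 ++ private S3 ++ R0)
                                  (privates [:: T1; T2; T3] ++ R0).
    exact: (perm_cat (perm_privates pS) (perm_refl R0)).
  have pF := perm_cat (perm_cycles pS) (prows_perm b b' pR).
  apply: good_perm (pF) _; apply: gS.
    by rewrite perm_sym in pR; apply: rows_ok_perm pR okR.
  by rewrite (par_perm _ pF).
have [nbad1|bad1] := boolP ((size R0 == 2) ==> (count (on_cycle T1.1.1) R0 != 1)).
  apply: (permute T1 T2 T3) => // ok' ev'; apply: good_three_leftover => //.
  by move=> e2; move: nbad1; rewrite e2.
have [nbad2|bad2] := boolP ((size R0 == 2) ==> (count (on_cycle T2.1.1) R0 != 1)).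
  apply: (permute T2 T1 T3) => [|ok' ev']; first by perm_count.
  by apply: good_three_leftover => // e2; move: nbad2; rewrite e2.
have [nbad3|bad3] := boolP ((size R0 == 2) ==> (count (on_cycle T3.1.1) R0 != 1)).
  apply: (permute T3 T1 T2) => [|ok' ev']; first by perm_count.
  by apply: good_three_leftover => // e2; move: nbad3; rewrite e2.
have at12 x : Some x \in R0 -> x \in T1.1.1 -> x \in T2.1.1 ->
    good sg (cycles [:: T1; T2; T3] ++ prows (privates [:: T1; T2; T3] ++ R0)).
  move=> xR x1 x2; apply: (permute T1 T2 T3) => // ok' ev'.
  exact: (good_three_at (x := x)).
have at13 x : Some x \in R0 -> x \in T1.1.1 -> x \in T3.1.1 ->
    good sg (cycles [:: T1; T2; T3] ++ prows (privates [:: T1; T2; T3] ++ R0)).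
  move=> xR x1 x2; apply: (permute T1 T3 T2) => [|ok' ev']; first by perm_count.
  exact: (good_three_at (x := x)).
have at23 x : Some x \in R0 -> x \in T2.1.1 -> x \in T3.1.1 ->
    good sg (cycles [:: T1; T2; T3] ++ prows (privates [:: T1; T2; T3] ++ R0)).
  move=> xR x1 x2; apply: (permute T2 T3 T1) => [|ok' ev']; first by perm_count.
  exact: (good_three_at (x := x)).
move: bad1; rewrite negb_imply => /andP[s2 /negPn c1].
move: bad2; rewrite negb_imply => /andP[_ /negPn c2].
move: bad3; rewrite negb_imply => /andP[_ /negPn c3].
move: R0 s2 c1 c2 c3 at12 at13 at23 {okR ev evp permute} => [|r [|r' []]] //= _.
rewrite !addn0; case: r r' => [x|] [y|] //=; rewrite ?addn0 ?add0n ?eqb1.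
- have xin : Some x \in [:: Some x; Some y] by rewrite mem_head.
  have yin : Some y \in [:: Some x; Some y] by rewrite !inE eqxx orbT.
  case x1: (x \in T1.1.1); case y1: (y \in T1.1.1) => // _;
  case x2: (x \in T2.1.1); case y2: (y \in T2.1.1) => // _;
  case x3: (x \in T3.1.1); case y3: (y \in T3.1.1) => // _ at12 at13 at23;
  solve [exact: at12 xin _ _|exact: at12 yin _ _|exact: at13 xin _ _
        |exact: at13 yin _ _|exact: at23 xin _ _|exact: at23 yin _ _].
- by move=> x1 x2 _ at12 _ _; apply: (at12 x); rewrite ?mem_head.
- by move=> y1 y2 _ at12 _ _; apply: (at12 y); rewrite ?inE ?eqxx ?orbT.
Qed.

(** Cycles are merged in pairs. If their number is odd and not one, three of them take all the spare
    rows, so the exception concerns only a single cycle. *)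
Lemma good_balanced L R : all linked L -> all balanced L -> meeting L ->
  uniq (privates L) -> {subset privates L <= R} -> rows_ok R -> ~~ odd (size R) ->
  ~~ par sg (cycles L ++ prows R) ->
  (forall T, L = [:: T] -> size R = 4 -> count (on_cycle T.1.1) R != 3) ->
  good sg (cycles L ++ prows R).
Proof.
move=> lL bL m uL sub okR evR ev nbad.
have [oL|eL] := boolP (odd (size L)); last first.
  apply: (@good_extend_rows _ _ _ _ _ R (privates L)) => //.
    exact: size_privates.
  exact: good_balanced_even.
have [R0 pR] := perm_subset uL sub.
have eR0 : ~~ odd (size R0).
  by move: evR; rewrite (perm_size pR) size_cat oddD (negbTE (size_privates L)).
case: L oL lL bL m uL sub ev nbad pR => [|T [|T2 [|T3 L]]] // oL.
  rewrite /= !andbT => lT _ _ uT sub ev nbad _; rewrite /cycles /= cats0 in ev *.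
  apply: (absorb_rows (p := T.1.2) (q := T.2)) => //; last exact: nbad.
  - exact: linked_cycle.
  - exact: linked_p.
  - exact: linked_q.
  - by apply: contraTneq uT => e; rewrite /privates /= inE e eqxx.
  - by apply: sub; rewrite /privates /= mem_head.
  - by apply: sub; rewrite /privates /= !inE eqxx orbT.
move=> lL bL m uL sub ev nbad pR.
have uT : uniq [:: T, T2, T3 & L] := uniq_privates uL.
have inL S0 : S0 \in [:: T; T2; T3] -> S0 \in [:: T, T2, T3 & L].
  by rewrite -[X in _ -> _ \in X]/([:: T; T2; T3] ++ L) mem_cat => ->.
have [m12 m13 m23] : [/\ meet1 T.1.1 T2.1.1, meet1 T.1.1 T3.1.1 & meet1 T2.1.1 T3.1.1].
  have := uT; rewrite /= !inE !negb_or => /and4P[/and3P[n12 n13 _] /andP[n23 _] _ _].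
  by split; apply: m => //; apply: inL; rewrite !inE eqxx ?orbT.
have [l3 lL'] : all linked [:: T; T2; T3] /\ all linked L.
  by apply/andP; rewrite -all_cat.
have [b3 bL'] : all balanced [:: T; T2; T3] /\ all balanced L.
  by apply/andP; rewrite -all_cat.
have eT : privates [:: T, T2, T3 & L] = privates [:: T; T2; T3] ++ privates L.
  by rewrite -privates_cat.
have gL : good sg (cycles L ++ prows (privates L)).
  apply: good_balanced_even => //; first by move: oL; rewrite /= !negbK.
    by move=> T' T'' h h'; apply: m; rewrite !inE ?h ?h' !orbT.
  by move: uL; rewrite eT cat_uniq => /and3P[].
have ok3 : rows_ok (privates [:: T; T2; T3] ++ R0).
  apply: (@rows_ok_sub _ _ _ (privates L)); apply: rows_ok_perm okR.
  by apply: perm_trans pR _; rewrite eT -catA; apply/permPl/perm_catCA.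
have pE : perm_eq ((cycles L ++ prows (privates L)) ++
      (cycles [:: T; T2; T3] ++ prows (privates [:: T; T2; T3] ++ R0)))
    (cycles [:: T, T2, T3 & L] ++ prows R).
  have pp := prows_perm b b' pR; rewrite perm_sym in pp.
  apply: perm_trans (perm_cat (perm_refl _) pp).
  rewrite eT -[[:: T, T2, T3 & L]]/([:: T; T2; T3] ++ L) cycles_cat !prows_cat.
  move: (cycles _) (prows _) (prows _) (prows _) (cycles _) => A B C D E.
  by perm_count.
apply: good_perm (pE) _; apply: good_cat => //; apply: good_three => //.
by move: ev; rewrite -(par_perm _ pE) par_cat (negbTE (good_par gL)).
Qed.

End Core.

(** * Edge lists of simple graphs *)

Section EdgeLists.
Variable V : finType.
Implicit Types (x y z : V) (s t c C D : seq V) (e : {set V}) (E H : seq {set V}).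

Definition degree_in H x := count (fun e : {set V} => x \in e) H.

Lemma degree_in_perm H H' x : perm_eq H H' -> degree_in H x = degree_in H' x.
Proof. by move/permP; apply. Qed.

Lemma degree_in_cat H H' x : degree_in (H ++ H') x = degree_in H x + degree_in H' x.
Proof. exact: count_cat. Qed.

Lemma mem_pe x y s e : e \in pe y s -> x \in e -> x \in y :: s.
Proof.
elim: s y => // z s IH y; rewrite inE => /orP[/eqP->|/IH h].
  by rewrite !inE => /orP[]->; rewrite ?orbT.
by move=> /h zs; rewrite inE zs orbT.
Qed.

Lemma ce_first x s : ce (x :: s) = [set last x s; x] :: pe x s.
Proof. by []. Qed.

Lemma pe_cons x y s : pe x (y :: s) = [set x; y] :: pe y s.
Proof. by []. Qed.

Lemma mem_ce x c e : e \in ce c -> x \in e -> x \in c.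
Proof.
case: c => // y s; rewrite (perm_mem (ce_cons y s)) => /mem_pe h /h.
by rewrite !inE mem_rcons inE => /orP[->|].
Qed.

Lemma has_ce x c : x \in c -> has (fun e : {set V} => x \in e) (ce c).
Proof.
case/rot_cycle_to => s [_ /perm_mem pce]; apply/hasP; exists [set last x s; x].
  by rewrite pce /ce /= inE eqxx.
by rewrite !inE eqxx orbT.
Qed.

Lemma uniq_pe y s : uniq (y :: s) -> uniq (pe y s).
Proof.
elim: s y => // z s IH y /andP[ys uzs]; rewrite cons_uniq -/(pe z s) IH // andbT.
by apply: contra ys => /mem_pe; apply; rewrite !inE eqxx.
Qed.

Lemma uniq_ce c : uniq c -> 2 < size c -> uniq (ce c).
Proof.
case: c => [|x [|y [|z s]]] // u _; rewrite ce_first cons_uniq uniq_pe // andbT.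
rewrite pe_cons in_cons negb_or; apply/andP; split; last first.
  move: u => /andP[xs _]; apply: contra xs => /mem_pe; apply.
  by rewrite !inE eqxx orbT.
apply/eqP => /setP/(_ (last x [:: y, z & s])); rewrite !inE eqxx /=.
move: u; rewrite /= !inE !negb_or => /and3P[/and3P[xy xz xs] /andP[yz ys] _].
have lz : last z s \in z :: s by apply: mem_last.
case: eqVneq => [e|_]; first by move: lz; rewrite e inE (negbTE xz) (negbTE xs).
case: eqVneq => // e; first by move: lz; rewrite e inE (negbTE yz) (negbTE ys).
Qed.

Lemma simple2_sub E H : {subset E <= H} -> simple2 H -> simple2 E.
Proof. by move=> sub /allP sH; apply/allP => e /sub /sH. Qed.

Lemma edge_at H e x : simple2 H -> e \in H -> x \in e ->
  exists2 y, x != y & e = [set x; y].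
Proof.
move=> /allP sH /sH /cards2P[u [v [uv ->]]]; rewrite !inE => /pred2P[]->.
  by exists v.
by exists u; rewrite 1?eq_sym // setUC.
Qed.

Definition joined H x y := (x != y) && ([set x; y] \in H).

Lemma joined_sym H : symmetric (joined H).
Proof. by move=> x y; rewrite /joined eq_sym setUC. Qed.

Lemma path_subset H x s : path (joined H) x s -> {subset pe x s <= H}.
Proof.
elim: s x => // y s IH x /= /andP[/andP[_ xyH] /IH h] e.
by rewrite inE => /orP[/eqP->|/h].
Qed.

Lemma set2_inj x y z : [set x; y] = [set x; z] -> y = z.
Proof.
move=> /setP h; have := h y; have := h z; rewrite !inE !eqxx !orbT.
by case: (eqVneq z x) (eqVneq y x) => [->|_] [->|_] //= /eqP.
Qed.

Lemma degree_nbrs H x s : uniq H -> simple2 H ->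
  (forall y, joined H x y -> y \in s) ->
  degree_in H x <= count (joined H x) s.
Proof.
move=> uH sH nb; rewrite /degree_in -!size_filter.
rewrite -(size_map (fun y => [set x; y]) (filter (joined H x) s)).
apply: uniq_leq_size; first exact: filter_uniq.
move=> e; rewrite mem_filter => /andP[xe eH].
have [y xy ee] := edge_at sH eH xe; rewrite ee in eH *.
have xyH : joined H x y by rewrite /joined xy.
by apply: map_f; rewrite mem_filter xyH nb.
Qed.

Lemma degree_bound H x s : uniq H -> simple2 H -> uniq s -> x \in s ->
  (forall e y, e \in H -> y \in e -> y \in s) -> degree_in H x <= (size s).-1.
Proof.
move=> uH sH us xs inS; have nb y : joined H x y -> y \in rem x s.
  case/andP=> xy /inS h; rewrite mem_rem_uniq // inE eq_sym xy h //.
  by rewrite !inE eqxx orbT.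
apply: leq_trans (degree_nbrs uH sH nb) _.
by rewrite (leq_trans (count_size _ _)) // size_rem.
Qed.

Lemma handshake H s : simple2 H -> uniq s ->
  (forall e y, e \in H -> y \in e -> y \in s) ->
  \sum_(x <- s) degree_in H x = (size H).*2.
Proof.
move=> sH us inS; rewrite /degree_in.
elim: H sH inS => [|e H IH] /= => [_ _|/andP[e2 sH] inS]; first by rewrite big1.
rewrite big_split /= IH //; last by move=> e' y e'H; apply: inS; rewrite inE e'H orbT.
rewrite doubleS -[RHS]add2n; congr (_ + _); rewrite -(eqP e2).
rewrite (eq_bigr (fun x => if x \in e then 1 else 0)); last by move=> x _; case: (x \in e).
rewrite -big_mkcond sum1_count -size_filter -(card_uniqP (filter_uniq _ us)).
apply: eq_card => x; rewrite mem_filter /=; case xe: (x \in e) => //=.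
by rewrite (inS e x) // mem_head.
Qed.

Definition eulerian_list H := forall x, ~~ odd (degree_in H x).

Lemma eulerian_ce c : simple2 (ce c) -> eulerian_list (ce c).
Proof. by move=> sc x; apply: even_degree_ce. Qed.

Lemma eulerian_rest E F H : perm_eq H (E ++ F) ->
  eulerian_list H -> eulerian_list E -> eulerian_list F.
Proof.
move=> pH eH eE x; have := eH x; rewrite (degree_in_perm _ pH) degree_in_cat oddD.
by rewrite (negbTE (eE x)).
Qed.

End EdgeLists.

(** * Longest paths and graphs all of whose cycles are odd *)

Section LongestPath.
Variables (V : finType) (sg : pred {set V}).
Implicit Types (x y z : V) (s t c C D : seq V) (e : {set V}) (E H : seq {set V}).

Definition simple_path H x s := path (joined H) x s && uniq (x :: s).

Definition longest H x s := simple_path H x s /\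
  forall y t, simple_path H y t -> size t <= size s.

Lemma exists_longest H x s : simple_path H x s ->
  exists y t, longest H y t /\ size s <= size t.
Proof.
move=> ps; pose P n := [exists y, exists t : n.-tuple V, simple_path H y t].
have exP : exists n, P n.
  by exists (size s); apply/existsP; exists x; apply/existsP; exists (in_tuple s).
have leP n : P n -> n <= #|V|.
  case/existsP=> y /existsP[t /andP[_ /card_uniqP u]].
  by have := max_card (mem (y :: t)); rewrite u /= size_tuple => /ltnW.
case: (ex_maxnP exP leP) => n /existsP[y /existsP[t pt]] mx.
have mx' z u : simple_path H z u -> size u <= n.
  by move=> pu; apply: mx; apply/existsP; exists z; apply/existsP; exists (in_tuple u).
exists y, t; rewrite size_tuple; split; last exact: mx' ps.
by split=> // z u; rewrite size_tuple; apply: mx'.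
Qed.

Lemma longest_nbrs H x s y : longest H x s -> joined H x y -> y \in s.
Proof.
case=> /andP[ps us] mx xy; apply/negPn/negP => ys.
have : simple_path H y (x :: s).
  rewrite /simple_path /= joined_sym xy ps /=; move: us => /= -> /=.
  rewrite andbT inE negb_or ys eq_sym andbT.
  by case/andP: xy.
by move/mx; rewrite /= ltnn.
Qed.

(** Rotation along the chord [xz]: the part before [z] is reversed, so the predecessor of [z]
    becomes the end of a path of the same length. *)
Lemma longest_rot H x t z s : longest H x (t ++ z :: s) -> joined H x z ->
  longest H (last x t) (rev (belast x t) ++ z :: s).
Proof.
case=> /andP[ps us] mx xz; split; last first.
  by move=> y u /mx; rewrite !size_cat size_rev size_belast.
move: ps; rewrite cat_path /= => /and3P[pt _ ps]; apply/andP; split.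
  rewrite cat_path /= rev_path (eq_path (e' := joined H)) ?pt; last first.
    by move=> y u; rewrite joined_sym.
  have -> : last (last x t) (rev (belast x t)) = x.
    by case: t {us mx pt} => // y t; rewrite /= rev_cons last_rcons.
  by rewrite xz ps.
have -> : last x t :: rev (belast x t) ++ z :: s = rev (x :: t) ++ z :: s.
  by rewrite [x :: t]lastI rev_rcons.
rewrite (perm_uniq (s2 := (x :: t) ++ z :: s)) //.
by rewrite perm_cat2r perm_rev.
Qed.

Lemma longest_rev H x s : longest H x s -> longest H (last x s) (rev (belast x s)).
Proof.
case=> /andP[ps us] mx; split; last by move=> y u /mx; rewrite size_rev size_belast.
apply/andP; split.
  by rewrite rev_path (eq_path (e' := joined H)) ?ps // => y u; rewrite joined_sym.
by rewrite -rev_rcons -lastI rev_uniq.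
Qed.

Definition all_odd H := forall c, uniq c -> 2 < size c -> {subset ce c <= H} ->
  par sg (ce c).

(* The third cycle of a theta graph in which two cycles are odd is even. *)
Lemma longest_degree H x s : uniq H -> simple2 H -> all_odd H -> longest H x s ->
  degree_in H x <= 2.
Proof.
move=> uH sH odd_H lx; rewrite leqNgt; apply/negP => deg.
have := leq_trans deg (degree_nbrs uH sH (fun y => longest_nbrs lx)).
case: lx => /andP[ps us] _.
have hE y : joined H x y -> [set x; y] \in H by case/andP.
move=> h3; have [|t1 [z1 [s1 [e1 a1 c1]]]] := @split_first _ (joined H x) s.
  by rewrite (leq_trans _ h3).
rewrite c1 in h3.
have [|t2 [z2 [s2 [e2 a2 c2]]]] := @split_first _ (joined H x) s1.
  by rewrite -ltnS (leq_trans _ h3).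
rewrite c2 in h3.
have [|t3 [z3 [s3 [e3 a3 _]]]] := @split_first _ (joined H x) s2.
  by rewrite -2!ltnS (leq_trans _ h3).
pose w := t1 ++ z1 :: t2.
have es : s = w ++ z2 :: t3 ++ z3 :: s3 by rewrite e1 e2 e3 /w -catA.
have sw : 0 < size w by rewrite /w size_cat addnS.
have sub : {subset pe x s <= H} := path_subset ps.
have esp : pe x s = pe x (rcons w z2) ++ pe z2 (rcons t3 z3) ++ pe z3 s3.
  by rewrite es pe_split pe_split.
have subX e : e \in pe x (rcons w z2) -> e \in H.
  by move=> h; apply: sub; rewrite esp mem_cat h.
have subY e : e \in pe z2 (rcons t3 z3) -> e \in H.
  by move=> h; apply: sub; rewrite esp !mem_cat h orbT.
have u1 : uniq (x :: w ++ [:: z2]).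
  move: us; rewrite es -cat_rcons -cats1 -cat_cons cat_uniq; by case/andP.
have u2 : uniq (x :: w ++ z2 :: t3 ++ [:: z3]).
  have e : s = (w ++ z2 :: t3 ++ [:: z3]) ++ s3 by rewrite es -!catA /= -catA.
  by move: us; rewrite e -cat_cons cat_uniq; case/andP.
have u3 : uniq (x :: [::] ++ z2 :: t3 ++ [:: z3]).
  by apply: subseq_uniq u2; rewrite /= eqxx suffix_subseq.
have o1 : par sg (ce (x :: w ++ [:: z2])).
  apply: odd_H => //; first by rewrite /= size_cat addn1.
  move=> e; rewrite (perm_mem (ce_arcs2 _ _ _ _)) mem_cat => /orP[/subX//|].
  by rewrite pe_cons in_cons orbF => /eqP->; rewrite setUC hE.
have o2 : par sg (ce (x :: w ++ z2 :: t3 ++ [:: z3])).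
  apply: odd_H => //; first by rewrite /= size_cat /= size_cat addn1 !addnS.
  move=> e; rewrite (perm_mem (ce_arcs3 _ _ _ _ _ _)) !mem_cat => /or3P[/subX//|/subY//|].
  by rewrite pe_cons in_cons orbF => /eqP->; rewrite setUC hE.
have o3 : par sg (ce (x :: [::] ++ z2 :: t3 ++ [:: z3])).
  apply: odd_H => //; first by rewrite /= size_cat addn1.
  move=> e; rewrite (perm_mem (ce_arcs3 _ _ _ _ _ _)) !mem_cat => /or3P[|/subY//|].
    by rewrite pe_cons in_cons orbF => /eqP->; rewrite hE.
  by rewrite pe_cons in_cons orbF => /eqP->; rewrite setUC hE.
move: o1 o2 o3; rewrite par_ce2 !par_ce3 /=.
have -> : par sg (pe z2 [:: x]) = par sg (pe x [:: z2]) by rewrite !pe_cons setUC.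
by do 4 case: par.
Qed.

(** All neighbours of the end lie on the path. The later of two of them is not the next vertex,
    which [0 < size w] records. *)
Lemma longest_chord H x s : uniq H -> simple2 H -> longest H x s ->
  1 < degree_in H x ->
  exists w z t, [/\ s = w ++ z :: t, 0 < size w & joined H x z].
Proof.
move=> uH sH lx deg.
have h2 := leq_trans deg (degree_nbrs uH sH (fun y => longest_nbrs lx)).
have [|t1 [z1 [s1 [e1 a1 c1]]]] := @split_first _ (joined H x) s.
  by rewrite (leq_trans _ h2).
rewrite c1 in h2.
have [|t2 [z2 [s2 [e2 a2 c2]]]] := @split_first _ (joined H x) s1.
  by rewrite -ltnS (leq_trans _ h2).
by exists (t1 ++ z1 :: t2), z2, s2; rewrite e1 e2 -catA size_cat addnS.
Qed.

Lemma chord_cycle H x w z t : simple_path H x (w ++ z :: t) -> 0 < size w ->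
  joined H x z ->
  [/\ uniq (x :: w ++ [:: z]), 2 < size (x :: w ++ [:: z]) &
      {subset ce (x :: w ++ [:: z]) <= H}].
Proof.
case/andP=> ps us sw /andP[_ xz]; split; last 1 first.
- move=> e; rewrite (perm_mem (ce_arcs2 _ _ _ _)) mem_cat => /orP[he|].
    by apply: (path_subset ps); rewrite pe_split mem_cat he.
  by rewrite pe_cons in_cons orbF => /eqP->; rewrite setUC.
- have e : w ++ z :: t = (w ++ [:: z]) ++ t by rewrite -catA.
  by move: us; rewrite e -cat_cons cat_uniq => /andP[].
by rewrite /= size_cat addn1.
Qed.

Lemma edge_path H e : simple2 H -> e \in H -> exists x y, simple_path H x [:: y].
Proof.
move=> sH eH; have /cards2P[x [y [xy ee]]] := allP sH e eH.
by exists x, y; rewrite /simple_path /= /joined xy -ee eH inE xy.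
Qed.

Lemma longest_degree_pos H x s : longest H x s -> 0 < size s -> 0 < degree_in H x.
Proof.
case=> /andP[ps _] _; case: s ps => //= y s /andP[/andP[_ xyH] _] _.
by rewrite -has_count; apply/hasP; exists [set x; y]; rewrite // !inE eqxx.
Qed.

Lemma exists_cycle H : uniq H -> simple2 H -> eulerian_list H -> H != [::] ->
  exists c, [/\ uniq c, 2 < size c & {subset ce c <= H}].
Proof.
case: H => // e H uH sH eH _; have [x [y pxy]] := edge_path sH (mem_head e H).
have [z [t [lz st]]] := exists_longest pxy.
have deg : 1 < degree_in (e :: H) z.
  have := longest_degree_pos lz st; have := eH z.
  by case: (degree_in _ z) => [|[|]].
have [w [z' [u [eu sw zz']]]] := longest_chord uH sH lz deg.
case: lz => pz _; rewrite eu in pz.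
by have [] := chord_cycle pz sw zz'; exists (z :: w ++ [:: z']).
Qed.

Lemma cycle_rest H c : uniq H -> uniq c -> 2 < size c -> {subset ce c <= H} ->
  exists F, perm_eq H (ce c ++ F).
Proof. by move=> uH uc sc sub; apply: perm_subset => //; apply: uniq_ce. Qed.

(** The end [p] of a longest path has degree two and hence a chord. Rotating along it gives a
    longest path from another vertex of the cycle closed by the chord, so this vertex has degree two
    as well. The cycle uses up all edges at both. *)
Lemma leaf_cycle H : uniq H -> simple2 H -> eulerian_list H -> all_odd H ->
  H != [::] -> exists c p q F,
  [/\ [/\ uniq c, 2 < size c & perm_eq H (ce c ++ F)],
      [/\ p \in c, q \in c & p != q], degree_in F p = 0 & degree_in F q = 0].
Proof.
case: H => // e H uH sH eH oH _; have [x [y pxy]] := edge_path sH (mem_head e H).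
have [p [t [lp st]]] := exists_longest pxy.
have deg z s : longest (e :: H) z s -> 0 < size s -> degree_in (e :: H) z = 2.
  move=> lz st'; have := longest_degree_pos lz st'; have := eH z.
  have := longest_degree uH sH oH lz.
  by case: (degree_in _ z) => [|[|[|]]].
have degp := deg _ _ lp st.
have [w [z [u [eu sw pz]]]] := longest_chord uH sH lp (eq_leq (esym degp)).
rewrite eu in lp; have [pp _] := lp; have [uc sc sub] := chord_cycle pp sw pz.
have [F pF] := cycle_rest uH uc sc sub.
have lq := longest_rot lp pz.
have degq := deg _ _ lq (_ : 0 < size _); rewrite size_cat addnS in degq.
have qw : last p w \in w by case: (w) sw => // v w' _ /=; apply: mem_last.
have inc v : v \in p :: w ++ [:: z] -> degree_in (e :: H) v = 2 -> degree_in F v = 0.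
  move=> vc; rewrite (degree_in_perm _ pF) degree_in_cat.
  have := has_ce vc; rewrite has_count -/(degree_in _ v).
  have sce : simple2 (ce (p :: w ++ [:: z])) by apply: simple2_sub sub sH.
  have := eulerian_ce sce v.
  by case: (degree_in _ v) => [|[|[|n]]] // _ _ [].
exists (p :: w ++ [:: z]), p, (last p w), F; split => //.
- split; rewrite ?mem_head // ?inE ?mem_cat ?qw ?orbT //.
  by move: uc => /= /andP[pw _]; apply: contraNneq pw => {1}->; rewrite mem_cat qw.
- by apply: inc; rewrite ?mem_head.
by apply: inc; rewrite ?degq // inE mem_cat qw orbT.
Qed.

Lemma all_odd_sub H F : {subset F <= H} -> all_odd H -> all_odd F.
Proof. by move=> FH oH c uc sc cF; apply: oH => // e /cF /FH. Qed.

(** Two common vertices yield a theta graph: a piece of [D] is a third path between two vertices of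
    [C]. The parities of the three cycles of a theta graph have even sum, so they are not all
    odd. *)
Lemma all_odd_meet1 H C D : simple2 H -> all_odd H -> uniq C -> uniq D ->
  2 < size C -> {subset ce C ++ ce D <= H} -> uniq (ce C ++ ce D) -> meet1 C D.
Proof.
move=> sH oH uC uD sC sub uCD x y xC xD yC yD; apply/eqP/negPn/negP => xy.
have [s [pD pceD]] := rot_cycle_to xD.
have ys : y \in s by move: yD; rewrite (perm_mem pD) inE eq_sym (negbTE xy).
have hasC : has (mem C) s by apply/hasP; exists y.
(* [v] is the first vertex of [C] that [D] meets after [x], so the interior [t] between them avoids
   [C]. *)
case/split_find: hasC pD pceD {ys} => v t u /= vC tC; rewrite cat_rcons => pD pceD.
have := uD; rewrite (perm_uniq pD) => uxt.
have xv : x != v by move: uxt; rewrite cons_uniq => /andP[+ _]; apply: contraNneq => ->; rewrite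
  mem_cat mem_head orbT.
have [P [P' [pC pceC]]] := rot_cycle_to2 uC xC vC xv.
have := uC; rewrite (perm_uniq pC) => uxP.
have edgeD e : e \in pe x (rcons t v) -> e \in ce D.
  by move=> h; rewrite (perm_mem pceD) (perm_mem (ce_arcs2 _ _ _ _)) mem_cat h.
have edgeC e : e \in pe x (rcons P v) ++ pe v (rcons P' x) -> e \in ce C.
  by move=> h; rewrite (perm_mem pceC) (perm_mem (ce_arcs2 _ _ _ _)).
have dis e : e \in ce C -> e \in ce D -> False.
  move=> eC eD; move: uCD; rewrite cat_uniq => /and3P[_ /hasPn /(_ e eD) /negP].
  exact.
have tP : ~~ has (mem (P ++ P')) t.
  apply: contra tC => /hasP[w wt wP]; apply/hasP; exists w => //=.
  by rewrite (perm_mem pC) inE mem_cat inE; move: wP; rewrite /= mem_cat => /orP[]->; rewrite ?orbT.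
have xt : x \notin t ++ [:: v].
  by move: uxt; rewrite cons_uniq => /andP[+ _]; apply: contra; rewrite !mem_cat !inE =>
    /orP[]->; rewrite ?orbT.
have ut : uniq (t ++ [:: v]).
  by move: uxt; rewrite cons_uniq -cat_rcons cats1 cat_uniq => /and3P[].
have uxtP : uniq ((x :: t ++ [:: v]) ++ P ++ P').
  rewrite cat_uniq cons_uniq xt ut /=; apply/andP; split; last first.
    move: uxP; rewrite cons_uniq => /andP[_]; rewrite -cat_rcons -cats1 -catA uniq_catCA.
    by rewrite cat_uniq => /and3P[].
  apply/hasPn => w wP; rewrite /= inE mem_cat inE !negb_or.
  have := uxP; rewrite (perm_uniq (s2 := [:: x; v] ++ P ++ P')); last by perm_count.
  rewrite cat_uniq => /and3P[_ /hasPn /(_ w wP)].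
  rewrite /= !inE negb_or => /andP[-> ->] _; rewrite andbT /=.
  by apply: contra tP => wt; apply/hasP; exists w.
have o1 : par sg (ce (x :: P ++ v :: rev t)).
  apply: oH.
  - have := uxtP; rewrite (perm_uniq (s2 := (x :: P ++ v :: rev t) ++ P')).
      by rewrite cat_uniq => /andP[].
    by apply/permP => a; rewrite /=; repeat rewrite count_cat /=; rewrite count_rev; count_lia.
  - rewrite /= size_cat /= size_rev.
    (* If both interiors were empty, the edge [xv] would belong to [C] and to [D]. *)
    case: (P) edgeC (t) edgeD => [|? ?] //= edgeC; last by count_lia.
    move=> [|? ?] //= edgeD; exfalso; apply: (dis [set x; v]).
      by apply: edgeC; apply: mem_head.
    by apply: edgeD; apply: mem_head.
  move=> e; rewrite (perm_mem (ce_arcs2 _ _ _ _)) mem_cat => /orP[h|h]; apply: sub.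
    by rewrite mem_cat edgeC // mem_cat h.
  by rewrite mem_cat edgeD ?orbT // -(perm_mem (pe_rev _ _ _)).
have o2 : par sg (ce (x :: t ++ v :: P')).
  apply: oH.
  - have := uxtP; rewrite (perm_uniq (s2 := (x :: t ++ v :: P') ++ P)).
      by rewrite cat_uniq => /andP[].
    by perm_count.
  - rewrite /= size_cat /=.
    case: (P') edgeC (t) edgeD => [|? ?] //= edgeC; last by count_lia.
    move=> [|? ?] /= edgeD; last by count_lia.
    exfalso; apply: (dis [set x; v]).
      by apply: edgeC; rewrite mem_cat; apply/orP; right; rewrite setUC; apply: mem_head.
    by apply: edgeD; apply: mem_head.
  move=> e; rewrite (perm_mem (ce_arcs2 _ _ _ _)) mem_cat => /orP[h|h]; apply: sub.
    by rewrite mem_cat edgeD ?orbT.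
  by rewrite mem_cat edgeC // mem_cat h orbT.
have oC : par sg (ce C).
  by apply: oH => // e eC; apply: sub; rewrite mem_cat eC.
move: oC o1 o2; rewrite (par_perm _ pceC) !par_ce2 (par_perm _ (pe_rev x t v)).
by do 3 case: par.
Qed.

End LongestPath.

(** * Eulerian graphs with rows between two terminals *)

Section Terminals.
Variables (V : finType) (sg : pred {set V}) (b b' : V).
Implicit Types (x p q : V) (C D : seq V) (d o : option V) (R : seq (option V)).
Implicit Types (T : rooted V) (L : seq (rooted V)) (E F H : seq {set V}).

Local Notation prow := (prow b b').
Local Notation prows := (prows b b').
Local Notation S o := (par sg (prow o)).
Local Notation odd_cycle := (odd_cycle sg b b').
Local Notation rows_ok := (rows_ok b b').
Local Notation linked := (linked sg b b').
Local Notation balanced := (balanced sg b b').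

Definition covered L x := has (fun T => x \in T.1.1) L.

(* In a list produced by removing leaf cycles one after the other, the two
   private vertices of a cycle avoid all later cycles; they can be chosen
   balanced unless the later cycles cover the rest of the cycle. *)
Fixpoint elimination L : Prop :=
  if L is T :: L' then
    [/\ [/\ linked T, 2 < size T.1.1 & T.1.2 != T.2],
        ~~ covered L' T.1.2 /\ ~~ covered L' T.2,
        {in L', forall T', meet1 T.1.1 T'.1.1},
        balanced T \/ {in T.1.1, forall x, x != T.1.2 -> x != T.2 -> covered L' x}
      & elimination L']
  else True.

Lemma cycles_edges L T : T \in L -> {subset ce T.1.1 <= cycles L}.
Proof.
move=> TL e eT; apply/flattenP; exists (ce T.1.1) => //.
exact: (map_f (fun T => ce T.1.1)).
Qed.

Lemma cycles_split L T : T \in L -> exists F, perm_eq (cycles L) (ce T.1.1 ++ F).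
Proof.
by move=> /perm_to_rem pL; exists (cycles (rem T L)); apply: (perm_cycles pL).
Qed.

Lemma covered_degree L x : covered L x -> 0 < degree_in (cycles L) x.
Proof.
case/hasP=> T TL /has_ce /hasP[e eT xe]; rewrite -has_count; apply/hasP.
by exists e => //; apply: cycles_edges eT.
Qed.

Lemma elimination_linked L : elimination L -> all linked L.
Proof. by elim: L => //= T L IH [[-> _ _] _ _ _ /IH]. Qed.

Lemma exists_elimination H : b != b' -> uniq H -> simple2 H -> eulerian_list H ->
  all_odd sg H -> degree_in H b = 0 -> degree_in H b' = 0 ->
  exists L, elimination L /\ perm_eq H (cycles L).
Proof.
move=> bb; have [n] := ubnP (size H); elim: n H => // n IH H ltn uH sH eH oH b0 b'0.
have [->|nH] := eqVneq H [::]; first by exists [::].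
have [c [p [q [F [[uc sc pF] [pc qc pq] Fp Fq]]]]] := leaf_cycle uH sH eH oH nH.
have subc : {subset ce c <= H} by move=> e ec; rewrite (perm_mem pF) mem_cat ec.
have subF : {subset F <= H} by move=> e ec; rewrite (perm_mem pF) mem_cat ec orbT.
have sce := simple2_sub subc sH.
have degF x : degree_in H x = degree_in (ce c) x + degree_in F x.
  by rewrite (degree_in_perm _ pF) degree_in_cat.
have := uH; rewrite (perm_uniq pF) => uF; have /and3P[_ _ uF'] : [&& uniq (ce c), ~~ has (mem
  (ce c)) F & uniq F].
  by rewrite -cat_uniq.
have [|||||||L [eL pL]] := IH F => //.
- rewrite -ltnS; apply: leq_trans ltn; rewrite ltnS (perm_size pF) size_cat size_ce.
  by rewrite -add1n leq_add2r (leq_trans _ sc).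
- exact: simple2_sub subF sH.
- exact: eulerian_rest pF eH (eulerian_ce sce).
- exact: all_odd_sub subF oH.
- by move/eqP: b0; rewrite degF addn_eq0 => /andP[_ /eqP].
- by move/eqP: b'0; rewrite degF addn_eq0 => /andP[_ /eqP].
have ncov x : degree_in F x = 0 -> ~~ covered L x.
  by rewrite (degree_in_perm _ pL); apply: contra_eqN => /covered_degree; case: degree_in.
have notc x : degree_in H x = 0 -> x \notin c.
  rewrite degF; apply: contra_eqN => /has_ce; rewrite has_count -/(degree_in _ x).
  by case: degree_in.
have okc : odd_cycle c.
  by rewrite /odd_cycle /= inE negb_or bb !notc // uc oH.
have meets : {in L, forall T', meet1 c T'.1.1}.
  move=> T' T'L; have subT := cycles_edges T'L.
  have sub' : {subset ce T'.1.1 <= F} by move=> e /subT; rewrite (perm_mem pL).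
  apply: (all_odd_meet1 sH oH) => //.
  - by have /and3P[/odd_cycleE[]] := allP (elimination_linked eL) T' T'L.
  - by move=> e; rewrite mem_cat => /orP[/subc|/sub' /subF].
  have [F' pF'] := cycles_split T'L; have pF2 := perm_trans pL pF'.
  have := uF; rewrite (perm_uniq (perm_cat (perm_refl (ce c)) pF2)) catA.
  by rewrite cat_uniq => /andP[].
have mk p' q' : p' \in c -> q' \in c -> p' != q' -> ~~ covered L p' -> ~~ covered L q' ->
    (balanced (c, p', q') \/ {in c, forall x, x != p' -> x != q' -> covered L x}) ->
    exists L, elimination L /\ perm_eq H (cycles L).
  move=> p'c q'c pq' np nq bal; exists ((c, p', q') :: L); split.
    by split=> //; split=> //; rewrite /linked /= okc p'c q'c.
  by apply: perm_trans pF _; rewrite /cycles /= perm_cat2l.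
have [bal|nbal] := boolP (balanced (c, p, q)).
  by apply: (mk p q) => //; rewrite ?ncov //; left.
have [|all_cov] := boolP (has (fun x => [&& x != p, x != q & ~~ covered L x]) c); last first.
  apply: (mk p q); rewrite ?ncov //; right=> x xc xp xq.
  by have := hasPn all_cov x xc; rewrite xp xq /= negbK.
(* The rows of [p] and [q] differ, so the row of the third uncovered vertex [x] agrees with one of
   them. *)
case/hasP=> x xc /and3P[xp xq ncx].
have : balanced (c, x, p) || balanced (c, x, q).
  by move: nbal; rewrite /balanced /=; do 3 case: par.
by case/orP=> bal; [exact: (mk x p xc pc xp ncx (ncov p Fp) (or_introl bal))
                   |exact: (mk x q xc qc xq ncx (ncov q Fq) (or_introl bal))].
Qed.

Lemma elimination_uniq L : elimination L -> uniq (privates L).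
Proof.
elim: L => //= T L IH [[_ _ pq] [np nq] _ _ eL].
have lL := elimination_linked eL.
have cov x : Some x \in privates L -> covered L x.
  case/flattenP=> s /mapP[T' T'L ->]; have := allP lL T' T'L => /and3P[_ pT qT].
  by rewrite !inE => /orP[]/eqP[->]; apply/hasP; exists T'.
rewrite /privates /= -/(privates L) inE negb_or IH //; apply/and3P; split => //.
  by apply/andP; split; [apply: contra pq => /eqP[->]|apply: contra np => /cov].
by apply: contra nq => /cov.
Qed.

Lemma elimination_meeting L : elimination L -> meeting L.
Proof.
elim: L => // T L IH [_ _ m _ eL] T1 T2; rewrite !inE.
case/orP=> [/eqP->|h1] /orP[/eqP->|h2] ne.
- by rewrite eqxx in ne.
- exact: m.
- by apply: meet1C; apply: m.
- exact: IH.
Qed.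

Lemma elimination_size L T : elimination L -> T \in L ->
  2 < size T.1.1 /\ T.1.2 != T.2.
Proof.
elim: L => // T' L IH [[_ sT pq] _ _ _ eL]; rewrite inE => /orP[/eqP->//|].
exact: IH.
Qed.

Lemma elimination_cat L L' : elimination (L ++ L') -> elimination L'.
Proof. by elim: L => //= T L IH [_ _ _ _ /IH]. Qed.

(** No later cycle can cover the third vertex of the last cycle, so its two private vertices are
    balanced. *)
Lemma elimination_last L T : elimination (rcons L T) -> balanced T /\
  {in L, forall T', T'.1.2 \notin T.1.1 /\ T'.2 \notin T.1.1}.
Proof.
move=> eL; split.
  have := eL; rewrite -cats1 => /elimination_cat [[/and3P[cT _ _] sT _] _ _ [//|cov] _].
  have [uT _ _ _ _] := odd_cycleE cT.
  have : size T.1.1 <= size [:: T.1.2; T.2].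
    apply: uniq_leq_size => // x xT; rewrite !inE.
    case: eqVneq => //= xp; case: eqVneq => // xq.
    by have := cov x xT xp xq.
  by rewrite leqNgt sT.
elim: L eL => //= T' L IH [_ [np nq] _ _ /IH h] T1.
rewrite inE => /orP[/eqP->|/h//].
by move: np nq; rewrite /covered !has_rcons !negb_or => /andP[-> _] /andP[-> _].
Qed.

Lemma elimination_last2 L T1 T2 : elimination (rcons (rcons L T1) T2) ->
  ~~ balanced T1 -> {in T1.1.1, forall x, x != T1.1.2 -> x != T1.2 -> x \in T2.1.1}.
Proof.
rewrite -!cats1 -catA => /elimination_cat /= [_ _ _ [->//|cov] _] _ x xT xp xq.
by have := cov x xT xp xq; rewrite /covered /= orbF.
Qed.

Lemma good_unbalanced L : all linked L -> all (predC balanced) L ->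
  good sg (cycles L ++ prows (privates L)).
Proof.
elim: L => [|T L IH] /=; first by move=> *; apply: good_nil.
case/andP=> lT lL /andP[bT bL].
apply: (good_perm (E := (ce T.1.1 ++ prows (private T)) ++ (cycles L ++ prows (privates L)))).
  by rewrite /privates /= (prows_cat _ _ (private T) (privates L)) /cycles /=; perm_count.
apply: good_cat (IH lL bL); have /and3P[cT pT qT] := lT.
exact: absorb_unequal.
Qed.

(* The four leftover rows are three rows on the triangle [C] and one other. The
   previous cycle [C'] is unbalanced and covered by [C] except for its two
   private vertices, so it meets [C] in some [x]; it can use the row of [x] and
   one of its own, which leaves a row off [C] of the same parity as [C]. *)
Lemma good_last_two C C' p q R : odd_cycle C -> odd_cycle C' -> meet1 C' C ->
  2 < size C' -> p \in C' -> q \in C' -> p \notin C -> q \notin C -> p != q ->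
  S (Some p) != S (Some q) ->
  {in C', forall x, x != p -> x != q -> x \in C} ->
  rows_ok (Some p :: Some q :: R) -> {in C, forall x, Some x \in R} ->
  size R = 4 -> count (on_cycle C) R = 3 ->
  ~~ par sg (ce C ++ ce C' ++ prows (Some p :: Some q :: R)) ->
  good sg (ce C ++ ce C' ++ prows (Some p :: Some q :: R)).
Proof.
move=> cC cC' m sC' pC' qC' pC qC pq neS covC okR rowC sR cR ev.
have [uR _ _] := rows_okE okR.
have okR' : rows_ok R.
  exact: (@rows_ok_sub _ _ _ [:: Some p; Some q]).
have [uR' _ _] := rows_okE okR'.
have g1 : good sg (ce C' ++ prows [:: Some p; Some q]) by apply: absorb_unequal.
have [uC' _ _ _ _] := odd_cycleE cC'.
have [x xC' /andP[xp xq]] : exists2 x, x \in C' & (x != p) && (x != q).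
  apply/hasP; rewrite has_count -size_filter.
  have : size (filter (predC (fun x => (x != p) && (x != q))) C') <= 2.
    rewrite -[2]/(size [:: p; q]); apply: uniq_leq_size; first exact: filter_uniq.
    by move=> x; rewrite mem_filter !inE /= negb_and !negbK => /andP[].
  move: sC'; rewrite -(count_predC (fun x => (x != p) && (x != q)) C') -!size_filter.
  by case: (size _) => //; rewrite add0n => h1 h2; have := leq_trans h1 h2.
have xC := covC x xC' xp xq; have xR := rowC x xC.
have [R1 pR] : exists R1, perm_eq R (Some x :: R1).
  by exists (rem (Some x) R); apply: perm_to_rem.
have sR1 : size R1 = 3 by have := perm_size pR; rewrite sR => -[].
have cR1 : count (on_cycle C) R1 = 2.
  by have := permP pR (on_cycle C); rewrite cR /= xC => -[].
have uxR1 : uniq (Some x :: R1) by rewrite -(perm_uniq pR).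
have step u v : [|| (u == p) && (v == q) | (u == q) && (v == p)] ->
    S (Some u) != S (Some x) -> good sg (ce C ++ ce C' ++ prows (Some p :: Some q :: R)).
  move=> uv ne; have pF : perm_eq
      ((ce C' ++ prows [:: Some u; Some x]) ++ (ce C ++ prows (Some v :: R1)))
      (ce C ++ ce C' ++ prows (Some p :: Some q :: R)).
    have pp := prows_perm b b' pR; rewrite perm_sym in pp.
    rewrite !prows_cons; apply: (perm_trans (y := ce C ++ ce C' ++ prow (Some p)
      ++ prow (Some q) ++ prows (Some x :: R1))); last by rewrite !perm_cat2l.
    by case/orP: uv => /andP[/eqP-> /eqP->]; rewrite !prows_cons; perm_count.
  have [uinC' vC] : u \in C' /\ v \notin C by case/orP: uv => /andP[/eqP-> /eqP->].
  have gu : good sg (ce C' ++ prows [:: Some u; Some x]) by apply: absorb_unequal.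
  apply: good_perm (pF) _; apply: good_cat => //.
  have [y [z [yz yC zC yR zR]]] : exists y z,
      [/\ y != z, y \in C, z \in C, Some y \in R1 & Some z \in R1].
    have c2 : size (filter (on_cycle C) R1) = 2 by rewrite size_filter.
    have uf : uniq (filter (on_cycle C) R1).
      by apply: filter_uniq; case/andP: uxR1.
    have mf o : o \in filter (on_cycle C) R1 -> on_cycle C o && (o \in R1).
      by rewrite mem_filter.
    move: c2 uf mf; case: (filter _ R1) => [|[y|] [|[z|] []]] //= _.
    - rewrite inE andbT => yz mf; exists y, z.
      have /andP[yC yR] := mf (Some y) (mem_head _ _).
      have /andP[zC zR] : on_cycle C (Some z) && (Some z \in R1).
        by apply: mf; rewrite !inE eqxx orbT.
      by split=> //; apply: contraNneq yz => ->.
    - by move=> _ /(_ None); rewrite !inE ?eqxx ?orbT /= => /(_ isT).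
    - by move=> _ /(_ None); rewrite !inE ?eqxx ?orbT /= => /(_ isT).
  have okv : rows_ok (Some v :: R1).
    apply: (@rows_ok_sub _ _ _ [:: Some u; Some x]).
    apply: rows_ok_perm okR.
    apply: (perm_trans (y := [:: Some p, Some q, Some x & R1])).
      by rewrite !perm_cons.
    by case/orP: uv => /andP[/eqP-> /eqP->]; perm_count.
  apply: (absorb_rows cC yC zC yz okv) => //.
  - by rewrite inE yR orbT.
  - by rewrite inE zR orbT.
  - by rewrite /= sR1.
  - by move: ev; rewrite -(par_perm _ pF) par_cat (negbTE (good_par gu)).
  - by move=> _; rewrite /= (negbTE vC) cR1.
have : (S (Some p) != S (Some x)) || (S (Some q) != S (Some x)).
  by move: neS; do 3 case: par.
by case/orP; [apply: (step p q)|apply: (step q p)]; rewrite !eqxx ?orbT.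
Qed.

Lemma rcons_nonempty (U : eqType) (s : seq U) :
  s != [::] -> exists (s' : seq U) (x : U), s = rcons s' x.
Proof. by case/lastP: s => // s x _; exists s, x. Qed.

Definition incident_rows H R :=
  forall e x, e \in H -> x \in e -> Some x \in R.

(** An unbalanced cycle is settled by its own two rows, and [good_balanced] treats the balanced ones
    with all other rows. The exception can arise only for a single balanced cycle, which is then the
    last of the elimination. If it is the whole graph, the hypothesis excludes it; otherwise the
    cycle before it is unbalanced and [good_last_two] treats both together. *)
Lemma good_odd_terminals H R : b != b' -> uniq H -> simple2 H -> eulerian_list H ->
  all_odd sg H -> rows_ok R -> incident_rows H R -> ~~ odd (size R) ->
  ~~ par sg (H ++ prows R) -> (size R = 4 -> size H != 3) ->
  good sg (H ++ prows R).
Proof.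
move=> bb uH sH eH oH okR inR evR ev nexc.
have [uR bR b'R] := rows_okE okR.
have deg0 x : Some x \notin R -> degree_in H x = 0.
  move=> xR; apply/eqP; rewrite -leqn0 leqNgt -has_count; apply: contra xR.
  by case/hasP=> e eH' xe; apply: inR eH' xe.
have [L [eL pL]] := exists_elimination bb uH sH eH oH (deg0 b bR) (deg0 b' b'R).
have lL := elimination_linked eL; have uL := elimination_uniq eL.
have mL := elimination_meeting eL.
have rowL T x : T \in L -> x \in T.1.1 -> Some x \in R.
  move=> TL /has_ce/hasP[e eT xe]; apply: (inR e) => //.
  by rewrite (perm_mem pL); apply: cycles_edges eT.
have sub : {subset privates L <= R}.
  move=> o /flattenP[s /mapP[T TL ->]]; have /and3P[_ pT qT] := allP lL T TL.
  by rewrite !inE => /orP[]/eqP->; apply: rowL TL _.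
pose Lb := filter balanced L; pose Lu := filter (predC balanced) L.
have pLL : perm_eq (Lu ++ Lb) L by rewrite perm_catC; apply/permPl/perm_filterC.
have subu T : T \in Lu -> T \in L by rewrite mem_filter => /andP[].
have subb T : T \in Lb -> T \in L by rewrite mem_filter => /andP[].
have uLL : uniq (privates Lu ++ privates Lb).
  by rewrite -privates_cat (perm_uniq (perm_privates pLL)).
have := uLL; rewrite cat_uniq => /and3P[uLu _ uLb].
have [R' pR'] : exists R', perm_eq R (privates Lu ++ R').
  by apply: perm_subset => // o oL; apply: sub; rewrite -(perm_mem (perm_privates pLL))
    privates_cat mem_cat oL.
have gu : good sg (cycles Lu ++ prows (privates Lu)).
  apply: good_unbalanced; last exact: filter_all.
  by apply/allP => T /subu; apply: allP.
have okR' : rows_ok R' by apply: (@rows_ok_sub _ _ _ (privates Lu)); apply: rows_ok_perm okR.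
have evR' : ~~ odd (size R').
  by move: evR; rewrite (perm_size pR') size_cat oddD (negbTE (size_privates Lu)).
have pE : perm_eq ((cycles Lu ++ prows (privates Lu)) ++ (cycles Lb ++ prows R')) (H ++ prows R).
  have p1 := prows_perm b b' pR'; rewrite perm_sym prows_cat in p1.
  have p2 := perm_cycles pLL; rewrite cycles_cat in p2.
  rewrite perm_sym in pL; have p3 := perm_trans p2 pL.
  apply: perm_trans (perm_cat p3 p1).
  move: (cycles _) (prows _) (prows _) (cycles _) => A B C D.
  by perm_count.
have subR' : {subset privates Lb <= R'}.
  move=> o oLb; have : o \in R.
    by apply: sub; rewrite -(perm_mem (perm_privates pLL)) privates_cat mem_cat oLb orbT.
  rewrite (perm_mem pR') mem_cat => /orP[oLu|//].
  by move: uLL; rewrite cat_uniq => /and3P[_ /hasPn /(_ o oLb)]; rewrite /= oLu.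
have ev' : ~~ par sg (cycles Lb ++ prows R').
  by move: ev; rewrite -(par_perm _ pE) par_cat (negbTE (good_par gu)).
have lLb : all linked Lb by apply/allP => T /subb; apply: allP.
have mLb : meeting Lb by move=> T T' /subb h /subb h'; apply: mL.
have gb : (forall T, Lb = [:: T] -> size R' = 4 -> count (on_cycle T.1.1) R' != 3) ->
    good sg (H ++ prows R).
  move=> nbad; apply: good_perm (pE) _; apply: good_cat => //.
  by apply: good_balanced => //; apply: filter_all.
have [[T [eLb sR' cR']]|nbad] : (exists T,
    [/\ Lb = [:: T], size R' = 4 & count (on_cycle T.1.1) R' = 3]) \/
    (forall T, Lb = [:: T] -> size R' = 4 -> count (on_cycle T.1.1) R' != 3).
- case eLb: (Lb) => [|T [|T' L']]; try by right.
  have [/andP[/eqP s4 /eqP c3]|ns] := boolP ((size R' == 4) && (count (on_cycle T.1.1) R' == 3)).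
    by left; exists T.
  by right=> T' [<-] s4; move: ns; rewrite s4.
- have TLb : T \in Lb by rewrite eLb mem_head.
  have TL := subb T TLb; have nL : L != [::] by apply: contraTneq TL => ->.
  have [L1 [T2 eL1]] := rcons_nonempty nL.
  have [bT2 nT2] : balanced T2 /\ {in L1, forall T', T'.1.2 \notin T2.1.1 /\ T'.2 \notin T2.1.1}.
    by apply: elimination_last; rewrite -eL1.
  have eT2 : T2 = T.
    have : T2 \in Lb by rewrite mem_filter bT2 eL1 mem_rcons mem_head.
    by rewrite eLb inE => /eqP.
  subst T2; have uniqL := uniq_privates uL.
  have LuE T' : T' \in Lu -> T' \in L1.
    rewrite mem_filter eL1 mem_rcons inE => /andP[/= nb /orP[/eqP eT|//]].
    by rewrite eT bT2 in nb.
  have /and3P[cT pT qT] := allP lL T TL; have [uT _ _ _ _] := odd_cycleE cT.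
  (* Private vertices of earlier cycles avoid the last one, so no row on [T] has been used. As only
     three rows of [R'] lie on [T], it is a triangle. *)
  have rowT : {in T.1.1, forall x, Some x \in R'}.
    move=> x xT; have := rowL T x TL xT; rewrite (perm_mem pR') mem_cat => /orP[|//].
    case/flattenP=> s /mapP[T' /LuE /nT2 [np nq] ->].
    by rewrite !inE => /orP[]/eqP[ex]; rewrite -ex xT in np nq.
  have sT : size T.1.1 <= 3.
    rewrite -cR' -size_filter -(size_map Some); apply: uniq_leq_size.
      by rewrite map_inj_uniq // => x y [].
    by move=> o /mapP[x xT ->]; rewrite mem_filter /= xT rowT.
  have [eL10|nL1] := eqVneq L1 [::].
    have eLu : Lu = [::] by case: (Lu) LuE => // T' ? /(_ T' (mem_head _ _)); rewrite eL10.
    have sR : size R = 4 by rewrite (perm_size pR') eLu.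
    have := nexc sR; rewrite (perm_size pL) eL1 eL10 /cycles /= cats0 size_ce => /eqP[].
    apply/eqP; rewrite eqn_leq sT /=.
    by case: (elimination_size eL TL).
  have [L0 [T1 eL0]] := rcons_nonempty nL1.
  have T1L1 : T1 \in L1 by rewrite eL0 mem_rcons mem_head.
  have T1L : T1 \in L by rewrite eL1 mem_rcons inE T1L1 orbT.
  have neT : T1 != T.
    by move: uniqL; rewrite eL1 rcons_uniq => /andP[+ _]; apply: contraNneq => <-.
  have nbT1 : ~~ balanced T1.
    apply: contra neT => bT1; have : T1 \in Lb by rewrite mem_filter bT1.
    by rewrite eLb inE.
  have T1Lu : T1 \in Lu by rewrite mem_filter /= nbT1.
  have pLu := perm_to_rem T1Lu; set Lu' := rem T1 Lu in pLu.
  have gu' : good sg (cycles Lu' ++ prows (privates Lu')).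
    apply: good_unbalanced; apply/allP => T' /mem_rem.
      by move/subu; apply: allP.
    by rewrite mem_filter => /andP[].
  have [np nq] := nT2 T1 T1L1; have /and3P[cT1 pT1 qT1] := allP lL T1 T1L.
  have pF : perm_eq ((cycles Lu' ++ prows (privates Lu')) ++
      (ce T.1.1 ++ ce T1.1.1 ++ prows (Some T1.1.2 :: Some T1.2 :: R'))) (H ++ prows R).
    apply: perm_trans pE; rewrite eLb.
    apply: (perm_trans (y := (cycles (T1 :: Lu') ++ prows (privates (T1 :: Lu')))
        ++ cycles [:: T] ++ prows R')).
      rewrite /privates /= -/(privates Lu') !prows_cons /cycles /= -/(cycles Lu').
      by perm_count.
    rewrite perm_cat2r perm_sym; apply: perm_cat; first exact: perm_cycles.
    exact: (prows_perm b b' (perm_privates pLu)).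
  apply: good_perm (pF) _; apply: good_cat => //.
  apply: good_last_two => //.
  - by apply: meet1C; apply: mL => //; rewrite eq_sym.
  - by case: (elimination_size eL T1L).
  - by case: (elimination_size eL T1L).
  - by apply: (elimination_last2 (L := L0)) => //; rewrite -eL0 -eL1.
  - apply: (@rows_ok_sub _ _ _ (privates Lu')); apply: rows_ok_perm okR.
    apply: perm_trans pR' _; apply: (perm_trans (y := privates (T1 :: Lu') ++ R')).
      by rewrite perm_cat2r; apply: perm_privates.
    by rewrite /privates /= -/(privates Lu'); perm_count.
  - by move: ev; rewrite -(par_perm _ pF) par_cat (negbTE (good_par gu')).
exact: gb.
Qed.

(** Decided by exhaustive search, as a cycle has at most [#|V|] vertices. *)
Lemma all_odd_or_even H : all_odd sg H \/
  exists c, [/\ uniq c, 2 < size c, {subset ce c <= H} & ~~ par sg (ce c)].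
Proof.
pose P (n : 'I_#|V|.+1) (t : n.-tuple V) :=
  [&& uniq t, 2 < size t, all [in H] (ce t) & ~~ par sg (ce t)].
have [/existsP[n /existsP[t /and4P[ut st /allP sub pt]]]|noP] :=
    boolP [exists n, exists t, P n t].
  by right; exists t.
left=> c uc sc sub; apply: contraNT noP => pc.
have ltc : size c < #|V|.+1 by rewrite ltnS -(card_uniqP uc) max_card.
apply/existsP; exists (Ordinal ltc); apply/existsP; exists (in_tuple c).
by apply/and4P; split=> //; apply/allP.
Qed.

(** On at most four vertices an even degree is at most two. *)
Lemma small_eulerian H s : uniq H -> simple2 H -> eulerian_list H -> uniq s ->
  (forall e y, e \in H -> y \in e -> y \in s) -> size s <= 4 -> size H <= 4.
Proof.
move=> uH sH eH us inS s4; rewrite -leq_double -(handshake sH us inS).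
apply: (@leq_trans (\sum_(x <- s) 2)); last first.
  by rewrite big_const_seq count_predT iter_addn_0 -muln2 mulnC leq_mul2r s4.
rewrite !big_seq; apply: leq_sum => x xs.
have := degree_bound uH sH us xs inS; have := eH x.
by move: s4; case: (size s) => [|[|[|[|[|]]]]] // _; case: degree_in => [|[|[|[|]]]].
Qed.

(** Removing even cycles does not create the exception: with four rows the graph has at most four
    vertices, hence at most four edges, too few for a cycle and three further edges. *)
Lemma good_terminals H R : b != b' -> uniq H -> simple2 H -> eulerian_list H ->
  rows_ok R -> incident_rows H R -> ~~ odd (size R) ->
  ~~ par sg (H ++ prows R) -> (size R = 4 -> size H != 3) ->
  good sg (H ++ prows R).
Proof.
move=> bb; have [n] := ubnP (size H); elim: n H => // n IH H ltn uH sH eH okR inR evR ev nexc.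
have [oH|[c [uc sc sub evc]]] := all_odd_or_even H; first exact: good_odd_terminals.
have [F pF] := cycle_rest uH uc sc sub.
have subF : {subset F <= H} by move=> e eF; rewrite (perm_mem pF) mem_cat eF orbT.
have pE : perm_eq (ce c ++ (F ++ prows R)) (H ++ prows R).
  by rewrite catA perm_cat2r perm_sym.
have gc : good sg (ce c) by apply: good_cycle.
apply: good_perm (pE) _; apply: good_cat => //; apply: IH => //.
- rewrite -ltnS; apply: leq_trans ltn; rewrite ltnS (perm_size pF) size_cat size_ce.
  by rewrite -add1n leq_add2r (leq_trans _ sc).
- by have := uH; rewrite (perm_uniq pF) cat_uniq => /and3P[].
- exact: simple2_sub subF sH.
- by apply: eulerian_rest pF eH (eulerian_ce _); apply: simple2_sub sub sH.
- by move=> e x /subF; apply: inR.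
- by move: ev; rewrite -(par_perm _ pE) par_cat (negbTE (good_par gc)).
move=> sR; apply/eqP => sF; have [uR _ _] := rows_okE okR.
have : size H <= 4.
  apply: (@small_eulerian H (flatten (map (@seq_of_opt V) R))) => //.
  - exact: uniq_rows.
  - by move=> e y eH' ye; rewrite mem_rows; apply: inR eH' ye.
  rewrite -sR; elim: (R) => //= -[y|] R0 IHR //=; exact: leq_trans IHR _.
rewrite (perm_size pF) size_cat size_ce sF => le4.
by have := leq_trans (leq_add sc (leqnn 3)) le4.
Qed.

End Terminals.

(** * Joins of two even sides *)

Section PickPair.
Variables (T : eqType) (f : pred T).
Implicit Types s : seq T.

Lemma pick_two c s : 1 < count c s ->
  exists x y r, [/\ c x, c y & perm_eq s [:: x, y & r]].
Proof.
rewrite -size_filter => lt1.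
have /permPl := perm_filterC c s; rewrite perm_sym.
have : all c (filter c s) by apply: filter_all.
move: lt1; case: (filter c s) => [|x [|y r]] //= _ /and3P[cx cy _] p.
by exists x, y, (r ++ filter (predC c) s).
Qed.

(** The pair carries the parity of the whole list, so the remainder is even. If that parity is odd,
    both values of [f] occur because the size is even; otherwise two elements with equal values
    exist. *)
Lemma pick_pair s : 0 < size s -> ~~ odd (size s) -> exists x y r,
  perm_eq s [:: x, y & r] /\ f x (+) f y = odd (count f s).
Proof.
move=> s0 ev; have cc := count_predC f s.
have [oc|ec] := boolP (odd (count f s)).
  have oc' : odd (count (predC f) s) by move: ev; rewrite -cc oddD oc /= negbK.
  have /hasP[x xs fx] : has f s by rewrite has_count; case: count oc.
  have /hasP[y ys fy] : has (predC f) s by rewrite has_count; case: count oc'.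
  have yrx : y \in rem x s.
    move: ys; rewrite (perm_mem (perm_to_rem xs)) inE => /orP[/eqP eyx|//].
    by rewrite /= eyx fx in fy.
  exists x, y, (rem y (rem x s)); split.
    by apply: perm_trans (perm_to_rem xs) _; rewrite perm_cons; apply: perm_to_rem.
  by rewrite fx (negbTE fy).
have [lt1|] := ltnP 1 (count f s).
  have [x [y [r [fx fy p]]]] := pick_two lt1.
  by exists x, y, r; rewrite fx fy.
move: (ec); case cf: (count f s) => [|[]] // _ _.
have lt1 : 1 < count (predC f) s.
  by move: cc s0 ev; rewrite cf add0n => <-; case: count => [|[]].
have [x [y [r [fx fy p]]]] := pick_two lt1.
by exists x, y, r; rewrite (negbTE fx) (negbTE fy).
Qed.

End PickPair.

Section Bipartite.
Variables (V : finType) (sg : pred {set V}).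
Implicit Types (x y a b p q : V) (A B C D s t : seq V).
Implicit Types (R : seq (option V)) (E F H : seq {set V}).

Definition bip A B : seq {set V} := [seq [set a; b] | a <- A, b <- B].

Lemma bip_perm A A' B B' : perm_eq A A' -> perm_eq B B' ->
  perm_eq (bip A B) (bip A' B').
Proof. exact: perm_allpairs. Qed.

Lemma bip_cons a A B : bip (a :: A) B = [seq [set a; b] | b <- B] ++ bip A B.
Proof. by []. Qed.

Lemma bip_sym A B : perm_eq (bip A B) (bip B A).
Proof.
elim: A => [|a A IH] /=; first by rewrite /bip; elim: B.
rewrite bip_cons; apply: (perm_trans (y := [seq [set a; b] | b <- B] ++ bip B A)).
  by rewrite perm_cat2l.
elim: B {IH} => //= b B IH; rewrite !bip_cons /= [[set b; a]]setUC perm_cons.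
apply: perm_trans (_ : perm_eq _ ([seq [set b; a0] | a0 <- A] ++
  ([seq [set a; b0] | b0 <- B] ++ bip B A))) _; first by perm_count.
by rewrite perm_cat2l.
Qed.

Lemma bip_catr A B B' : perm_eq (bip A (B ++ B')) (bip A B ++ bip A B').
Proof. exact/permPl/perm_allpairs_catr. Qed.

Lemma bip_rows A b b' : perm_eq (bip A [:: b; b']) (prows b b' (map Some A)).
Proof.
elim: A => //= a A IH; rewrite bip_cons prows_cons; apply: perm_cat => //.
by rewrite /prow /row /= /pe /= [[set a; b]]setUC.
Qed.

(** The parity is summed over the stars at the vertices of [B]; pairs of terminals are chosen by the
    parities of their stars. *)
Lemma par_bip A B : par sg (bip A B) = odd (count (fun b => par sg (bip A [:: b])) B).
Proof.
elim: B => [|b B IH]; first by rewrite (par_perm _ (bip_sym _ _)).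
rewrite /= oddD oddb -IH -par_cat; apply: par_perm.
exact: (bip_catr A [:: b] B).
Qed.

Lemma rows_ok_vertices A b b' : uniq [:: b, b' & A] -> rows_ok b b' (map Some A).
Proof. by move=> u; rewrite /rows_ok -(map_inj_uniq (@Some_inj _)) in u *. Qed.

Lemma bip_split A B b b' B' : perm_eq B [:: b, b' & B'] ->
  perm_eq (bip A B) (prows b b' (map Some A) ++ bip A B').
Proof.
move=> pB; apply: perm_trans (bip_perm (perm_refl A) pB) _.
apply: perm_trans (bip_catr A [:: b; b'] B') _.
by rewrite perm_cat2r bip_rows.
Qed.

Lemma split_uniq A B b b' B' : uniq (A ++ B) -> perm_eq B [:: b, b' & B'] ->
  uniq [:: b, b' & A] /\ uniq (A ++ B').
Proof.
move=> u pB; have {u} : uniq ([:: b, b' & A] ++ B').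
  rewrite (perm_uniq (perm_cat (perm_refl A) pB)) in u.
  by rewrite (perm_uniq (s2 := A ++ [:: b, b' & B'])) //; perm_count.
move=> u; split; first by move: u; rewrite cat_uniq => /andP[].
by move: u; apply: subseq_uniq; apply: (suffix_subseq [:: b; b'] (A ++ B')).
Qed.

Lemma good_bip A B : uniq (A ++ B) -> ~~ odd (size A) -> ~~ odd (size B) ->
  ~~ par sg (bip A B) -> good sg (bip A B).
Proof.
have [n] := ubnP (size B); elim: n B => // n IH B ltn u evA evB ev.
have [B0|B0] := posnP (size B).
  rewrite (size0nil B0); apply: (good_perm (E := [::])); last exact: good_nil.
  by rewrite perm_sym (perm_trans (bip_sym _ _)).
have [b [b' [B' [pB eS]]]] := pick_pair (fun b => par sg (bip A [:: b])) B0 evB.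
have [uP uB'] := split_uniq u pB.
have pE := bip_split A pB; have okR := rows_ok_vertices uP.
have evR : ~~ par sg (prows b b' (map Some A)).
  rewrite -(par_perm _ (bip_rows A b b')) par_bip /= addn0 oddD !oddb eS.
  by rewrite -par_bip.
have evB' : ~~ odd (size B') by move: evB; rewrite (perm_size pB) /= negbK.
rewrite perm_sym in pE; apply: good_perm (pE) _; apply: good_cat.
  by apply: good_rows => //; rewrite size_map.
apply: IH => //.
  by move: ltn; rewrite (perm_size pB) /= ltnS => /ltnW.
by move: ev; rewrite -(par_perm _ pE) par_cat (negbTE evR).
Qed.

End Bipartite.

(** * Odd cycles through the terminals *)

Section TwoSided.
Variables (V : finType) (sg : pred {set V}).
Implicit Types (x y a b p q : V) (A B C D s t : seq V).
Implicit Types (R : seq (option V)) (E F H : seq {set V}).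

(** The two arcs of the cycle between [p] and [q] are two further parallel rows. *)
Lemma good_cycle_rows D p q R : uniq D -> p \in D -> q \in D -> p != q ->
  rows_ok p q R -> ~~ has (on_cycle D) R -> ~~ odd (size R) ->
  ~~ par sg (ce D ++ prows p q R) -> good sg (ce D ++ prows p q R).
Proof.
move=> uD pD qD pq okR dis evR ev; have [uR _ _] := rows_okE okR.
have [s [t [pc pce]]] := rot_cycle_to2 uD pD qD pq.
pose Rs := s :: rev t :: map (@seq_of_opt V) R.
have pr : perm_eq (flatten (map (row p q) Rs)) (ce D ++ prows p q R).
  rewrite /= catA -map_comp; apply: perm_cat => //.
  rewrite perm_sym; apply: perm_trans pce _; apply: perm_trans (ce_arcs2 _ _ _ _) _.
  by rewrite perm_cat2l perm_sym pe_rev.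
apply: good_perm (pr) _; apply: good_parallel; last 2 first.
- by rewrite /= size_map negbK.
- by rewrite (par_perm _ pr).
rewrite (perm_uniq (s2 := (p :: s ++ q :: t) ++ flatten (map (@seq_of_opt V) R))); last first.
  apply/permP => a; rewrite /=; repeat rewrite count_cat /=; rewrite count_rev; count_lia.
rewrite cat_uniq -(perm_uniq pc) uD uniq_rows // andbT.
apply/hasPn => x; rewrite mem_rows -(perm_mem pc) => xR.
exact: (hasPn dis (Some x) xR).
Qed.

Definition opposite_cond v := let p := nth false v in
  [&& p 0 (+) p 1, p 2 (+) p 3 & (p 4 (+) p 5) == (p 6 (+) p 7)].

Lemma opposite_check : allbits 8 (fun v => opposite_cond v ==>
  has (even_template v) [:: [:: [:: 0; 6; 2; 5]; [:: 1; 4; 3; 7]];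
                            [:: [:: 0; 6; 3; 5]; [:: 1; 4; 2; 7]]]).
Proof. by vm_compute. Qed.

(** One odd cycle on each side: exchanging [Q] and [Q'] flips the parities of both resulting cycles,
    and the total is even. *)
Lemma good_opposite a a' q q' P P' Q Q' :
  uniq ([:: a; a'; q; q'] ++ P ++ P' ++ Q ++ Q') ->
  par sg (ce (a :: P ++ a' :: P')) -> par sg (ce (q :: Q ++ q' :: Q')) ->
  par sg (prow q q' (Some a)) = par sg (prow q q' (Some a')) ->
  good sg (ce (a :: P ++ a' :: P') ++ ce (q :: Q ++ q' :: Q')
           ++ prows q q' [:: Some a; Some a']).
Proof.
move=> u; rewrite !par_ce2 !par_prow => o0 o1 eS.
apply: (use_template (x0 := a)
  (T := [:: (0, 1); (1, 0); (2, 3); (3, 2); (2, 0); (0, 3); (2, 1); (1, 3)])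
  (bs := [:: a; a'; q; q'])
  (Ps := [:: P; P'; Q; Q'; [::]; [::]; [::]; [::]]) opposite_check isT erefl).
- by rewrite /= ?cats0.
- by rewrite /opposite_cond /link /= o0 o1 eS eqxx.
- by template_perm.
Qed.

Lemma good_two_sides C D q q' A : uniq C -> 2 < size C -> par sg (ce C) ->
  {subset C <= A} -> uniq (D ++ A) -> par sg (ce D) -> q \in D -> q' \in D ->
  q != q' -> ~~ odd (size A) -> ~~ par sg (prows q q' (map Some A)) ->
  good sg (ce C ++ ce D ++ prows q q' (map Some A)).
Proof.
move=> uC sC oC CA uDA oD qD q'D qq evA ev.
have := uDA; rewrite cat_uniq => /and3P[uD dis uA].
pose S a := par sg (prow q q' (Some a)).
(* Two of any three vertices of [C] have rows of equal parity; all rows other than these two pair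
   off. *)
have [a [a' [aC a'C aa eS]]] : exists a a', [/\ a \in C, a' \in C, a != a' & S a = S a'].
  case: (C) uC sC => [|a1 [|a2 [|a3 s]]] //= u _; move: u; rewrite !inE !negb_or.
  case/and3P=> /andP[n12 /andP[n13 _]] /andP[n23 _] _.
  have [e12|n12'] := eqVneq (S a1) (S a2).
    by exists a1, a2; rewrite !inE !eqxx ?orbT.
  have [e13|n13'] := eqVneq (S a1) (S a3).
    by exists a1, a3; rewrite !inE !eqxx ?orbT.
  exists a2, a3; rewrite !inE !eqxx ?orbT; split=> //.
  by move: n12' n13'; do 3 case: (S _).
have [s [s' [pc pce]]] := rot_cycle_to2 uC aC a'C aa.
have [t [t' [pd pde]]] := rot_cycle_to2 uD qD q'D qq.
have disCD : ~~ has (mem D) C.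
  apply/hasPn => x xC; apply: contra dis => xD; apply/hasP; exists x => //.
  exact: CA.
have nqA x : x \in D -> x \notin A.
  by move=> xD; apply: contra dis => xA; apply/hasP; exists x.
have okR : rows_ok q q' (map Some A).
  by apply: rows_ok_vertices; rewrite /= inE negb_or qq !nqA.
have gE : good sg (ce C ++ ce D ++ prows q q' [:: Some a; Some a']).
  apply: (good_perm (E := ce (a :: s ++ a' :: s') ++ ce (q :: t ++ q' :: t')
            ++ prows q q' [:: Some a; Some a'])).
    by rewrite perm_sym; apply: perm_cat pce (perm_cat pde (perm_refl _)).
  apply: good_opposite => //; rewrite -?(par_perm _ pce) -?(par_perm _ pde) //.
  rewrite (perm_uniq (s2 := (a :: s ++ a' :: s') ++ (q :: t ++ q' :: t'))); last by perm_count.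
  rewrite -(perm_uniq (perm_cat pc pd)) cat_uniq uC uD andbT.
  by apply/hasPn => x xD; apply: contra disCD => xC; apply/hasP; exists x.
rewrite catA; apply: (@good_extend_rows _ sg q q' _ _ [:: Some a; Some a']) => //.
- by rewrite size_map.
- by move=> o; rewrite !inE => /orP[]/eqP->; rewrite map_f // CA.
- by rewrite /= inE (inj_eq (@Some_inj _)) aa.
- by rewrite !par_cat oC oD.
by rewrite -catA.
Qed.

End TwoSided.

(** * Switching, and a triangle inside one side of K_{4,4} *)

Section TemplateSwitch.
Variables (n : nat) (T : seq (nat * nat)) (g : nat -> bool).

(** Switching at the vertices where [g] is true: an arc with exactly one such end changes parity, a
    closed walk never does. Below it reduces nineteen free arc parities to twelve. *)
Definition switched (v : seq bool) : seq bool :=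
  mkseq (fun k => nth false v k (+) (g (nth (0, 0) T k).1 (+) g (nth (0, 0) T k).2))
        (size T).

Lemma odd_count_switched v i ks j : all (fun k => k < size T) ks ->
  chained T i ks j ->
  odd (count (nth false (switched v)) ks)
    = odd (count (nth false v) ks) (+) (g i (+) g j).
Proof.
elim: ks i => [|k ks IH] i /=; first by move=> _ /eqP->; rewrite addbb.
case/andP=> lt_k lt_ks ch; rewrite !oddD !oddb /switched nth_mkseq //.
have {}IH i' : chained T i' ks j -> odd (count (nth false (switched v)) ks)
    = odd (count (nth false v) ks) (+) (g i' (+) g j) by apply: IH.
move: ch; case: ifP => [/eqP <- /IH|_ /andP[/eqP <- /IH]] ->;
  move: (nth _ v k) (odd _) (g _) (g _) (g _); by do 5 case.
Qed.

Lemma template_lt d : template n T d -> all (all (fun k => k < size T)) d.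
Proof.
case/andP=> pd _; apply/allP => ks ksd; apply/allP => k kks.
have : k \in flatten d by apply/flattenP; exists ks.
by rewrite (perm_mem pd) mem_iota.
Qed.

Lemma even_template_switched v d : template n T d ->
  even_template (switched v) d = even_template v d.
Proof.
move=> td; have lt_d := template_lt td; have /andP[_ cl] := td.
rewrite /even_template; apply: eq_in_all => ks ksd.
have /and4P[_ ch _ _] := allP cl ks ksd.
by rewrite (odd_count_switched _ (allP lt_d ks ksd) ch) addbb addbF.
Qed.

Lemma parity_switched v d : template n T d -> size v = size T ->
  odd (count id (switched v)) = odd (count id v).
Proof.
move=> td sv; have lt_d := template_lt td; have /andP[pd cl] := td.
have E w : size w = size T -> odd (count id w) = odd (count (nth false w) (flatten d)).
  move=> sw; rewrite (permP pd) -[in LHS](mkseq_nth false w) /mkseq count_map sw.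
  by congr odd; apply: eq_count.
rewrite !E ?size_mkseq //; move: lt_d cl; elim: (d) => //= ks d' IH.
case/andP=> lt_ks lt_d /andP[/and4P[_ ch _ _] cl].
by rewrite !count_cat !oddD IH // (odd_count_switched _ lt_ks ch) addbb addbF.
Qed.

End TemplateSwitch.

Section ConeTriangle.
Variables (V : finType) (sg : pred {set V}).

(** Vertices 0, 1, 2 form the triangle, 3 is the fourth vertex of their side, and 4 to 7 form the
    other side. *)
Definition k44_arcs : seq (nat * nat) :=
  [:: (0, 1); (1, 2); (2, 0); (4, 0); (5, 0); (6, 0); (7, 0); (4, 1); (5, 1); (6, 1); (7, 1);
    (4, 2); (5, 2); (6, 2); (7, 2); (4, 3); (5, 3); (6, 3); (7, 3)].

Definition k44_templates : seq (seq (seq nat)) :=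
  [:: [:: [:: 0; 1; 11; 3]; [:: 2; 4; 8; 9; 17; 18; 14]; [:: 5; 6; 10; 7; 15; 16; 12; 13]];
    [:: [:: 0; 1; 13; 5]; [:: 2; 6; 10; 7; 15; 16; 12]; [:: 3; 4; 8; 9; 17; 18; 14; 11]];
    [:: [:: 0; 1; 11; 15; 16; 4]; [:: 2; 3; 7; 9; 17; 18; 14]; [:: 5; 6; 10; 8; 12; 13]];
    [:: [:: 0; 1; 11; 15; 17; 5]; [:: 2; 3; 7; 8; 16; 18; 14]; [:: 4; 6; 10; 9; 13; 12]];
    [:: [:: 0; 1; 14; 18; 17; 5]; [:: 2; 4; 16; 15; 7; 9; 13]; [:: 3; 6; 10; 8; 12; 11]];
    [:: [:: 0; 1; 12; 16; 18; 6]; [:: 2; 5; 17; 15; 7; 10; 14]; [:: 3; 4; 8; 9; 13; 11]];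
    [:: [:: 0; 1; 12; 16; 17; 5]; [:: 2; 6; 10; 7; 11]; [:: 3; 4; 8; 9; 13; 14; 18; 15]];
    [:: [:: 0; 8; 12; 2]; [:: 1; 14; 18; 17; 5; 3; 7]; [:: 4; 6; 10; 9; 13; 11; 15; 16]];
    [:: [:: 0; 10; 6]; [:: 1; 12; 8]; [:: 2; 5; 17; 15; 11]; [:: 3; 4; 16; 18; 14; 13; 9; 7]];
    [:: [:: 0; 9; 13; 14; 18; 16; 4]; [:: 1; 11; 15; 17; 5; 6; 10]; [:: 2; 3; 7; 8; 12]];
    [:: [:: 0; 7; 3]; [:: 1; 12; 8]; [:: 2; 5; 17; 18; 14]; [:: 4; 6; 10; 9; 13; 11; 15; 16]];
    [:: [:: 0; 8; 12; 11; 3]; [:: 1; 14; 18; 16; 4; 5; 9]; [:: 2; 6; 10; 7; 15; 17; 13]];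
    [:: [:: 0; 1; 14; 18; 15; 3]; [:: 2; 4; 12]; [:: 5; 6; 10; 8; 16; 17]; [:: 7; 9; 13; 11]]].

(* The parities of the arcs after switching so that the arcs of a spanning tree
   are even. *)
Definition k44_parities (s : seq bool) : seq bool :=
  let p := nth false s in
  [:: p 0; p 1; p 2; false; false; false; false; false; p 3; p 4; p 5; false; p 6; p 7; p 8;
    false; p 9; p 10; p 11].

Lemma k44_check : allbits 12 (fun s => let p := nth false s in
  (p 0 (+) (p 1 (+) p 2)) && ~~ odd (count id (k44_parities s)) ==>
  has (even_template (k44_parities s)) k44_templates).
Proof. by vm_compute. Qed.

Lemma k44_templateP : all (template 8 k44_arcs) k44_templates.
Proof. by vm_compute. Qed.

Lemma k44_has_template v : size v = 19 ->
  nth false v 0 (+) (nth false v 1 (+) nth false v 2) ->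
  ~~ odd (count id v) -> has (even_template v) k44_templates.
Proof.
move=> sv tri ev; pose p := nth false v.
(* [g] is the parity of the path from vertex 0 in the spanning tree of the arcs 3, 4, 5, 6, 7, 11,
   15; switching by it makes these arcs even. *)
pose g := nth false [:: false; p 7 (+) p 3; p 11 (+) p 3; p 15 (+) p 3; p 3; p 4; p 5; p 6].
pose w := switched k44_arcs g v.
have -> : has (even_template v) k44_templates = has (even_template w) k44_templates.
  apply: eq_in_has => d dk; rewrite (even_template_switched _ _ (n := 8)) //.
  exact: (allP k44_templateP).
have {}ev : ~~ odd (count id w).
  by rewrite (parity_switched _ (n := 8) (d := head [::] k44_templates)) //.
have w0 k : k \in [:: 3; 4; 5; 6; 7; 11; 15] -> nth false w k = false.
  rewrite !inE => k_in; have lt_k : k < 19.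
    by move: k_in; do 6 (case/orP=> [/eqP->//|]); move/eqP->.
  rewrite nth_mkseq // -/(p k); move: k_in =>
    /orP[/eqP->|/orP[/eqP->|/orP[/eqP->|/orP[/eqP->|/orP[/eqP->|/orP[/eqP->|/eqP->]]]]]];
    by rewrite /g /=; case: (p 3) (p 4) (p 5) (p 6) (p 7) (p 11) (p 15) => [] [] [] [] [] [] [].
have wE : w = k44_parities [seq nth false w k | k <- [:: 0; 1; 2; 8; 9; 10; 12; 13; 14; 16; 17;
  18]].
  apply: (@eq_from_nth _ false); rewrite size_mkseq // => k.
  by do 19 (case: k => [_|k]; first by [|rewrite w0]).
rewrite wE in ev *; apply: (implyP (allbitsP k44_check _)) => //.
rewrite ev andbT; move: tri; rewrite /w /switched /mkseq /= /g /= -/(p 0) -/(p 1) -/(p 2).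
by case: (p 0) (p 1) (p 2) (p 3) (p 7) (p 11) => [] [] [] [] [] [].
Qed.

Lemma par_flatten (Es : seq (seq {set V})) :
  par sg (flatten Es) = odd (count id (map (par sg) Es)).
Proof. by elim: Es => //= E Es IH; rewrite par_cat IH oddD oddb. Qed.

(** With only two opposite vertices, a triangle and a fourth vertex form the exceptional graph; this
    is why four opposite vertices are taken together. *)
Lemma good_triangle_k44 c1 c2 c3 d b0 b1 b2 b3 :
  uniq [:: c1; c2; c3; d; b0; b1; b2; b3] -> par sg (ce [:: c1; c2; c3]) ->
  ~~ par sg (ce [:: c1; c2; c3] ++ bip [:: c1; c2; c3; d] [:: b0; b1; b2; b3]) ->
  good sg (ce [:: c1; c2; c3] ++ bip [:: c1; c2; c3; d] [:: b0; b1; b2; b3]).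
Proof.
set B := [:: b0; b1; b2; b3]; set C := [:: c1; c2; c3; d] => u tri ev.
pose As := arcs c1 k44_arcs (C ++ B) (nseq 19 [::]).
have pE : perm_eq (flatten As) (ce [:: c1; c2; c3] ++ bip C B).
  apply: (perm_trans (y := ce ([:: c1] ++ [:: c2] ++ [:: c3]) ++ bip B C)); last first.
    by rewrite perm_cat2l bip_sym.
  apply/permP => a; rewrite !count_cat (permP (ce_arcs3 c1 [::] c2 [::] c3 [::])) !count_cat.
  by rewrite /As /arcs /link /= /pe /=; count_lia.
apply: good_perm (pE) _.
apply: (@realize V sg c1 k44_arcs (C ++ B) (nseq 19 [::]) erefl u _ k44_templateP).
apply: k44_has_template => //.
- by move: tri; rewrite (par_ce3 sg c1 [::] c2 [::] c3 [::]).
- by rewrite -par_flatten (par_perm _ pE).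
Qed.

End ConeTriangle.

(** * Two even sides, one of them without edges *)

Section OneSided.
Variables (V : finType) (sg : pred {set V}).
Implicit Types (x y a b p q : V) (A B C D s t : seq V) (E F H : seq {set V}).

Definition graph_on A H :=
  [/\ uniq H, simple2 H & forall e y, e \in H -> y \in e -> y \in A].

Lemma graph_on_rest A E F H : perm_eq H (E ++ F) -> graph_on A H -> graph_on A F.
Proof.
move=> pH [uH sH inA]; have sub : {subset F <= H}.
  by move=> e eF; rewrite (perm_mem pH) mem_cat eF orbT.
split; last by move=> e y /sub; apply: inA.
  by have := uH; rewrite (perm_uniq pH) cat_uniq => /and3P[].
exact: simple2_sub sub sH.
Qed.

Lemma cycle_vertices A H c : graph_on A H -> {subset ce c <= H} -> {subset c <= A}.
Proof. by move=> [_ _ inA] sub x /has_ce/hasP[e /sub eH xe]; apply: inA eH xe. Qed.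

Lemma uniq_cat_rows A B b b' B' : uniq (A ++ B) -> perm_eq B [:: b, b' & B'] ->
  [/\ b != b', rows_ok b b' (map Some A) & uniq (A ++ B')].
Proof.
move=> u pB; have [uP uB'] := split_uniq u pB; split => //.
  by move: uP; rewrite /= inE negb_or => /andP[/andP[]].
exact: rows_ok_vertices.
Qed.

(** Two vertices of [B] whose stars carry the parity of the whole bipartite part serve as terminals;
    the rest of it is even. A triangle on a side of four vertices is the case that this choice
    cannot treat. *)
Lemma good_one_sided A B H : uniq (A ++ B) -> ~~ odd (size A) -> ~~ odd (size B) ->
  0 < size B -> graph_on A H -> eulerian_list H -> ~~ par sg (H ++ bip A B) ->
  (size A = 4 -> size B = 2 -> size H != 3) -> good sg (H ++ bip A B).
Proof.
move=> u evA evB B0 gA eH ev nexc; have [uH sH inA] := gA.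
have [/andP[/eqP sA /eqP sH3]|big] := boolP ((size A == 4) && (size H == 3)); last first.
  have [b [b' [B' [pB eS]]]] := pick_pair (fun b => par sg (bip A [:: b])) B0 evB.
  have [bb okR uB'] := uniq_cat_rows u pB; have pE := bip_split A pB.
  have evB' : ~~ odd (size B') by move: evB; rewrite (perm_size pB) /= negbK.
  have evR : ~~ par sg (H ++ prows b b' (map Some A)).
    move: ev; rewrite !par_cat -(par_perm _ (bip_rows A b b')) [par _ (bip A B)]par_bip.
    by rewrite par_bip /= addn0 oddD !oddb eS.
  have gH : good sg (H ++ prows b b' (map Some A)).
    apply: good_terminals => //.
    - by move=> e x eH' xe; rewrite map_f // (inA e).
    - by rewrite size_map.
    by rewrite size_map => sA; move: big; rewrite sA.
  apply: (good_perm (E := (H ++ prows b b' (map Some A)) ++ bip A B')).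
    by rewrite -catA perm_cat2l perm_sym.
  apply: good_cat => //; apply: good_bip => //.
  move: ev; rewrite par_cat (par_perm _ pE) par_cat addbA -par_cat.
  by rewrite (negbTE (good_par gH)).
have [c [uc sc sub]] : exists c, [/\ uniq c, 2 < size c & {subset ce c <= H}].
  by apply: exists_cycle => //; rewrite -size_eq0 sH3.
have [F pF] := cycle_rest uH uc sc sub.
have [sc3 sF] : size c = 3 /\ size F = 0.
  have := perm_size pF; rewrite size_cat size_ce sH3.
  by move: sc; case: (size c) => [|[|[|[|n]]]] // _ [].
have {F pF sF}pH : perm_eq H (ce c) by rewrite (size0nil sF) cats0 in pF.
have uA : uniq A by move: u; rewrite cat_uniq => /andP[].
have pE := perm_cat pH (perm_refl (bip A B)).
rewrite perm_sym in pE; apply: good_perm (pE) _; rewrite -(par_perm _ pE) in ev.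
have [oc|ec] := boolP (par sg (ce c)); last first.
  apply: good_cat; first exact: good_cycle.
  by apply: good_bip => //; move: ev; rewrite par_cat (negbTE ec).
have oK : par sg (bip A B) by move: ev; rewrite par_cat oc negbK.
have [A' pA] := perm_subset uc (cycle_vertices gA sub).
have [d eA'] : exists d, A' = [:: d].
  have := perm_size pA; rewrite sA size_cat sc3.
  by case: A' {pA} => [|d []] // _; exists d.
have [b [b' [B' [pB eS]]]] := pick_pair (fun b => par sg (bip A [:: b])) B0 evB.
have B'0 : 0 < size B'.
  have sB := perm_size pB; case: (B') sB => //= sB.
  by have := nexc sA sB; rewrite sH3.
have evB' : ~~ odd (size B') by move: evB; rewrite (perm_size pB) /= negbK.
have [b2 [b3 [B'' [pB' eS']]]] := pick_pair (fun b => par sg (bip A [:: b])) B'0 evB'.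
have pBB : perm_eq B ([:: b; b'; b2; b3] ++ B'').
  by apply: perm_trans pB _; rewrite !perm_cons.
have pK : perm_eq (bip A B) (bip A [:: b; b'; b2; b3] ++ bip A B'').
  exact: perm_trans (bip_perm (perm_refl A) pBB) (bip_catr _ _ _).
have parB : par sg (bip A B) = odd (count (fun b => par sg (bip A [:: b])) B) := par_bip _ _ _.
have parB' : par sg (bip A B') = odd (count (fun b => par sg (bip A [:: b])) B') := par_bip _ _ _.
(* The first pair carries the odd parity of the whole and the second the even parity of what is
   left, so the remaining vertices of [B] have even total. *)
have o4 : par sg (bip A [:: b; b'; b2; b3]).
  rewrite par_bip /= addn0 !oddD !oddb addbA eS eS' -parB oK -parB'.
  have := oK; rewrite parB (permP pB) /= !oddD !oddb addbA eS -parB oK -parB'.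
  by case: (par _ (bip A B')).
have uB4 : uniq (A ++ [:: b; b'; b2; b3]) /\ uniq (A ++ B'').
  have := u; rewrite (perm_uniq (perm_cat (perm_refl A) pBB)) => u'; split.
    by move: u'; rewrite catA cat_uniq => /andP[].
  apply: subseq_uniq u'; apply: cat_subseq => //.
  exact: (suffix_subseq [:: b; b'; b2; b3] B'').
have [uA4 uA''] := uB4.
apply: (good_perm (E := (ce c ++ bip A [:: b; b'; b2; b3]) ++ bip A B'')).
  by rewrite -catA perm_cat2l perm_sym.
apply: good_cat; last first.
  apply: good_bip => //; last by move: oK; rewrite (par_perm _ pK) par_cat o4.
  by move: evB'; rewrite (perm_size pB') /= negbK.
case: c uc sc3 pA oc {sc sub pH pE ev} => [|c1 [|c2 [|c3 []]]] // uc _; rewrite eA' => pA oc.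
have pA4 : perm_eq (bip A [:: b; b'; b2; b3]) (bip [:: c1; c2; c3; d] [:: b; b'; b2; b3]).
  exact: bip_perm.
rewrite perm_sym in pA4.
apply: good_perm (perm_cat (perm_refl _) pA4) _; apply: good_triangle_k44 => //.
  by rewrite (perm_uniq (perm_cat pA (perm_refl _))) in uA4.
by rewrite par_cat oc (par_perm _ pA4) o4.
Qed.

End OneSided.

Ltac size_lia :=
  repeat match goal with H : ?T |- _ =>
    match type of T with Prop => clear H end end;
  repeat match goal with |- context [size ?s] =>
    let n := fresh in set n := size s; clearbody n end;
  lia.

(** * Two even sides in general *)

Section EvenEven.
Variables (V : finType) (sg : pred {set V}).
Implicit Types (x y a b p q : V) (A B C D s t : seq V) (E F H : seq {set V}).

Lemma graph_cycle_size A H : graph_on A H -> eulerian_list H ->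
  ~~ odd (size A) -> H != [::] -> 3 < size A.
Proof.
move=> gA eH evA nH; have [uH sH _] := gA.
have [c [uc sc sub]] := exists_cycle uH sH eH nH.
have := leq_trans sc (uniq_leq_size uc (cycle_vertices gA sub)).
by rewrite leq_eqVlt => /orP[/eqP e|//]; rewrite -e in evA.
Qed.

(* When [B] has four vertices, all vertices of the cycle [c] are private, so two
   of them are balanced. *)
Lemma leaf_cycle_balanced (f : V -> bool) B H : uniq B -> graph_on B H ->
  eulerian_list H -> all_odd sg H -> H != [::] -> exists c p q F,
  [/\ [/\ uniq c, 2 < size c & perm_eq H (ce c ++ F)],
      [/\ p \in c, q \in c & p != q], degree_in F p = 0, degree_in F q = 0 &
      f p = f q \/ size B != 4].
Proof.
move=> uB gB eH oH nH; have [uH sH inB] := gB.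
have [c [p [q [F [[uc sc pF] [pc qc pq] Fp Fq]]]]] := leaf_cycle uH sH eH oH nH.
have [s4|ns4] := eqVneq (size B) 4; last by exists c, p, q, F; split => //; right.
(* On four vertices there are at most four edges, so at most one lies outside [c], and a single edge
   is not Eulerian. *)
have F0 : F = [::].
  have := small_eulerian uH sH eH uB inB (eq_leq s4).
  rewrite (perm_size pF) size_cat size_ce => le4.
  have le1 : size F <= 1 by rewrite -(leq_add2l 3) (leq_trans _ le4) // leq_add2r.
  have sce : simple2 (ce c).
    by apply: simple2_sub sH => e ec; rewrite (perm_mem pF) mem_cat ec.
  have eF := eulerian_rest pF eH (eulerian_ce sce).
  case: F pF le1 eF {Fp Fq le4} => [//|e []] // pF _ eF.
  have : e \in H by rewrite (perm_mem pF) mem_cat mem_head orbT.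
  move/(allP sH)/cards2P => [x [y [_ ee]]].
  by have := eF x; rewrite /degree_in /= ee !inE eqxx.
have [p' [q' [p'c q'c pq' fpq]]] : exists p' q', [/\ p' \in c, q' \in c, p' != q' & f p' = f q'].
  case: (c) uc sc => [|a1 [|a2 [|a3 s]]] //= u _; move: u; rewrite !inE !negb_or.
  case/and3P=> /andP[n12 /andP[n13 _]] /andP[n23 _] _.
  have [e12|n12'] := eqVneq (f a1) (f a2).
    by exists a1, a2; rewrite !inE !eqxx ?orbT.
  have [e13|n13'] := eqVneq (f a1) (f a3).
    by exists a1, a3; rewrite !inE !eqxx ?orbT.
  exists a2, a3; rewrite !inE !eqxx ?orbT; split=> //.
  by move: n12' n13'; do 3 case: (f _).
by exists c, p', q', F; rewrite F0 in pF *; split => //; left.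
Qed.

Lemma graph_on_delete B H p q B' : graph_on B H -> perm_eq B [:: p, q & B'] ->
  degree_in H p = 0 -> degree_in H q = 0 -> graph_on B' H.
Proof.
move=> [uH sH inB] pB dp dq; split => // e y eH ye.
have := inB e y eH ye; rewrite (perm_mem pB) !inE.
have ndeg z : degree_in H z = 0 -> (y == z) = false.
  move=> dz; apply: contra_eqF dz => /eqP <-; rewrite -lt0n -has_count.
  by apply/hasP; exists e.
by rewrite !ndeg.
Qed.

(** Once all cycles inside the sides are odd, a leaf cycle [D] of [H2] is removed and its vertices
    [q], [q'] are split off with their rows. If their stars differ in parity, [D] and these rows
    have even total; if the stars agree, an odd cycle of [H1] is added to correct the parity. *)
Lemma good_even_even A B H1 H2 : uniq (A ++ B) -> ~~ odd (size A) -> ~~ odd (size B) ->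
  0 < size A -> 0 < size B -> graph_on A H1 -> graph_on B H2 ->
  eulerian_list H1 -> eulerian_list H2 -> ~~ par sg (H1 ++ H2 ++ bip A B) ->
  (size A = 4 -> size B = 2 -> size H1 != 3) ->
  (size B = 4 -> size A = 2 -> size H2 != 3) ->
  good sg (H1 ++ H2 ++ bip A B).
Proof.
have [n] := ubnP (size B + size H1 + size H2); elim: n B H1 H2 => // n IH B H1 H2.
move=> ltn u evA evB A0 B0 g1 g2 e1 e2 ev nex1 nex2.
have [n2|n2] := eqVneq H2 [::].
  by rewrite n2 /= in ev *; apply: good_one_sided.
have [n1|n1] := eqVneq H1 [::].
  have pE : perm_eq (H2 ++ bip B A) (H1 ++ H2 ++ bip A B).
    by rewrite n1 /= perm_cat2l bip_sym.
  apply: good_perm (pE) _; apply: good_one_sided => //; first by rewrite uniq_catC.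
  by rewrite (par_perm _ pE).
have [uH1 sH1 _] := g1; have [uH2 sH2 _] := g2.
have A4 := graph_cycle_size g1 e1 evA n1; have B4 := graph_cycle_size g2 e2 evB n2.
have [oH1|[c [uc sc sub evc]]] := all_odd_or_even sg H1; last first.
  have [F pF] := cycle_rest uH1 uc sc sub.
  have pE : perm_eq (ce c ++ (F ++ H2 ++ bip A B)) (H1 ++ H2 ++ bip A B).
    by rewrite catA perm_cat2r perm_sym.
  have gc : good sg (ce c) by apply: good_cycle.
  apply: good_perm (pE) _; apply: good_cat => //; apply: IH => //.
  - move: ltn sc; rewrite (perm_size pF) size_cat size_ce; size_lia.
  - exact: graph_on_rest pF g1.
  - by apply: eulerian_rest pF e1 (eulerian_ce _); apply: simple2_sub sub sH1.
  - by move: ev; rewrite -(par_perm _ pE) par_cat (negbTE (good_par gc)).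
  - by move=> _ sB; rewrite sB in B4.
have [oH2|[c [uc sc sub evc]]] := all_odd_or_even sg H2; last first.
  have [F pF] := cycle_rest uH2 uc sc sub.
  have pE : perm_eq (ce c ++ (H1 ++ F ++ bip A B)) (H1 ++ H2 ++ bip A B).
    have := perm_cat (perm_cat (perm_refl H1) pF) (perm_refl (bip A B)).
    by rewrite -[X in perm_eq X _]catA perm_sym; apply: perm_trans; perm_count.
  have gc : good sg (ce c) by apply: good_cycle.
  apply: good_perm (pE) _; apply: good_cat => //; apply: IH => //.
  - move: ltn sc; rewrite (perm_size pF) size_cat size_ce; size_lia.
  - exact: graph_on_rest pF g2.
  - by apply: eulerian_rest pF e2 (eulerian_ce _); apply: simple2_sub sub sH2.
  - by move: ev; rewrite -(par_perm _ pE) par_cat (negbTE (good_par gc)).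
  - by move=> _ sA; rewrite sA in A4.
have uB : uniq B by move: u; rewrite cat_uniq => /and3P[].
have [D [q [q' [F [[uD sD pF] [qD q'D qq] Fq Fq' fq]]]]] :=
  leaf_cycle_balanced (fun b => par sg (bip A [:: b])) uB g2 e2 oH2 n2.
have subD : {subset ce D <= H2} by move=> e eD; rewrite (perm_mem pF) mem_cat eD.
have DB := cycle_vertices g2 subD.
have [B' pB] : exists B', perm_eq B ([:: q; q'] ++ B').
  apply: perm_subset; first by rewrite /= inE qq.
  by move=> x; rewrite !inE => /orP[]/eqP->; apply: DB.
have [_ okR uB'] := uniq_cat_rows u pB; have pK := bip_split A pB.
have gF := graph_on_rest pF g2.
have gB' := graph_on_delete gF pB Fq Fq'.
have eF : eulerian_list F.
  by apply: eulerian_rest pF e2 (eulerian_ce _); apply: simple2_sub subD sH2.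
have oD : par sg (ce D) by apply: oH2.
have evB' : ~~ odd (size B') by move: evB; rewrite (perm_size pB) /= negbK.
have B'0 : 0 < size B' by move: B4; rewrite (perm_size pB) /=; case: (size B').
have parR : par sg (prows q q' (map Some A)) =
    par sg (bip A [:: q]) (+) par sg (bip A [:: q']).
  by rewrite -(par_perm _ (bip_rows A q q')) par_bip /= addn0 oddD !oddb.
have sizeB' : (size B').+2 = size B by rewrite (perm_size pB).
have sizeF : size F < size H2.
  by rewrite (perm_size pF) size_cat size_ce; move: sD; size_lia.
have disDA : uniq (D ++ A).
  have [uA _ dis] : [/\ uniq A, true & ~~ has (mem A) B].
    by move: u; rewrite cat_uniq => /and3P[].
  rewrite cat_uniq uD uA andbT; apply/hasPn => x xA; apply: contra dis => xD.
  by apply/hasP; exists x => //; apply: DB.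
have [eqf|nef] := eqVneq (par sg (bip A [:: q])) (par sg (bip A [:: q'])).
  have [C [uC sC subC]] := exists_cycle uH1 sH1 e1 n1.
  have [F1 pF1] := cycle_rest uH1 uC sC subC.
  have gE : good sg (ce C ++ ce D ++ prows q q' (map Some A)).
    apply: good_two_sides => //; first exact: oH1.
      exact: cycle_vertices g1 subC.
    by rewrite parR eqf addbb.
  have pE : perm_eq ((ce C ++ ce D ++ prows q q' (map Some A)) ++ (F1 ++ F ++ bip A B'))
      (H1 ++ H2 ++ bip A B).
    have := perm_cat pF1 (perm_cat pF pK); rewrite perm_sym; apply: perm_trans.
    by perm_count.
  apply: good_perm (pE) _; apply: good_cat => //; apply: IH => //.
  - move: ltn sizeF sizeB'; rewrite (perm_size pF1) size_cat; size_lia.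
  - exact: graph_on_rest pF1 g1.
  - by apply: eulerian_rest pF1 e1 (eulerian_ce _); apply: simple2_sub subC sH1.
  - by move: ev; rewrite -(par_perm _ pE) par_cat (negbTE (good_par gE)).
  (* If [A] has four vertices, [H1] has at most four edges, so at most one is left after removing
     [C], not three. *)
  - move=> sA _; have [_ _ inA] := g1.
    have uA : uniq A by move: u; rewrite cat_uniq => /and3P[].
    have := small_eulerian uH1 sH1 e1 uA inA (eq_leq sA).
    rewrite (perm_size pF1) size_cat size_ce; move: sC; size_lia.
  - by move=> _ sA; rewrite sA in A4.
(* For four vertices in [B] the leaf cycle came with equal stars; hence [B'] does not shrink to two
   vertices here. *)
have nB4 : size B != 4 by case: fq => // eqf; rewrite eqf eqxx in nef.
have gE : good sg (ce D ++ prows q q' (map Some A)).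
  apply: good_cycle_rows => //; last 2 first.
  - by rewrite size_map.
  - by rewrite par_cat oD parR; move: nef; do 2 case: par.
  apply/hasPn => o /mapP[x xA ->] /=; move: disDA; rewrite cat_uniq => /and3P[_ /hasPn h _].
  exact: h.
have pE : perm_eq ((ce D ++ prows q q' (map Some A)) ++ (H1 ++ F ++ bip A B'))
    (H1 ++ H2 ++ bip A B).
  have := perm_cat (perm_refl H1) (perm_cat pF pK); rewrite perm_sym; apply: perm_trans.
  by perm_count.
apply: good_perm (pE) _; apply: good_cat => //; apply: IH => //.
- move: ltn sizeF sizeB'; size_lia.
- by move: ev; rewrite -(par_perm _ pE) par_cat (negbTE (good_par gE)).
- by move=> _ sB'; rewrite sB' in sizeB'; rewrite -sizeB' in nB4.
by move=> _ sA; rewrite sA in A4.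
Qed.

End EvenEven.

(** * Joins with an odd side *)

Section TwoPairs.
Variables (V : finType) (sg : pred {set V}).
Implicit Types (x y a b p q : V) (A B C D s t : seq V) (E F H : seq {set V}).

Definition two_pairs_cond v := let p := nth false v in
  (p 0 (+) (p 2 (+) p 3 (+) (p 4 (+) p 5 (+) (p 6 (+) p 7)))) &&
  (p 1 (+) (p 8 (+) p 9 (+) (p 10 (+) p 11 (+) (p 12 (+) p 13)))).

Lemma two_pairs_check : allbits 14 (fun v => two_pairs_cond v ==>
  has (even_template v)
  [:: [:: [:: 0; 3; 8; 10; 11; 13; 6]; [:: 1; 9; 2; 4; 5; 7; 12]];
      [:: [:: 0; 3; 8; 12; 13; 11; 4]; [:: 1; 9; 2; 6; 7; 5; 10]];
      [:: [:: 0; 3; 9; 1; 10; 4]; [:: 2; 8; 12; 6]; [:: 5; 7; 13; 11]];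
      [:: [:: 0; 3; 9; 11; 10; 12; 6]; [:: 1; 13; 7; 5; 4; 2; 8]];
      [:: [:: 0; 3; 2]; [:: 1; 11; 5; 7; 12]; [:: 4; 10; 8; 9; 13; 6]];
      [:: [:: 0; 3; 8; 1; 13; 6]; [:: 2; 9; 11; 4]; [:: 5; 7; 12; 10]]]).
Proof. by vm_compute. Qed.

Lemma good_two_pairs3 b b' c c' x y z : uniq [:: b; b'; c; c'; x; y; z] ->
  par sg (prows b b' (None :: map Some [:: x; y; z])) ->
  par sg (prows c c' (None :: map Some [:: x; y; z])) ->
  good sg (prows b b' (None :: map Some [:: x; y; z])
           ++ prows c c' (None :: map Some [:: x; y; z])).
Proof.
move=> u; rewrite !odd_parity_rows /= !addn0 !oddD !oddb !par_prow /prow /row /= => o1 o2.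
apply: (use_template (x0 := b)
  (T := [:: (0, 1); (2, 3); (0, 4); (4, 1); (0, 5); (5, 1); (0, 6); (6, 1);
            (2, 4); (4, 3); (2, 5); (5, 3); (2, 6); (6, 3)])
  (bs := [:: b; b'; c; c'; x; y; z]) (Ps := nseq 14 [::]) two_pairs_check isT erefl).
- by [].
- by rewrite /two_pairs_cond /link /= o1.
apply/permP => a; rewrite /arcs /link /prows /prow /row /= /pe /=; count_lia.
Qed.

(** Among five vertices of [A] three have equal rows for [b], [b'], and two of these also for [c],
    [c']. Their rows are even for both pairs and are removed, until three vertices are left for the
    computed case. *)
Lemma good_two_pairs A b b' c c' : uniq ([:: b; b'; c; c'] ++ A) ->
  odd (size A) -> 2 < size A ->
  par sg (prows b b' (None :: map Some A)) ->
  par sg (prows c c' (None :: map Some A)) ->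
  good sg (prows b b' (None :: map Some A) ++ prows c c' (None :: map Some A)).
Proof.
have [n] := ubnP (size A); elim: n A => // n IH A ltn u oA gt2 o1 o2.
case: A ltn u oA gt2 o1 o2 => [|x [|y [|z [|w A]]]] // ltn u oA _ o1 o2.
  exact: good_two_pairs3.
set A0 := [:: x, y, z, w & A] in ltn u oA o1 o2 *.
have uA : uniq A0 by move: u; rewrite cat_uniq => /and3P[].
have A0_5 : 4 < size A0 by move: oA; rewrite /A0 /=; case: (size A).
pose f a := par sg (prow b b' (Some a)); pose g a := par sg (prow c c' (Some a)).
have [h [lt2 fh]] : exists h : pred V, 2 < count h A0 /\ (forall a a', h a -> h a' -> f a = f a').
  have [lt2|le2] := ltnP 2 (count f A0).
    by exists f; split=> // a a' -> ->.
  exists (predC f); split; last by move=> a a' /negbTE-> /negbTE->.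
  move: A0_5 le2; rewrite -(count_predC f A0).
  by move: (count f A0) (count _ A0) => m k; lia.
have [a1 [a2 [a3 [r [h1 h2 h3 pA]]]]] := pick_three lt2 uA.
have [a [a' [r' [pA' fe ge]]]] : exists a a' r',
    [/\ perm_eq A0 [:: a, a' & r'], f a = f a' & g a = g a'].
  have [e12|n12] := eqVneq (g a1) (g a2).
    by exists a1, a2, (a3 :: r); split => //; apply: fh.
  have [e13|n13] := eqVneq (g a1) (g a3).
    exists a1, a3, (a2 :: r); split => //; last exact: fh.
    by apply: perm_trans pA _; perm_count.
  exists a2, a3, (a1 :: r); split => //; last by move: n12 n13; do 3 case: (g _).
    by apply: perm_trans pA _; perm_count.
  exact: fh.
have u4 : uniq ([:: b; b'; c; c'; a; a'] ++ r').
  have := u; rewrite (perm_uniq (perm_cat (perm_refl [:: b; b'; c; c']) pA')).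
  by [].
have pb d d' : perm_eq (prows d d' (None :: map Some A0))
    (prows d d' [:: Some a; Some a'] ++ prows d d' (None :: map Some r')).
  apply: (perm_trans (y := prows d d' (None :: map Some [:: a, a' & r']))).
    by apply: prows_perm; rewrite perm_cons perm_map.
  by rewrite /= !prows_cons; perm_count.
have ev d d' : par sg (prow d d' (Some a)) = par sg (prow d d' (Some a')) ->
    ~~ par sg (prows d d' [:: Some a; Some a']).
  by move=> e; rewrite odd_parity_rows /= addn0 oddD !oddb e addbb.
have ok d d' : d \in [:: b; b'; c; c'] -> d' \in [:: b; b'; c; c'] -> d != d' ->
    par sg (prow d d' (Some a)) = par sg (prow d d' (Some a')) ->
    good sg (prows d d' [:: Some a; Some a']).
  move=> di d'i dd e; apply: good_rows => //; last exact: ev.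
  have u6 : uniq ([:: b; b'; c; c'] ++ [:: a; a']).
    by move: u4; rewrite cat_uniq => /andP[].
  apply: (@rows_ok_vertices _ [:: a; a']); move: u6.
  rewrite cat_uniq => /and3P[_ /hasPn h' u2].
  rewrite /= inE negb_or dd; move: u2 => /= ->; rewrite andbT.
  apply/andP; split; [apply: contraL di|apply: contraL d'i]; exact: h'.
have bin z' : z' \in [:: b; b'; c; c'] -> z' \in [:: b; b'; c; c'] by [].
have [bb cc] : b != b' /\ c != c'.
  by move: u4; rewrite /= !inE !negb_or => /and3P[/andP[-> _] _ /and3P[/andP[-> _] _ _]].
have g1 : good sg (prows b b' [:: Some a; Some a']) by apply: ok; rewrite ?inE ?eqxx ?orbT.
have g2 : good sg (prows c c' [:: Some a; Some a']) by apply: ok; rewrite ?inE ?eqxx ?orbT.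
apply: (good_perm (E := (prows b b' [:: Some a; Some a'] ++ prows c c' [:: Some a; Some a']) ++
   (prows b b' (None :: map Some r') ++ prows c c' (None :: map Some r')))).
  have := perm_cat (pb b b') (pb c c'); rewrite perm_sym; apply: perm_trans.
  exact/permPl/perm_catACA.
have sA : size A0 = (size r').+2 := perm_size pA'.
apply: good_cat; first exact: good_cat.
apply: IH.
- by move: ltn; rewrite sA ltnS => /ltnW.
- by apply: subseq_uniq u4; rewrite /= !eqxx; apply: (suffix_subseq [:: a; a'] r').
- by move: oA; rewrite sA /= negbK.
- by move: A0_5 oA; rewrite sA /=; case: (size r') => [|[|[|]]].
- by move: o1; rewrite (par_perm _ (pb b b')) par_cat (negbTE (good_par g1)).
by move: o2; rewrite (par_perm _ (pb c c')) par_cat (negbTE (good_par g2)).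
Qed.

End TwoPairs.

(** * Pairs of leaves in a side with odd degrees *)

Section LeafPairs.
Variables (V : finType) (sg : pred {set V}) (f : V -> bool).
Implicit Types (x y a b p q : V) (A B C D s t : seq V) (E F H : seq {set V}).

Lemma longest_leaf H x s : uniq H -> simple2 H -> all_odd sg H -> longest H x s ->
  odd (degree_in H x) -> degree_in H x = 1.
Proof.
move=> uH sH oH lx; have := longest_degree uH sH oH lx.
by case: (degree_in H x) => [|[|[|]]].
Qed.

Lemma par_pe_cons x y s : par sg (pe x (y :: s)) = sg [set x; y] (+) par sg (pe y s).
Proof. by rewrite pe_cons /par /= oddD oddb. Qed.

(** In the application [f x] is the parity of the star from [x] to the other side, so an even link
    has even total together with the rows at its ends. *)
Definition even_link x s := ~~ (f x (+) f (last x s) (+) par sg (pe x s)).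

(* If all links between leaves are odd, a longest path has a single edge:
   otherwise its second vertex has a third neighbour, which is either another
   leaf or closes an odd cycle. *)
Lemma leaf_link B H : uniq H -> simple2 H -> all_odd sg H ->
  (forall e y, e \in H -> y \in e -> y \in B) ->
  {in B, forall x, odd (degree_in H x)} -> H != [::] ->
  (exists x s, [/\ simple_path H x s, 0 < size s, degree_in H x = 1,
     degree_in H (last x s) = 1 & even_link x s]) \/
  {in B, forall x, degree_in H x = 1}.
Proof.
move=> uH sH oH inB odd_B nH.
have edge_in x y : joined H x y -> x \in B /\ y \in B.
  by case/andP=> _ xyH; split; apply: inB xyH _; rewrite !inE eqxx ?orbT.
have [/hasP[y yB ny1]|all1] := boolP (has (fun x => degree_in H x != 1) B); last first.
  by right=> x xB; have := hasPn all1 x xB; rewrite negbK => /eqP.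
left; have deg y' : joined H y' y -> 0 < degree_in H y.
  by case/andP=> _ eH; rewrite -has_count; apply/hasP; exists [set y'; y]; rewrite // !inE eqxx
    orbT.
have deg3 z : z \in B -> degree_in H z != 1 -> 2 < degree_in H z.
  by move=> /odd_B; case: (degree_in H z) => [|[|[|]]].
have nbB x z : joined H x z -> z \in B by case/edge_in.
have cnt z : degree_in H z <= count (joined H z) (undup B).
  by apply: degree_nbrs => // w /nbB; rewrite mem_undup.
have [u [w [r [yu yw pB]]]] := pick_two (leq_trans (ltnW (deg3 y yB ny1)) (cnt y)).
have uw : u != w.
  have := undup_uniq B; rewrite (perm_uniq pB) /= inE negb_or => /andP[/andP[-> _]].
  by [].
have pu : simple_path H u [:: y; w].
  rewrite /simple_path /= joined_sym yu yw /= !inE negb_or uw.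
  by case/andP: yu => /negbTE yu _; case/andP: yw => -> _; rewrite eq_sym yu.
have [v0 [t [lv st]]] := exists_longest pu.
case: t lv st => [|v1 [|v2 t]] // lv _.
have [pv mx] := lv; have [ps us] := andP pv.
have /and3P[j01 j12 pt0] := ps; have pt : path (joined H) v2 t := pt0.
have [v0B v1B] := edge_in _ _ j01.
have d0 : degree_in H v0 = 1 by apply: longest_leaf lv _ => //; apply: odd_B.
have lastB : last v2 t \in B.
  have [_ v2B] := edge_in _ _ j12.
  by elim: (t) (v2) v2B pt => //= z t' IH v _ /andP[/edge_in[_ zB] /(IH z zB)].
have dr : degree_in H (last v2 t) = 1.
  by apply: longest_leaf (longest_rev lv) _ => //; apply: odd_B.
have [ev|od] := boolP (even_link v0 [:: v1, v2 & t]).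
  by exists v0, [:: v1, v2 & t].
have d1 : 2 < degree_in H v1.
  apply: deg3 => //; apply/eqP => d1; have : 1 < degree_in H v1; last by rewrite d1.
  rewrite /degree_in -size_filter.
  apply: (@leq_trans (size [:: [set v0; v1]; [set v1; v2]])) => //.
  apply: uniq_leq_size.
    rewrite /= inE andbT; apply/eqP; rewrite setUC => /set2_inj e02.
    by move: us; rewrite /= e02 !inE eqxx orbT.
  move=> e; rewrite !inE mem_filter => /orP[]/eqP->; rewrite !inE eqxx ?orbT /=.
    by case/andP: j01.
  by case/andP: j12.
have [w' [j1w n0 n2]] : exists w', [/\ joined H v1 w', w' != v0 & w' != v2].
  have [a1 [a2 [a3 [r' [h1 h2 h3 pB']]]]] := pick_three (leq_trans d1 (cnt v1)) (undup_uniq B).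
  have := undup_uniq B; rewrite (perm_uniq pB') /= !inE !negb_or.
  case/and3P=> /and3P[n12 n13 _] /andP[n23 _] _.
  have [e1|m1] := boolP ((a1 == v0) || (a1 == v2)); last first.
    by exists a1; move: m1; rewrite negb_or => /andP[].
  have [e2|m2] := boolP ((a2 == v0) || (a2 == v2)); last first.
    by exists a2; move: m2; rewrite negb_or => /andP[].
  exists a3; split=> //.
    apply: contraNneq n12 => e3; rewrite e3 in n13 n23.
    by case/orP: e1 n13 => /eqP-> n13; case/orP: e2 n23 => /eqP-> n23; rewrite ?eqxx in n13 n23 *.
  apply: contraNneq n12 => e3; rewrite e3 in n13 n23.
  by case/orP: e1 n13 => /eqP-> n13; case/orP: e2 n23 => /eqP-> n23; rewrite ?eqxx in n13 n23 *.
have nw1 : w' != v1 by case/andP: j1w; rewrite eq_sym.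
(* Off the path, [w'] can replace [v0] as an end and is thus a leaf. If its link to the far end is
   odd like that of [v0], the link from [v0] over [v1] to [w'] is even. *)
have [wt|wt] := boolP (w' \in t); last first.
  have pw : simple_path H w' [:: v1, v2 & t].
    apply/andP; split; first by rewrite /= joined_sym j1w j12 pt.
    rewrite cons_uniq !inE !negb_or nw1 n2 wt /=.
    by move: us; rewrite cons_uniq => /andP[].
  have lw : longest H w' [:: v1, v2 & t] by split.
  have [_ wB] := edge_in _ _ j1w.
  have dw : degree_in H w' = 1 by apply: longest_leaf lw _ => //; apply: odd_B.
  have [ev'|od'] := boolP (even_link w' [:: v1, v2 & t]).
    by exists w', [:: v1, v2 & t].
  exists v0, [:: v1; w']; split => //.
    have n01 : v0 != v1 by case/andP: j01.
    by rewrite /simple_path /= j01 j1w !inE negb_or n01 ![_ == w']eq_sym n0 nw1.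
  move: od od'; rewrite /even_link !par_pe_cons [[set w'; v1]]setUC /=.
  rewrite [par sg (pe w' [::])](_ : _ = false) //.
  case: (f v0) (f w') (f (last v2 t)) (sg [set v0; v1]) (sg [set v1; v2])
    (sg [set v1; w']) (par _ _) => [] [] [] [] [] [] []; by [].
(* On the path, [w'] closes an odd cycle with [v1]; the shortcut along the chord flips the parity of
   the link between the two ends. *)
have [t1 [t2 et]] := split_mem wt.
have lastE : last v1 (w' :: t2) = last v2 t by rewrite et last_cat.
have us' : uniq (v0 :: (v1 :: v2 :: t1 ++ [:: w']) ++ t2).
  by move: us; rewrite et /= -catA.
have ocyc : par sg (ce (v1 :: (v2 :: t1) ++ [:: w'])).
  apply: oH; first by move: us'; rewrite cons_uniq cat_uniq => /and3P[_ + _].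
    by rewrite /= size_cat addn1.
  move=> e; rewrite (perm_mem (ce_arcs2 _ _ _ _)) mem_cat => /orP[he|].
    apply: (path_subset ps); rewrite (pe_cons v0) in_cons et; apply/orP; right.
    by rewrite -cat_cons pe_split mem_cat he.
  by rewrite pe_cons in_cons orbF => /eqP->; rewrite setUC; case/andP: j1w.
exists v0, [:: v1, w' & t2]; split => //; last 2 first.
- by rewrite [last _ _]lastE.
- move: od ocyc; rewrite /even_link par_ce2 [last v0 [:: v1, w' & t2]]lastE.
  rewrite et !(par_pe_cons v0) -cat_cons pe_split par_cat (par_pe_cons v1 w').
  rewrite (par_pe_cons w' v1) [[set w'; v1]]setUC.
  rewrite [par sg (pe v1 [::])](_ : _ = false) //.
  rewrite -[last v0 _]/(last v2 (t1 ++ w' :: t2)).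
  move: (par sg (pe v1 _)) (par sg (pe w' t2)) (sg [set v0; v1]) (sg [set v1; w']) => X Y Z W.
  by case: (f v0) (f (last v2 _)) X Y Z W => [] [] [] [] [] [].
rewrite /simple_path; apply/andP; split.
  rewrite /= j01 j1w; move: pt; rewrite et cat_path /= => /and3P[_ _ ->]; by [].
apply: subseq_uniq us; rewrite et /= !eqxx; apply: (suffix_subseq (v2 :: t1) (w' :: t2)).
Qed.

End LeafPairs.

Section OddEven.
Variables (V : finType) (sg : pred {set V}).
Implicit Types (x y a b p q : V) (A B C D s t : seq V) (E F H : seq {set V}).

Definition odd_on B H := {in B, forall x, odd (degree_in H x)}.

Lemma has_pe_first x s : s != [::] -> 0 < degree_in (pe x s) x.
Proof. by case: s => // y s _; rewrite /degree_in pe_cons /= !inE eqxx. Qed.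

Lemma has_pe_last x s y : 0 < degree_in (pe x (rcons s y)) y.
Proof. by rewrite /degree_in pe_rcons -cats1 count_cat /= !inE eqxx orbT addnC. Qed.

Lemma mem_path_edge x s z : s != [::] -> z \in x :: s ->
  exists2 e, e \in pe x s & z \in e.
Proof.
elim: s x => // y s IH x _; rewrite inE => /orP[/eqP->|zs].
  by exists [set x; y]; rewrite ?pe_cons ?mem_head // !inE eqxx.
have [s0|/IH ex] := eqVneq s [::].
  exists [set x; y]; rewrite ?pe_cons ?mem_head //.
  by move: zs; rewrite s0 !inE => ->; rewrite orbT.
by have [e es ze] := ex y zs; exists e; rewrite // pe_cons in_cons es orbT.
Qed.

(** The ends are leaves, so removing the path isolates them and they can be deleted; each inner
    vertex loses two edges and keeps odd degree. *)
Lemma link_rest B H x s y : graph_on B H -> uniq B -> odd_on B H ->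
  simple_path H x (rcons s y) -> degree_in H x = 1 -> degree_in H y = 1 ->
  exists F B', [/\ perm_eq H (pe x (rcons s y) ++ F), perm_eq B [:: x, y & B'],
    graph_on B' F, odd_on B' F & {subset s <= B}].
Proof.
move=> gB uB oB /andP[ps us] dx dy; have [uH sH inB] := gB.
have sub := path_subset ps.
have [F pF] := perm_subset (uniq_pe us) sub.
have xy : x != y.
  by move: us; rewrite /= mem_rcons inE negb_or => /andP[/andP[]].
have in_path z : z \in x :: rcons s y -> z \in B.
  move=> zp; have [|e es ze] := mem_path_edge _ zp; first by case: (s).
  exact: inB (sub e es) ze.
have [B' pB] : exists B', perm_eq B ([:: x; y] ++ B').
  apply: perm_subset; first by rewrite /= inE xy.
  by move=> z; rewrite !inE => /orP[]/eqP->; apply: in_path; rewrite ?mem_head // inE mem_rcons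
    mem_head orbT.
have dF z : degree_in H z = degree_in (pe x (rcons s y)) z + degree_in F z.
  by rewrite (degree_in_perm _ pF) degree_in_cat.
have Fx : degree_in F x = 0.
  have : 0 < degree_in (pe x (rcons s y)) x by apply: has_pe_first; case: (s).
  by move: dx; rewrite dF; case: (degree_in (pe _ _) x) => // n [/eqP]; rewrite addn_eq0 =>
    /andP[_ /eqP].
have Fy : degree_in F y = 0.
  have := has_pe_last x s y.
  by move: dy; rewrite dF; case: (degree_in (pe _ _) y) => // n [/eqP]; rewrite addn_eq0 =>
    /andP[_ /eqP].
exists F, B'; split => //.
- exact: graph_on_delete (graph_on_rest pF gB) pB Fx Fy.
- move=> z zB'; have zB : z \in B by rewrite (perm_mem pB) !inE zB' !orbT.
  have := oB z zB; rewrite dF oddD.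
  have -> : odd (degree_in (pe x (rcons s y)) z) = false.
    rewrite /degree_in degree_pe ?last_rcons; last exact: simple2_sub sub sH.
    have := uB; rewrite (perm_uniq pB) /= !inE !negb_or => /and3P[/andP[_ xB'] yB' _].
    have [xz yz] : x != z /\ y != z.
      by split; [apply: contraNneq xB'|apply: contraNneq yB'] => ->.
    by rewrite (negbTE xz) (negbTE yz).
  by [].
by move=> z zs; apply: in_path; rewrite inE mem_rcons inE zs !orbT.
Qed.

(** The path between the terminals is one more row and makes their number even. *)
Lemma good_link_rows A x s y : uniq ([:: x, y & s] ++ A) -> odd (size A) ->
  ~~ par sg (pe x (rcons s y) ++ prows x y (map Some A)) ->
  good sg (pe x (rcons s y) ++ prows x y (map Some A)).
Proof.
move=> u oA ev; pose Rs := s :: map (@seq_of_opt V) (map Some A).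
have eR : pe x (rcons s y) ++ prows x y (map Some A) = flatten (map (row x y) Rs).
  by rewrite /prows /Rs /= -[in RHS]map_comp.
rewrite eR in ev *; apply: good_parallel => //; last by rewrite /= !size_map oA.
rewrite /= -map_comp (_ : flatten (map _ A) = A) //.
by elim: (A) => //= a A' ->.
Qed.

(** Even links are split off one by one. If none exists, [H2] is a perfect matching of [B], and each
    edge with the rows at its ends is odd. Such an edge is combined with an odd cycle of [H1] or,
    when [H1] is empty, with a second such edge. The last hypothesis keeps K5 away from the case of
    two vertices in [B]. *)
Lemma good_odd_even A B H1 H2 : uniq (A ++ B) -> odd (size A) -> 2 < size A ->
  ~~ odd (size B) -> 0 < size B -> graph_on A H1 -> eulerian_list H1 ->
  graph_on B H2 -> odd_on B H2 -> ~~ par sg (H1 ++ H2 ++ bip A B) ->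
  (size A = 3 -> H1 = [::]) -> good sg (H1 ++ H2 ++ bip A B).
Proof.
have [n] := ubnP (size B + size H1 + size H2); elim: n B H1 H2 => // n IH B H1 H2.
move=> ltn u oA A2 evB B0 g1 e1 g2 o2 ev nex.
have [uH1 sH1 in1] := g1; have [uH2 sH2 in2] := g2.
have uB : uniq B by move: u; rewrite cat_uniq => /and3P[].
have nH2 : H2 != [::].
  by case: (B) B0 o2 => // b B1 _ /(_ b (mem_head _ _)); case: (H2).
(* On two vertices [H2] is the single edge between them, which serves as the row [None]. *)
have [sB2|sBn2] := eqVneq (size B) 2.
  case: B sB2 u evB B0 g2 o2 ev in2 uB {ltn} => [|b [|b' []]] // _ u _ _ g2 o2 ev in2 uB.
  have [bb okR uA] := uniq_cat_rows u (perm_refl _).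
  have pH2 : perm_eq H2 [:: [set b; b']].
    apply: uniq_perm => // e; rewrite inE.
    have mem2 e' : e' \in H2 -> e' = [set b; b'].
      move=> eH; have /cards2P[x [y [xy ee]]] := allP sH2 e' eH.
      have xe : x \in [:: b; b'] by apply: (in2 e'); rewrite // ee !inE eqxx.
      have ye : y \in [:: b; b'] by apply: (in2 e'); rewrite // ee !inE eqxx orbT.
      move: xe ye xy; rewrite ee !inE => /orP[]/eqP-> /orP[]/eqP->; rewrite ?eqxx //.
      by rewrite setUC.
    apply/idP/eqP => [/mem2//|->].
    by case: (H2) nH2 mem2 => // e' H' _ mem2; rewrite -(mem2 e') mem_head.
  have pE : perm_eq (H1 ++ prows b b' (None :: map Some A)) (H1 ++ H2 ++ bip A [:: b; b']).
    rewrite perm_cat2l prows_cons perm_sym; apply: perm_cat => //; exact: bip_rows.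
  apply: good_perm (pE) _; apply: good_terminals => //.
  - rewrite /rows_ok; move: okR; rewrite /rows_ok /= !inE => /and3P[-> -> ->].
    by rewrite !andbT; apply/mapP => -[].
  - by move=> e x eH xe; rewrite inE map_f ?orbT //; apply: in1 eH xe.
  - by rewrite /= size_map oA.
  - by rewrite (par_perm _ pE).
  by rewrite /= size_map => -[/nex ->].
have B4 : 3 < size B.
  by move: B0 evB sBn2; case: (size B) => [|[|[|[|]]]].
have [oH2|[c [uc sc sub evc]]] := all_odd_or_even sg H2; last first.
  have [F pF] := cycle_rest uH2 uc sc sub.
  have pE : perm_eq (ce c ++ (H1 ++ F ++ bip A B)) (H1 ++ H2 ++ bip A B).
    have := perm_cat (perm_cat (perm_refl H1) pF) (perm_refl (bip A B)).
    by rewrite -[X in perm_eq X _]catA perm_sym; apply: perm_trans; perm_count.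
  have gc : good sg (ce c) by apply: good_cycle.
  apply: good_perm (pE) _; apply: good_cat => //; apply: IH => //.
  - move: ltn sc; rewrite (perm_size pF) size_cat size_ce; size_lia.
  - exact: graph_on_rest pF g2.
  - move=> x xB; have := o2 x xB; rewrite (degree_in_perm _ pF) degree_in_cat oddD.
    by rewrite (negbTE (eulerian_ce _ x)) //; apply: simple2_sub sub sH2.
  - by move: ev; rewrite -(par_perm _ pE) par_cat (negbTE (good_par gc)).
pose f b := par sg (bip A [:: b]).
have linkE x y : par sg (prows x y (map Some A)) = f x (+) f y.
  by rewrite -(par_perm _ (bip_rows A x y)) par_bip /= addn0 oddD !oddb.
have step x s y : simple_path H2 x (rcons s y) -> degree_in H2 x = 1 ->
    degree_in H2 y = 1 -> even_link sg f x (rcons s y) -> good sg (H1 ++ H2 ++ bip A B).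
  move=> pxy dx dy el; have [F [B' [pF pB gF oF sB]]] := link_rest g2 uB o2 pxy dx dy.
  have [xy okR uB'] := uniq_cat_rows u pB; have pK := bip_split A pB.
  have gW : good sg (pe x (rcons s y) ++ prows x y (map Some A)).
    apply: good_link_rows => //; last first.
      by move: el; rewrite /even_link last_rcons par_cat linkE addbC.
    have := pxy => /andP[_ us].
    rewrite (perm_uniq (s2 := (x :: rcons s y) ++ A)); last by rewrite -cats1; perm_count.
    rewrite cat_uniq us /=; have := u; rewrite cat_uniq => /and3P[-> dis _]; rewrite andbT.
    apply/hasPn => a aA; apply: contra dis => ap; apply/hasP; exists a => //.
    move: ap; rewrite (perm_mem pB) !inE mem_rcons inE => /or3P[->//|->|/sB]; rewrite ?orbT //.
    by rewrite (perm_mem pB) !inE.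
  have pE : perm_eq ((pe x (rcons s y) ++ prows x y (map Some A)) ++ (H1 ++ F ++ bip A B'))
      (H1 ++ H2 ++ bip A B).
    have := perm_cat (perm_refl H1) (perm_cat pF pK); rewrite perm_sym; apply: perm_trans.
    by perm_count.
  have sB' := perm_size pB; rewrite /= in sB'.
  apply: good_perm (pE) _; apply: good_cat => //; apply: IH => //.
  - move: ltn sB'; rewrite (perm_size pF) size_cat; size_lia.
  - by move: evB; rewrite sB' /= negbK.
  - by move: B4; rewrite sB'; case: (size B').
  by move: ev; rewrite -(par_perm _ pE) par_cat (negbTE (good_par gW)).
have [[x [s [pxs ss dx dy el]]]|all1] := leaf_link f uH2 sH2 oH2 in2 o2 nH2.
  case/lastP: s ss pxs dy el => // s y _; rewrite last_rcons => pxs dy.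
  exact: step.
have edge_step F B1 : graph_on B1 F -> odd_on B1 F -> 0 < size B1 -> {subset F <= H2} ->
    exists x y, [/\ simple_path F x [:: y], simple_path H2 x [:: y], x \in B & y \in B].
  move=> gF oF sB1 sub; have [e eF] : exists e, e \in F.
    by case: B1 gF oF sB1 => // b B2 _ /(_ b (mem_head _ _)); case: (F) => // e F' _ _; exists
      e; apply: mem_head.
  have eH := sub e eF; have /cards2P[x [y [xy ee]]] := allP sH2 e eH.
  exists x, y; rewrite ee in eF eH; rewrite /simple_path /= /joined xy eF eH inE xy.
  by split=> //; apply: (in2 _ _ eH); rewrite !inE eqxx ?orbT.
have [x [y [_ pxy xB yB]]] := edge_step H2 B g2 o2 B0 (fun _ => id).
have [el|ol] := boolP (even_link sg f x [:: y]).
  by apply: (step x [::] y) => //; apply: all1.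
have [F [B' [pF pB gF oF _]]] :=
  link_rest (s := [::]) g2 uB o2 pxy (all1 x xB) (all1 y yB).
have [xy okR uB'] := uniq_cat_rows u pB; have pK := bip_split A pB.
have sB' : size B = (size B').+2 := perm_size pB.
have B'0 : 0 < size B' by move: B4; rewrite sB'; case: (size B').
have evB' : ~~ odd (size B') by move: evB; rewrite sB' /= negbK.
have oW : par sg (prows x y (None :: map Some A)).
  by move: ol; rewrite prows_cons par_cat linkE /even_link negbK addbC.
have pW : perm_eq (prows x y (None :: map Some A) ++ (F ++ bip A B')) (H2 ++ bip A B).
  have := perm_cat pF pK; rewrite perm_sym; apply: perm_trans.
  by rewrite prows_cons; perm_count.
have [n1|n1] := eqVneq H1 [::]; last first.
  have [C [uC sC subC]] := exists_cycle uH1 sH1 e1 n1.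
  have [F1 pF1] := cycle_rest uH1 uC sC subC.
  have gF1 := graph_on_rest pF1 g1.
  have sce : simple2 (ce C) by apply: simple2_sub subC sH1.
  have eF1 := eulerian_rest pF1 e1 (eulerian_ce sce).
  have nex' : size A = 3 -> F1 = [::] by move=> /nex n1'; rewrite n1' in n1.
  have [oC|evC] := boolP (par sg (ce C)); last first.
    have pE : perm_eq (ce C ++ (F1 ++ H2 ++ bip A B)) (H1 ++ H2 ++ bip A B).
      by rewrite catA perm_cat2r perm_sym.
    have gc : good sg (ce C) by apply: good_cycle.
    apply: good_perm (pE) _; apply: good_cat => //; apply: IH => //.
      move: ltn sC; rewrite (perm_size pF1) size_cat size_ce; size_lia.
    by move: ev; rewrite -(par_perm _ pE) par_cat (negbTE (good_par gc)).
  have gCW : good sg (ce C ++ prows x y (None :: map Some A)).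
    apply: good_terminals => //.
    - exact: uniq_ce.
    - exact: eulerian_ce.
    - rewrite /rows_ok; move: okR; rewrite /rows_ok /= !inE => /and3P[-> -> ->].
      by rewrite !andbT; apply/mapP => -[].
    - move=> e v eC ve; rewrite inE map_f ?orbT //.
      by apply: (in1 e) => //; apply: subC.
    - by rewrite /= size_map oA.
    - by rewrite par_cat oC oW.
    by rewrite /= size_map => -[/nex n1']; rewrite n1' in n1.
  have pE : perm_eq ((ce C ++ prows x y (None :: map Some A)) ++ (F1 ++ F ++ bip A B'))
      (H1 ++ H2 ++ bip A B).
    apply/permP => e; move: (permP pF1 e) (permP pW e).
    by rewrite !count_cat; count_lia.
  apply: good_perm (pE) _; apply: good_cat => //; apply: IH => //.
    move: ltn sB'; rewrite (perm_size pF1) (perm_size pF) !size_cat; size_lia.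
  by move: ev; rewrite -(par_perm _ pE) par_cat (negbTE (good_par gCW)).
subst H1; rewrite /= in ev *.
have subF : {subset F <= H2} by move=> e eF; rewrite (perm_mem pF) mem_cat eF orbT.
have [x2 [y2 [px2F px2 x2B y2B]]] := edge_step F B' gF oF B'0 subF.
have [el2|ol2] := boolP (even_link sg f x2 [:: y2]).
  by apply: (step x2 [::] y2) => //; apply: all1.
have uBB' : uniq B' by move: uB; rewrite (perm_uniq pB) /= => /and3P[].
have le1 v : v \in B -> odd (degree_in F v) -> degree_in F v = 1.
  move=> vB; have := all1 v vB; rewrite (degree_in_perm _ pF) degree_in_cat.
  by case: (degree_in F v) => [|[|k]] //; rewrite !addnS.
have inB' v : v \in [:: x2; y2] -> v \in B'.
  have [_ _ inF] := gF; move/andP: px2F => [/andP[/andP[_ eF] _] _].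
  by move=> vin; apply: (inF _ _ eF); move: vin; rewrite !inE.
have [dx2 dy2] : degree_in F x2 = 1 /\ degree_in F y2 = 1.
  by split; apply: le1 => //; apply: oF; apply: inB'; rewrite !inE eqxx ?orbT.
have [F2 [B2 [pF2 pB2 gF2 oF2 _]]] := link_rest (s := [::]) gF uBB' oF px2F dx2 dy2.
have pK2 := bip_split A pB2.
have oW2 : par sg (prows x2 y2 (None :: map Some A)).
  by move: ol2; rewrite prows_cons par_cat linkE /even_link negbK addbC.
have gWW : good sg (prows x y (None :: map Some A) ++ prows x2 y2 (None :: map Some A)).
  apply: good_two_pairs => //.
  have pBB : perm_eq B ([:: x; y; x2; y2] ++ B2).
    by apply: perm_trans pB _; rewrite !perm_cons.
  have := u; rewrite (perm_uniq (perm_cat (perm_refl A) pBB)) catA cat_uniq => /andP[+ _].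
  by rewrite uniq_catC.
have pE : perm_eq ((prows x y (None :: map Some A) ++ prows x2 y2 (None :: map Some A)) ++
    (F2 ++ bip A B2)) (H2 ++ bip A B).
  apply/permP => e; move: (permP pW e) (permP pF2 e) (permP pK2 e).
  by rewrite (prows_cons x2 y2) !count_cat; count_lia.
apply: good_perm (pE) _; apply: good_cat => //.
have ev2 : ~~ par sg (F2 ++ bip A B2).
  by move: ev; rewrite -(par_perm _ pE) par_cat (negbTE (good_par gWW)).
have sB2 : size B' = (size B2).+2 := perm_size pB2.
have [B20|B20] := posnP (size B2).
  have [_ sF2 inF2] := gF2; rewrite (size0nil B20) in inF2 *.
  have -> : F2 = [::].
    case: (F2) sF2 inF2 => // e F3 /andP[/cards2P[v [w [_ ee]]] _] inF2.
    by have := inF2 e v (mem_head _ _); rewrite ee !inE eqxx => /(_ isT).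
  apply: (good_perm (E := [::])); last exact: good_nil.
  by rewrite perm_sym (perm_trans (bip_sym _ _)).
apply: (IH B2 [::] F2) => //.
- move: ltn sB' sB2 (perm_size pF) (perm_size pF2); rewrite !size_cat /=; size_lia.
- by have [_ _ ->] := uniq_cat_rows uB' pB2.
- by move: evB'; rewrite sB2 /= negbK.
Qed.

End OddEven.

(** * A triangle as the odd side, and all cases together *)

Section Joins.
Variables (V : finType) (sg : pred {set V}).
Implicit Types (x y a b p q : V) (A B C D s t : seq V) (E F H : seq {set V}).

Lemma degree_star d B v : uniq B -> d \notin B ->
  degree_in [seq [set d; b] | b <- B] v = if v == d then size B else (v \in B).
Proof.
move=> uB dB; rewrite /degree_in count_map; have [->|vd] := eqVneq v d.
  by apply/eqP; rewrite -all_count; apply/allP => b _; rewrite /= !inE eqxx.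
rewrite -count_uniq_mem //; apply: eq_count => b.
by rewrite /= !inE (negbTE vd) eq_sym.
Qed.

Lemma degree_out B H v : graph_on B H -> v \notin B -> degree_in H v = 0.
Proof.
move=> [_ _ inB] vB; apply/eqP; rewrite eqn0Ngt -has_count.
by apply/hasPn => e eH; apply: contra vB; apply: inB.
Qed.

Lemma triangle A H : uniq A -> size A = 3 -> graph_on A H -> eulerian_list H ->
  H != [::] -> exists a b d, perm_eq A [:: a; b; d] /\ perm_eq H (ce [:: a; b; d]).
Proof.
move=> uA sA gA eH nH; have [uH sH inA] := gA.
have [c [uc sc sub]] := exists_cycle uH sH eH nH.
have [A' pA] := perm_subset uc (cycle_vertices gA sub).
have [F pF] := cycle_rest uH uc sc sub.
have sH3 : size H <= 3.
  rewrite -leq_double -(handshake sH uA inA) -[3.*2]/(3 * 2) -sA.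
  rewrite -sum1_size big_distrl /= !big_seq leq_sum // => v vA; rewrite mul1n.
  by have := degree_bound uH sH uA vA inA; rewrite sA.
have := perm_size pA; have := perm_size pF; rewrite !size_cat size_ce sA => s1 s2.
have c3 : size c = 3 by move: sc s2; clear; size_lia.
have [F0 A0] : size F = 0 /\ size A' = 0.
  by split; move: sH3 s1 s2; rewrite c3; size_lia.
rewrite (size0nil F0) cats0 in pF; rewrite (size0nil A0) cats0 in pA.
by case: c c3 pF pA {uc sc sub s1 s2} => [|a [|b [|d []]]] // _ pF pA; exists a, b, d.
Qed.

(** Two vertices [a], [b] of the triangle are the terminals, and the third, [d], joins the other
    side: its star to [B] corrects the odd degrees of [H2]. The rows are the edge [ab], the path
    through [d] and those of [B], at least six in all, so the exception cannot occur. *)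
Lemma good_triangle_odd A B H1 H2 : uniq (A ++ B) -> size A = 3 ->
  ~~ odd (size B) -> 2 < size B -> graph_on A H1 -> eulerian_list H1 -> H1 != [::] ->
  graph_on B H2 -> odd_on B H2 -> ~~ par sg (H1 ++ H2 ++ bip A B) ->
  good sg (H1 ++ H2 ++ bip A B).
Proof.
move=> u sA evB B2 g1 e1 n1 g2 o2 ev; have [uH2 sH2 in2] := g2.
have [uA dis uB] : [/\ uniq A, ~~ has (mem A) B & uniq B].
  by move: u; rewrite cat_uniq => /and3P.
have [a [b [d [pA pH1]]]] := triangle uA sA g1 e1 n1.
have inA v : v \in [:: a; b; d] -> v \notin B.
  by rewrite -(perm_mem pA) => vA; apply: contra dis => vB; apply/hasP; exists v.
have := uA; rewrite (perm_uniq pA) /= !inE negb_or => /and3P[/andP[ab ad] bd _].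
have dB : d \notin B by apply: inA; rewrite !inE eqxx !orbT.
have pE : perm_eq ((H2 ++ [seq [set d; x] | x <- B]) ++
    prows a b (None :: Some d :: map Some B)) (H1 ++ H2 ++ bip A B).
  have pK : perm_eq (bip A B) (prows a b (map Some B) ++ [seq [set d; x] | x <- B]).
    apply: perm_trans (bip_perm pA (perm_refl B)) _.
    apply: (perm_trans (y := bip [:: a; b] B ++ [seq [set d; x] | x <- B])).
      by rewrite !bip_cons -!catA /bip /= !cats0.
    rewrite perm_cat2r; apply: perm_trans (bip_sym _ _) _; exact: bip_rows.
  have pT : perm_eq H1 (prow a b None ++ prow a b (Some d)).
    apply: perm_trans pH1 _; rewrite /prow /row /ce /pe /= [[set b; d]]setUC [[set d; a]]setUC.
    by perm_count.
  apply/permP => e; move: (permP pK e) (permP pT e).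
  by rewrite !prows_cons !count_cat; count_lia.
apply: good_perm (pE) _; apply: good_terminals => //.
- rewrite cat_uniq uH2 map_inj_in_uniq ?uB ?andbT /=.
    apply/hasPn => e /mapP[x xB ->]; apply: contra dB => /in2; apply.
    by rewrite !inE eqxx.
  move=> x y xB yB /setP/(_ y); rewrite !inE eqxx orbT => /orP[]/eqP // yd.
  by rewrite yd (negbTE dB) in yB.
- rewrite /simple2 all_cat -[all _ H2]/(simple2 H2) sH2; apply/allP => e /mapP[x xB ->].
  by rewrite cards2; apply/eqP; rewrite (_ : d != x) //; apply: contraNneq dB => ->.
- move=> v; rewrite degree_in_cat degree_star // oddD.
  have [->|vd] := eqVneq v d; first by rewrite (degree_out g2 dB).
  case vB : (v \in B); first by rewrite o2.
  by rewrite (degree_out g2) ?vB.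
- rewrite /rows_ok /= !inE /= !mem_map; try exact: Some_inj.
  have [aB bB] : a \notin B /\ b \notin B by split; apply: inA; rewrite !inE eqxx ?orbT.
  rewrite (map_inj_uniq (@Some_inj _)) uB (negbTE dB) (negbTE aB) (negbTE bB) !orbF.
  rewrite !(inj_eq (@Some_inj _)) negb_or ab ad bd /= ?andbT.
  by apply/mapP => -[].
- have inR v : (v == d) || (v \in B) -> Some v \in None :: Some d :: map Some B.
    by rewrite !in_cons mem_map; last exact: Some_inj.
  move=> e v; rewrite mem_cat => /orP[eH ve|/mapP[x xB ->] vdx]; apply: inR.
    by rewrite (in2 _ _ eH ve) orbT.
  by move: vdx; rewrite !inE => /orP[/eqP->|/eqP->]; rewrite ?eqxx ?xB ?orbT.
- by rewrite /= size_map !negbK.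
- by rewrite (par_perm _ pE).
by rewrite /= size_map => -[sB]; move: B2 evB; rewrite sB.
Qed.

Lemma handshake_odd B H : uniq B -> graph_on B H -> odd_on B H -> ~~ odd (size B).
Proof.
move=> uB [_ sH inB] oB; have := handshake sH uB inB.
move/(congr1 odd); rewrite odd_double => /negbT; congr (~~ _).
have : {subset B <= B} by [].
elim: {1 3 4}B => [|x s IH] sub; first by rewrite big_nil.
rewrite big_cons oddD oB ?sub ?mem_head //= IH // => y ys.
by apply: sub; rewrite inE ys orbT.
Qed.

(** For an Eulerian join the first case is K5 with an edge subdivided, [B] consisting of the ends of
    that edge, and the second is K5. *)
Definition bad_join A B H :=
  [|| [&& size A == 4, size B == 2 & size H == 3] |
      [&& size A == 3, size B == 2 & size H != 0]].

Lemma good_join A B H1 H2 : uniq (A ++ B) -> 1 < size A -> 1 < size B ->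
  graph_on A H1 -> graph_on B H2 ->
  {in A, forall x, odd (degree_in H1 x) = odd (size B)} ->
  {in B, forall x, odd (degree_in H2 x) = odd (size A)} ->
  ~~ bad_join A B H1 -> ~~ bad_join B A H2 -> ~~ par sg (H1 ++ H2 ++ bip A B) ->
  good sg (H1 ++ H2 ++ bip A B).
Proof.
have odd_case A' B' F1 F2 : uniq (A' ++ B') -> 1 < size A' -> 1 < size B' ->
    odd (size A') -> graph_on A' F1 -> graph_on B' F2 ->
    {in A', forall x, odd (degree_in F1 x) = odd (size B')} ->
    {in B', forall x, odd (degree_in F2 x) = odd (size A')} ->
    ~~ bad_join A' B' F1 -> ~~ par sg (F1 ++ F2 ++ bip A' B') ->
    good sg (F1 ++ F2 ++ bip A' B').
  move=> u A2 B2 oA g1 g2 d1 d2 nb ev.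
  have [uA uB] : uniq A' /\ uniq B' by move: u; rewrite cat_uniq => /and3P[].
  have o2 : odd_on B' F2 by move=> x xB; rewrite d2.
  have evB := handshake_odd uB g2 o2.
  have e1 : eulerian_list F1.
    move=> x; have [xA|xA] := boolP (x \in A'); first by rewrite d1.
    by rewrite (degree_out g1 xA).
  have A3 : 2 < size A' by case: (size A') A2 oA => [|[|[]]].
  have [/andP[/eqP sA n1]|nt] := boolP ((size A' == 3) && (F1 != [::])).
    apply: good_triangle_odd => //.
    move: nb; rewrite /bad_join sA /= size_eq0 n1 andbT.
    by case: (size B') B2 evB => [|[|[]]].
  apply: good_odd_even => //; first exact: ltnW.
  by move=> sA; move: nt; rewrite sA /= negbK => /eqP.
move=> u A2 B2 g1 g2 d1 d2 nb1 nb2 ev.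
have [oA|evA] := boolP (odd (size A)); first exact: odd_case.
have pE : perm_eq (H2 ++ H1 ++ bip B A) (H1 ++ H2 ++ bip A B).
  by rewrite perm_catCA !perm_cat2l bip_sym.
have [oB|evB] := boolP (odd (size B)).
  apply: good_perm (pE) _; apply: odd_case => //; first by rewrite uniq_catC.
  by rewrite (par_perm _ pE).
have el D F n : graph_on D F -> ~~ odd n -> {in D, forall x, odd (degree_in F x) = odd n} ->
    eulerian_list F.
  move=> gD evn dD x; have [xD|xD] := boolP (x \in D); first by rewrite dD.
  by rewrite (degree_out gD xD).
apply: good_even_even => //; try exact: ltnW.
- exact: el g1 evB d1.
- exact: el g2 evA d2.
- by move=> sA sB; move: nb1; rewrite /bad_join sA sB /= orbF.
- by move=> sB sA; move: nb2; rewrite /bad_join sA sB /= orbF.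
Qed.

End Joins.

(** * Subdivisions *)

Section FlattenUniq.
Variables S T : eqType.
Implicit Types (g : S -> seq T) (s : seq S).

Lemma uniq_flatten_map g s : uniq s -> {in s, forall a, uniq (g a)} ->
  (forall a b x, a \in s -> b \in s -> x \in g a -> x \in g b -> a = b) ->
  uniq (flatten (map g s)).
Proof.
elim: s => //= a s IH /andP[aN us] ug dis; rewrite cat_uniq ug ?mem_head //=.
rewrite IH // ?andbT; first last.
- by move=> b c x bs cs; apply: dis; rewrite inE ?bs ?cs orbT.
- by move=> b bs; apply: ug; rewrite inE bs orbT.
 apply/hasPn => x /flatten_mapP[b bs xb]; apply: contra aN => xa.
by rewrite (dis a b x) ?mem_head // inE bs orbT.
Qed.

Lemma uniq_flatten_inj g s a b x : uniq (flatten (map g s)) ->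
  a \in s -> b \in s -> x \in g a -> x \in g b -> a = b.
Proof.
elim: s => //= c s IH; rewrite cat_uniq => /and3P[_ dis us].
have nd d : d \in s -> x \in g d -> x \notin g c.
  move=> ds xd; apply/negP => xc; case/hasP: dis; exists x => //.
  by apply/flatten_mapP; exists d.
rewrite !inE => /orP[/eqP->|as_] /orP[/eqP->|bs] // xa xb; last exact: IH.
  by move: (nd _ bs xb); rewrite xa.
by move: (nd _ as_ xa); rewrite xb.
Qed.

Lemma uniq_flatten_mem g s a : uniq (flatten (map g s)) -> a \in s -> uniq (g a).
Proof.
elim: s => //= b s IH; rewrite inE cat_uniq.
by move=> /and3P[ub _ us] /orP[/eqP->|] //; apply: IH.
Qed.

End FlattenUniq.

Section Edges.
Variable G : sgraph.
Implicit Types (x y : G) (s c : seq G) (e : {set G}).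

Lemma edgesP e : reflect (exists x y, adj x y /\ e = [set x; y]) (e \in edges G).
Proof.
rewrite inE; apply: (iffP existsP) => [[x /existsP[y /andP[a /eqP->]]]|[x [y [a ->]]]].
  by exists x, y.
by exists x; apply/existsP; exists y; rewrite a eqxx.
Qed.

Lemma set2_eq x y u v : [set x; y] = [set u; v] -> x = u /\ y = v \/ x = v /\ y = u.
Proof.
move=> E; have : x \in [set u; v] by rewrite -E !inE eqxx.
rewrite !inE => /orP[]/eqP ex; rewrite ex in E *; [left|right].
  by split; [|apply: set2_inj E].
by split=> //; rewrite [RHS in _ = RHS]setUC in E; apply: set2_inj E.
Qed.

Lemma mem_edges x y : ([set x; y] \in edges G) = adj x y.
Proof.
apply/edgesP/idP => [[u [v [a]]]|a]; last by exists x, y.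
by case/set2_eq => -[-> ->] //; rewrite adj_sym.
Qed.

Lemma simple2_edges (E : seq {set G}) : {subset E <= edges G} -> simple2 E.
Proof.
move=> sub; apply/allP => e /sub/edgesP[x [y [a ->]]]; rewrite cards2.
by have [xy|] := eqVneq x y; first by rewrite xy adj_irr in a.
Qed.

Lemma path_pe (E : {pred {set G}}) x s : {subset pe x s <= E} ->
  path (fun a b => [set a; b] \in E) x s.
Proof.
elim: s x => //= y s IH z sub; rewrite sub ?pe_cons ?mem_head //=.
by apply: IH => e es; apply: sub; rewrite pe_cons inE es orbT.
Qed.

Lemma cycle_adj c : {subset ce c <= edges G} -> cycle (@adj G) c.
Proof.
case: c => // x s /path_pe; rewrite (cycle_path x).
by apply: sub_path => a b; rewrite mem_edges.
Qed.

Lemma pe_path (r : rel G) x s e : path r x s -> e \in pe x s ->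
  exists a b, [/\ a \in x :: s, r a b & e = [set a; b]].
Proof.
elim: s x => //= y s IH x /andP[rxy ps]; rewrite pe_cons inE => /orP[/eqP->|es].
  by exists x, y; rewrite mem_head.
have [a [b [ay rab ->]]] := IH y ps es; exists a, b; split=> //.
by rewrite inE ay orbT.
Qed.

Lemma cycle_edgesE c : uniq c -> cycle_edges c =i ce c.
Proof.
move=> uc e; apply/imsetP/idP => [[x xc ->]|].
  have cyc : cycle (fun a b => [set a; b] \in ce c) c.
    by case: (c) => // y s; rewrite (cycle_path y); apply: path_pe.
  exact: next_cycle cyc xc.
have := cycle_next uc; case: (c) => // x s; rewrite (cycle_path x) => /pe_path h /h.
move=> [a [b [ac /eqP ab ->]]]; exists a; rewrite ?ab //.
by move: ac; rewrite inE => /orP[/eqP->|//]; exact: (mem_last x s).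
Qed.

Lemma even_cycle_decomposable_seq (cs : seq (seq G)) :
  all (fun c => uniq c && ~~ odd (size c)) cs ->
  perm_eq (flatten (map (@ce G) cs)) (enum (edges G)) -> even_cycle_decomposable G.
Proof.
move=> ev pE; pose ds := [seq c <- cs | c != [::]].
have eds : flatten (map (@ce G) ds) = flatten (map (@ce G) cs).
  by rewrite /ds; elim: (cs) => //= -[|x c] cs' /= ->.
have u : uniq (flatten (map (@ce G) ds)) by rewrite eds (perm_uniq pE) enum_uniq.
have memE e : (e \in edges G) = (e \in flatten (map (@ce G) ds)).
  by rewrite eds (perm_mem pE) mem_enum.
have dsP c : c \in ds -> [/\ is_cycle c, uniq c & ~~ odd (size c)].
  move=> cds; have := cds; rewrite mem_filter => /andP[nc /(allP ev)/andP[uc ec]].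
  have sub : {subset ce c <= edges G}.
    by move=> e ec'; rewrite memE; apply/flatten_mapP; exists c.
  split=> //; split; last by rewrite /ucycle cycle_adj.
  (* A closed walk with one vertex has odd size, and one with two vertices would repeat its edge;
     only genuine cycles remain. *)
  have uce := uniq_flatten_mem u cds.
  move: c nc ec uce {cds uc sub}; case=> [|x [|y []]] // _ _.
  by rewrite /ce /pe /= !inE setUC eqxx.
pose P := [set B in map (@cycle_edges G) ds].
have PB B : B \in P -> exists2 c, c \in ds & B = cycle_edges c.
  by rewrite inE => /mapP[c cd ->]; exists c.
exists P; last first.
  by move=> B /PB[c /dsP[? _ ?] ->]; exists c.
apply/and3P; split.
- apply/eqP/setP => e; rewrite memE; apply/bigcupP/flatten_mapP.
    move=> [B /PB[c cd ->] eB]; exists c => //.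
    by have [_ uc _] := dsP c cd; rewrite -cycle_edgesE.
  move=> [c cd ec]; exists (cycle_edges c); first by rewrite inE map_f.
  by have [_ uc _] := dsP c cd; rewrite cycle_edgesE.
- apply/trivIsetP => B B' /PB[c cd ->] /PB[c' cd' ->]; apply: contraNT.
  case/pred0Pn => e /andP[/= ec ec'].
  have [_ uc _] := dsP c cd; have [_ uc' _] := dsP c' cd'.
  by rewrite (uniq_flatten_inj u cd cd' (x := e)) // -cycle_edgesE.
apply/negP => /PB[c cd /setP c0]; have [[sc _] uc _] := dsP c cd.
case: c sc uc c0 {cd} => // x s _ uc /(_ [set last x s; x]).
by rewrite inE cycle_edgesE // ce_first mem_head.
Qed.

End Edges.

Section PathEdges.
Variable V : finType.
Implicit Types (x y a b : V) (s L : seq V) (e : {set V}).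

Lemma infix_pe x s e :
  reflect (exists a b, infix [:: a; b] (x :: s) /\ e = [set a; b]) (e \in pe x s).
Proof.
elim: s x => [|y s IH] x.
  by apply: (iffP idP) => // -[a [b [/=]]]; rewrite andbF.
rewrite pe_cons in_cons; apply: (iffP orP) => [[/eqP->|/IH[a [b [ab ->]]]]|[a [b [+ ee]]]].
- by exists x, y; rewrite /= !eqxx prefix0s.
- by exists a, b; split=> //; apply/orP; right.
case/orP => [/= /and3P[/eqP ax /eqP bys _]|ab]; first by left; rewrite ee ax bys.
by right; apply/IH; exists a, b.
Qed.

Lemma inner_vertex x s y e : s != [::] -> e \in pe x (rcons s y) ->
  exists2 z, z \in s & z \in e.
Proof.
elim: s x => // z [|w s] IH x _; rewrite /= pe_cons inE => /orP[/eqP->|es].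
- by exists z; rewrite ?mem_head // !inE eqxx orbT.
- by move: es; rewrite /pe /= !inE => /eqP->; exists z; rewrite !inE eqxx.
- by exists z; rewrite ?mem_head // !inE eqxx orbT.
by have [//|v vs ve] := IH z _ es; exists v; rewrite // inE vs orbT.
Qed.

Lemma ce_last a L : L != [::] -> ce L = pe (last a L) L.
Proof. by case: L. Qed.

End PathEdges.

Section Lift.
Variables (G H : sgraph) (f : G -> H) (P : G -> G -> seq H).
Hypothesis S : subdivision_via f P.
Implicit Types (u v w : G) (x y : H) (c s : seq G) (e : {set G}) (E : seq {set G}).

Definition subdivided_edge u v : seq {set H} := pe (f u) (rcons (P u v) (f v)).

(** The path that replaces an edge is stored once per orientation, so an orientation must be picked;
    by [subdiv_rev] the choice affects lists of edges only up to permutation. *)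
Definition ends e : option (G * G) :=
  [pick p : G * G | adj p.1 p.2 && (e == [set p.1; p.2])].

Definition expand e := if ends e is Some p then subdivided_edge p.1 p.2 else [::].
Definition inner e := if ends e is Some p then P p.1 p.2 else [::].

Lemma endsP u v : adj u v -> ends [set u; v] = Some (u, v) \/ ends [set u; v] = Some (v, u).
Proof.
move=> a; rewrite /ends; case: pickP => [[u' v'] /= /andP[_ /eqP]|/(_ (u, v))].
  by case/set2_eq => -[-> ->]; [left|right].
by rewrite /= a eqxx.
Qed.

Lemma expandE u v : adj u v -> perm_eq (expand [set u; v]) (subdivided_edge u v).
Proof.
rewrite /expand => a; case: (endsP a) => -> //=.
by rewrite /subdivided_edge (subdiv_rev S a) pe_rev.
Qed.

Lemma innerE u v : adj u v -> perm_eq (inner [set u; v]) (P u v).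
Proof.
rewrite /inner => a; case: (endsP a) => -> //=.
by rewrite (subdiv_rev S a) perm_rev.
Qed.

Definition lift_walk u s := flatten (pairmap (fun v w => rcons (P v w) (f w)) u s).
Definition lift_cycle c := if c is u :: _ then lift_walk (last u c) c else [::].

Lemma last_lift u s : last (f u) (lift_walk u s) = f (last u s).
Proof.
elim: s u => //= v s IH u.
by rewrite /lift_walk /= last_cat last_rcons -/(lift_walk v s) IH.
Qed.

Lemma pe_lift u s : path (@adj G) u s ->
  perm_eq (pe (f u) (lift_walk u s)) (flatten (map expand (pe u s))).
Proof.
elim: s u => //= v s IH u /andP[a p].
rewrite /lift_walk /= -/(lift_walk v s) pe_cat last_rcons.
by apply: perm_cat; [rewrite perm_sym expandE|apply: IH].
Qed.

Lemma mem_lift u s : path (@adj G) u s ->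
  perm_eq (lift_walk u s) (map f s ++ flatten (map inner (pe u s))).
Proof.
elim: s u => //= v s IH u /andP[a p].
rewrite /lift_walk /= -/(lift_walk v s).
apply/permP => q; move: (permP (IH v p) q) (permP (innerE a) q).
by rewrite -cats1 /= !count_cat /=; count_lia.
Qed.

Lemma ce_lift c : cycle (@adj G) c ->
  perm_eq (ce (lift_cycle c)) (flatten (map expand (ce c))).
Proof.
case: c => // u s; rewrite (cycle_path u) /lift_cycle => p.
rewrite (ce_last (f (last u (u :: s)))); first by rewrite last_lift; apply: pe_lift.
by rewrite /lift_walk /=; case: (P _ _).
Qed.

Lemma uniq_lift c : cycle (@adj G) c -> uniq c -> uniq (ce c) -> {subset ce c <= edges G} ->
  uniq (lift_cycle c).
Proof.
case: c => // u s; rewrite (cycle_path u) /lift_cycle => p uc uce sub.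
have pL : perm_eq (lift_walk (last u (u :: s)) (u :: s))
    (map f (u :: s) ++ flatten (map inner (ce (u :: s)))) := mem_lift p.
have edge e x : e \in ce (u :: s) -> x \in inner e ->
    exists v w, [/\ adj v w, e = [set v; w] & x \in P v w].
  move=> /sub/edgesP[v [w [a ->]]]; rewrite (perm_mem (innerE a)) => xP.
  by exists v, w.
rewrite (perm_uniq pL) cat_uniq (map_inj_uniq (subdiv_inj S)) uc andTb.
apply/andP; split.
  apply/hasPn => x /flatten_mapP[e ec /(edge _ _ ec)[v [w [a _ xP]]]].
  by apply/mapP => -[z _ xz]; move: xP; rewrite xz (negbTE (subdiv_new S z a)).
apply: (@uniq_flatten_map _ _ inner) => //.
  move=> e /sub/edgesP[v [w [a ->]]]; rewrite (perm_uniq (innerE a)).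
  exact: (subdiv_uniq S a).
move=> e e' x ec ec' /(edge _ _ ec)[v [w [a -> xP]]] /(edge _ _ ec')[v' [w' [a' -> xP']]].
exact: (subdiv_disjoint S a a' xP xP').
Qed.

(** An inner vertex determines the edge it subdivides. If neither path has inner vertices, [e] is
    the image of both edges and injectivity of [f] applies. *)
Lemma subdivided_edge_inj u v u' v' (e : {set H}) : adj u v -> adj u' v' ->
  e \in subdivided_edge u v -> e \in subdivided_edge u' v' -> [set u; v] = [set u'; v'].
Proof.
have key w z w' z' : adj w z -> adj w' z' -> P w z != [::] ->
    e \in subdivided_edge w z -> e \in subdivided_edge w' z' -> [set w; z] = [set w'; z'].
  move=> a a' n /(inner_vertex n)[x xP xe] /mem_pe/(_ xe).
  rewrite inE mem_rcons inE => /or3P[/eqP xf|/eqP xf|xP'].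
  - by rewrite xf (negbTE (subdiv_new S _ a)) in xP.
  - by rewrite xf (negbTE (subdiv_new S _ a)) in xP.
  exact: (subdiv_disjoint S a a' xP xP').
move=> a a' eu eu'; have [Pn|n] := eqVneq (P u v) [::]; last exact: key eu eu'.
have [Pn'|n] := eqVneq (P u' v') [::]; last first.
  by apply: esym; apply: (key _ _ _ _ a' a n eu' eu).
move: eu eu'; rewrite /subdivided_edge Pn Pn' /pe /= !inE => /eqP-> /eqP.
by case/set2_eq => -[/(subdiv_inj S)-> /(subdiv_inj S)->] //; rewrite setUC.
Qed.

Lemma uniq_subdivided_edge u v : adj u v -> uniq (subdivided_edge u v).
Proof.
move=> a; apply: uniq_pe; rewrite /= rcons_uniq mem_rcons inE negb_or.
rewrite !(subdiv_new S _ a) (subdiv_uniq S a) (inj_eq (subdiv_inj S)) !andbT.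
by apply: contraTneq a => ->; rewrite adj_irr.
Qed.

Lemma perm_expand : perm_eq (flatten (map expand (enum (edges G)))) (enum (edges H)).
Proof.
have edge e (e' : {set H}) : e \in enum (edges G) -> e' \in expand e ->
    exists u v, [/\ adj u v, e = [set u; v] & e' \in subdivided_edge u v].
  rewrite mem_enum => /edgesP[v [w [a ->]]]; rewrite (perm_mem (expandE a)) => eE.
  by exists v, w.
apply: uniq_perm; last 1 first.
- move=> e; rewrite mem_enum; apply/flatten_mapP/edgesP.
    move=> [e0 eG /(edge _ _ eG)[u [v [a _ /infix_pe[x [y [ixy ->]]]]]]].
    by exists x, y; split=> //; apply/(subdiv_adj S); exists u, v.
  move=> [x [y [/(subdiv_adj S)[u [v [a ixy]]] ->]]]; exists [set u; v].
    by rewrite mem_enum mem_edges.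
  by rewrite (perm_mem (expandE a)); apply/infix_pe; exists x, y.
- apply: (@uniq_flatten_map _ _ expand); first exact: enum_uniq.
    move=> e; rewrite mem_enum => /edgesP[u [v [a ->]]].
    by rewrite (perm_uniq (expandE a)) uniq_subdivided_edge.
  move=> e e' e1 eG eG' /(edge _ _ eG)[u [v [a -> eu]]] /(edge _ _ eG')[u' [v' [a' -> eu']]].
  exact: subdivided_edge_inj eu eu'.
exact: enum_uniq.
Qed.

Definition length_parity : pred {set G} := fun e => odd (size (expand e)).

Lemma par_expand E : par length_parity E = odd (size (flatten (map expand E))).
Proof.
rewrite /par; elim: E => //= e E IH; rewrite size_cat !oddD IH.
by rewrite /length_parity oddb.
Qed.

(** The lift of a cycle has length the sum of the lengths of its replaced edges, so it is even
    exactly when the cycle is even for [length_parity]. *)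
Lemma good_subdivision : good length_parity (enum (edges G)) ->
  even_cycle_decomposable H.
Proof.
move=> [cs ev pE]; have uE : uniq (flatten (map (@ce G) cs)).
  by rewrite (perm_uniq pE) enum_uniq.
have cyc c : c \in cs -> cycle (@adj G) c /\ {subset ce c <= edges G}.
  move=> cc; have sub : {subset ce c <= edges G}.
    by move=> e ec; rewrite -mem_enum -(perm_mem pE); apply/flatten_mapP; exists c.
  by split=> //; apply: cycle_adj.
apply: (@even_cycle_decomposable_seq H (map lift_cycle cs)).
  apply/allP => _ /mapP[c cc ->]; have [ac sub] := cyc c cc.
  have /andP[uc ec] := allP ev c cc; rewrite uniq_lift ?(uniq_flatten_mem uE cc) //=.
  by rewrite -size_ce (perm_size (ce_lift ac)) -par_expand.
apply: perm_trans (perm_expand); apply: perm_trans (perm_flatten_map expand pE).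
have {uE ev pE} : {in cs, forall c, cycle (@adj G) c} by move=> c /cyc[].
elim: (cs) => //= c ds IH ac; rewrite map_cat flatten_cat; apply: perm_cat; first by apply:
  ce_lift; rewrite ac ?mem_head.
by apply: IH => d dd; apply: ac; rewrite inE dd orbT.
Qed.

Lemma par_subdivision : par length_parity (enum (edges G)) = odd #|edges H|.
Proof. by rewrite par_expand (perm_size perm_expand) cardE. Qed.

End Lift.

(** * The sides of a join *)

Section Sides.
Variable G : sgraph.
Implicit Types (x y a b : G) (A B s : seq G) (e : {set G}).

Definition inside A : seq {set G} := [seq e : {set G} <- enum (edges G) | e \subset [set x in A]].

Lemma mem_inside A x y : ([set x; y] \in inside A) = [&& adj x y, x \in A & y \in A].
Proof. by rewrite mem_filter mem_enum mem_edges subUset !sub1set !inE andbC. Qed.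

Lemma insideP A e : reflect (exists x y, [/\ adj x y, x \in A, y \in A & e = [set x; y]])
  (e \in inside A).
Proof.
apply: (iffP idP) => [eA|[x [y [a xA yA ->]]]]; last by rewrite mem_inside a xA yA.
have := eA; rewrite mem_filter mem_enum => /andP[_ /edgesP[x [y [a ee]]]].
by move: eA; rewrite ee mem_inside => /and3P[_ xA yA]; exists x, y.
Qed.

Lemma graph_on_inside A : graph_on A (inside A).
Proof.
split; first by rewrite filter_uniq ?enum_uniq.
  by apply: simple2_edges => e /insideP[x [y [a _ _ ->]]]; rewrite mem_edges.
by move=> e z /insideP[x [y [_ xA yA ->]]]; rewrite !inE => /orP[]/eqP->.
Qed.

Lemma degree_inside A x : uniq A -> x \in A -> degree_in (inside A) x = count (adj x) A.
Proof.
move=> uA xA; have [uI _ _] := graph_on_inside A.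
rewrite /degree_in -!size_filter -(size_map (fun y => [set x; y])).
apply/perm_size/uniq_perm; first exact: filter_uniq.
  by rewrite map_inj_uniq ?filter_uniq // => y z; apply: set2_inj.
move=> e; rewrite mem_filter; apply/andP/mapP => [[xe /insideP[u [v [a uA' vA ee]]]]|].
  move: xe; rewrite ee !inE => /orP[]/eqP->.
    by exists v; rewrite // mem_filter a.
  by exists u; rewrite ?mem_filter 1?adj_sym ?a // setUC.
by move=> [y]; rewrite mem_filter => /andP[a yA] ->; rewrite mem_inside a xA yA !inE eqxx.
Qed.

Definition join_sides A B :=
  [/\ uniq (A ++ B), forall x, (x \in A) || (x \in B) &
      forall a b, a \in A -> b \in B -> adj a b].

Lemma join_sidesC A B : join_sides A B -> join_sides B A.
Proof.
move=> [u all_ ab]; split; first by rewrite uniq_catC.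
  by move=> x; rewrite orbC.
by move=> b a bB aA; rewrite adj_sym ab.
Qed.

Lemma perm_sides A B : join_sides A B -> perm_eq (enum G) (A ++ B).
Proof.
move=> [u cov _]; apply: uniq_perm => //; first exact: enum_uniq.
by move=> x; rewrite mem_enum mem_cat cov.
Qed.

Lemma degree_sides A B x : join_sides A B -> x \in A ->
  degree x = degree_in (inside A) x + size B.
Proof.
move=> J xA; have [u _ ab] := J.
have uA : uniq A by move: u; rewrite cat_uniq => /and3P[].
rewrite degree_inside // /degree cardsE cardE -size_filter.
have -> : size (enum (adj x)) = count (adj x) (A ++ B).
  rewrite -(permP (perm_sides J)) -size_filter; congr size.
  by rewrite enumT.
rewrite size_filter count_cat; congr (_ + _); apply/eqP; rewrite -all_count.
by apply/allP => b; apply: ab.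
Qed.

Lemma perm_edges_sides A B : join_sides A B ->
  perm_eq (inside A ++ inside B ++ bip A B) (enum (edges G)).
Proof.
move=> [u cov ab]; have [uA dis uB] : [/\ uniq A, ~~ has (mem A) B & uniq B].
  by move: u; rewrite cat_uniq => /and3P.
have nAB x : x \in A -> x \in B -> False.
  by move=> xA xB; case/hasP: dis; exists x.
have [uIA _ _] := graph_on_inside A; have [uIB _ _] := graph_on_inside B.
have bipP e : reflect (exists a b, [/\ a \in A, b \in B & e = [set a; b]]) (e \in bip A B).
  apply: (iffP allpairsP) => [[[a b] /= [aA bB ->]]|[a [b [aA bB ->]]]].
    by exists a, b.
  by exists (a, b).
apply: uniq_perm; last 1 first.
- move=> e; rewrite !mem_cat mem_enum; apply/or3P/edgesP.
    case=> [/insideP[x [y [a _ _ ->]]]|/insideP[x [y [a _ _ ->]]]|/bipP[x [y [xA yB ->]]]].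
    - by exists x, y.
    - by exists x, y.
    by exists x, y; rewrite ab.
  move=> [x [y [a ->]]]; rewrite !mem_inside a /=.
  case/orP: (cov x) (cov y) => [xA|xB] /orP[yA|yB].
  + by apply: Or31; rewrite xA yA.
  + by apply: Or33; apply/bipP; exists x, y.
  + by apply: Or33; apply/bipP; exists y, x; rewrite setUC.
  by apply: Or32; rewrite xB yB.
- rewrite !cat_uniq uIA uIB /=; apply/and3P; split.
  + apply/hasPn => e; rewrite mem_cat => /orP[/insideP[x [y [_ xB _ ->]]]|/bipP[x [y [xA yB ->]]]].
      by rewrite mem_inside; apply/and3P => -[_ xA _]; apply: nAB xA xB.
    by rewrite mem_inside; apply/and3P => -[_ _ yA]; apply: nAB yA yB.
  + apply/hasPn => e /bipP[x [y [xA yB ->]]].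
    by rewrite mem_inside; apply/and3P => -[_ xB _]; apply: nAB xA xB.
  apply: allpairs_uniq => // -[a b] [a' b'] /allpairsP[[x y] /= [xA yB [-> ->]]].
  move=> /allpairsP[[x' y'] /= [xA' yB' [-> ->]]] /set2_eq[[-> ->]//|[xy _]].
  by rewrite xy in xA; case: (nAB _ xA yB').
exact: enum_uniq.
Qed.

End Sides.

(** * Recognizing the two exceptional graphs *)

Section Exceptions.
Variable G : sgraph.
Implicit Types (x y a b : G) (A B s : seq G) (e : {set G}).

(** For the concrete graphs [K] a map out of [K] is just a list of vertices of [G], so this
    direction is the convenient one. *)
Lemma isomorphic_inv (K : sgraph) (g : K -> G) : injective g -> #|G| <= #|K| ->
  (forall x y : K, adj (g x) (g y) = adj x y) -> isomorphic G K.
Proof.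
move=> ig cGK ag; have [h gK hK] := inj_card_bij ig cGK.
by exists h; [exists g|move=> x y; rewrite -ag !hK].
Qed.

Lemma isomorphic_K5 s : uniq s -> size s = 5 -> (forall x, x \in s) ->
  {in s &, forall x y, x != y -> adj x y} -> isomorphic G K5.
Proof.
case: s => // x0 s'; set s := x0 :: s' => us s5 cov ad.
have lt (i : 'I_5) : i < size s by rewrite s5.
pose g (i : K5) : G := nth x0 s i.
have ig : injective g.
  by move=> i j /eqP; rewrite /g nth_uniq // => /eqP/val_inj.
apply: (isomorphic_inv ig).
  rewrite card_ord -s5 -(card_uniqP us) subset_leq_card //.
  by apply/subsetP => x _; apply: cov.
move=> i j; rewrite [RHS]/(i != j); have [->|ij] := eqVneq i j; first by rewrite adj_irr.
by rewrite ad ?mem_nth // (inj_eq ig).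
Qed.

(** The list follows the vertices of [K5_subdivided]: [w] is the new vertex [None], and [b] and [b']
    stand for [ord0] and [ord_max], the ends of the subdivided edge. *)
Lemma isomorphic_K5_subdivided w b b' a1 a2 a3 :
  uniq [:: w; b; a1; a2; a3; b'] -> (forall x, x \in [:: w; b; a1; a2; a3; b']) ->
  adj w b -> adj w b' -> ~~ adj b b' ->
  (forall x, x \in [:: a1; a2; a3] -> [/\ ~~ adj w x, adj b x & adj b' x]) ->
  adj a1 a2 -> adj a1 a3 -> adj a2 a3 -> isomorphic G K5_subdivided.
Proof.
move=> us cov wb wb' bb' h a12 a13 a23.
have [w1 b1 c1] : [/\ ~~ adj w a1, adj b a1 & adj b' a1] by apply: h; rewrite !inE eqxx.
have [w2 b2 c2] : [/\ ~~ adj w a2, adj b a2 & adj b' a2] by apply: h; rewrite !inE eqxx orbT.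
have [w3 b3 c3] : [/\ ~~ adj w a3, adj b a3 & adj b' a3] by apply: h; rewrite !inE eqxx !orbT.
pose s := [:: w; b; a1; a2; a3; b'].
pose k (o : option 'I_5) := if o is Some i then i.+1 else 0.
have ltk o : k o < size s by case: o => [i|] //; exact: (ltn_ord i).
pose g (o : K5_subdivided) : G := nth w s (k o).
have ig : injective g.
  move=> o o' /eqP; rewrite /g nth_uniq //.
  by case: o o' => [i|] [j|] //= /eqP[/val_inj->].
apply: (isomorphic_inv ig).
  rewrite card_option card_ord -[6]/(size s) -(card_uniqP us) subset_leq_card //.
  by apply/subsetP => x _; apply: cov.
have adj2 (i j : 'I_5) : @adj K5_subdivided (Some i) (Some j) =
    (i != j) && ~~ ((i == ord0) && (j == ord_max) || (i == ord_max) && (j == ord0)).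
  rewrite [LHS]/((i != j) && _); congr (_ && ~~ _).
  apply/eqP/orP => [/set2_eq[[-> ->]|[-> ->]]|[/andP[/eqP-> /eqP->]|/andP[/eqP-> /eqP->]]] //.
  - by left.
  - by right.
  by rewrite [RHS]setUC.
have adjN (i : 'I_5) : @adj K5_subdivided None (Some i) = (i == ord0) || (i == ord_max).
  exact: in_set2.
have adjg x y : adj y x = adj x y by rewrite adj_sym.
have gN i : adj w (g (Some i)) = @adj K5_subdivided None (Some i).
  rewrite adjN /g; case: i => [[|[|[|[|[|]]]]] i5] //=; by [|apply: negbTE].
move=> [i|] [j|]; last by rewrite /= adj_irr.
- rewrite adj2 /g; case: i j => [[|[|[|[|[|]]]]] i5] // [[|[|[|[|[|]]]]] j5] //=;
  by rewrite ?adj_irr // ?(negbTE bb') //  adjg ?(negbTE bb').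
- by rewrite adjg [RHS]adj_sym gN.
exact: gN.
Qed.

Lemma bad_join_isomorphic A B : eulerian G -> join_sides A B ->
  bad_join A B (inside A) -> isomorphic G K5 \/ isomorphic G K5_subdivided.
Proof.
move=> eG J; have [u cov ab] := J.
have [uA dis uB] : [/\ uniq A, ~~ has (mem A) B & uniq B].
  by move: u; rewrite cat_uniq => /and3P.
have g1 := graph_on_inside A; have [u1 s1 in1] := g1.
have dA x : x \in A -> odd (degree_in (inside A) x) = odd (size B).
  by move=> xA; have := eG x; rewrite (degree_sides J xA) oddD; case: odd; case: odd.
have dB x : x \in B -> odd (degree_in (inside B) x) = odd (size A).
  move=> xB; have := eG x; rewrite (degree_sides (join_sidesC J) xB) oddD.
  by case: odd; case: odd.
have eA : odd (size B) = false -> eulerian_list (inside A).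
  move=> ev x; have [xA|xA] := boolP (x \in A); first by rewrite dA ?ev.
  by rewrite (degree_out g1 xA).
rewrite /bad_join => /orP[]/and3P[/eqP sA /eqP sB H1]; rewrite sB sA in dA dB eA.
  right; have eI := eA erefl.
  have [c [uc sc sub]] : exists c, [/\ uniq c, 2 < size c & {subset ce c <= inside A}].
    by apply: exists_cycle => //; rewrite -size_eq0 (eqP H1).
  have [F pF] := cycle_rest u1 uc sc sub.
  have [A' pA] := perm_subset uc (cycle_vertices g1 sub).
  have [sc3 sF] : size c = 3 /\ size F = 0.
    have := perm_size pF; rewrite size_cat size_ce (eqP H1).
    by move: sc; case: (size c) => [|[|[|[|n]]]] // _ [].
  rewrite (size0nil sF) cats0 in pF.
  case: c sc3 pF pA {uc sc sub} => [|a1 [|a2 [|a3 []]]] // _ pF pA.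
  have := perm_size pA; rewrite sA; case: A' pA => [|w []] // pA _.
  case: B sB {dis} u uB dB J cov ab {eA} => [|b [|b' []]] // _ u uB dB J cov ab.
  have inA x : x \in [:: w; a1; a2; a3] -> x \in A by rewrite (perm_mem pA) !inE orbC -!orbA.
  have pV : perm_eq (A ++ [:: b; b']) [:: w; b; a1; a2; a3; b'].
    by apply/permP => q; move: (permP pA q); rewrite !count_cat /=; count_lia.
  have uV := u; rewrite (perm_uniq pV) in uV.
  have adjA x y : x \in [:: a1; a2; a3] -> y \in A ->
      adj x y = ([set x; y] \in ce [:: a1; a2; a3]).
    by move=> xc yA; rewrite -(perm_mem pF) mem_inside inA ?yA ?andbT // inE xc orbT.
  have inc x : x \in [:: a1; a2; a3] -> x \in A by move=> xc; apply: inA; rewrite inE xc orbT.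
  apply: (isomorphic_K5_subdivided (w := w) (b := b) (b' := b') (a1 := a1) (a2 := a2) (a3 := a3)).
  - exact: uV.
  - by move=> x; rewrite -(perm_mem pV) mem_cat; apply: cov.
  - by apply: ab; rewrite ?inA ?inE ?eqxx.
  - by apply: ab; rewrite ?inA ?inE ?eqxx ?orbT.
  (* [A] has four vertices, so [b] has even degree inside [B] and is not adjacent to [b']. *)
  - have := dB b (mem_head _ _); rewrite degree_inside ?mem_head //= adj_irr addn0.
    by case: (adj b b').
  - move=> x xc; split.
    + rewrite adj_sym adjA ?inA ?mem_head //; apply/negP => /mem_ce/(_ (set22 x w)) wc.
      move: uA; rewrite (perm_uniq pA) cat_uniq => /and3P[_ + _].
      by rewrite /= wc.
    + by rewrite adj_sym ab ?inc ?mem_head.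
    by rewrite adj_sym ab ?inc // !inE eqxx orbT.
  - by rewrite adjA ?inc /ce /pe /= ?inE ?eqxx ?orbT.
  - by rewrite adjA ?inc /ce /pe /= ?inE ?eqxx ?orbT // setUC eqxx.
  by rewrite adjA ?inc /ce /pe /= ?inE ?eqxx ?orbT.
left; have eI := eA erefl; rewrite size_eq0 in H1.
have [a [b [d [pA pT]]]] := triangle uA sA g1 eI H1.
apply: (isomorphic_K5 u); [by rewrite size_cat sA sB|by move=> x; rewrite mem_cat|].
have adjA x y : [set x; y] \in ce [:: a; b; d] -> adj x y.
  by rewrite -(perm_mem pT) mem_inside => /and3P[].
have [dab abb bd] : [/\ adj d a, adj a b & adj b d].
  by split; apply: adjA; rewrite /ce /pe /= !inE eqxx ?orbT.
move=> x y; rewrite !mem_cat => /orP[xA|xB] /orP[yA|yB] xy.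
- move: xA yA xy; rewrite !(perm_mem pA) !inE.
  by move=> /or3P[]/eqP-> /or3P[]/eqP->; rewrite ?eqxx // 1?adj_sym.
- exact: ab.
- by rewrite adj_sym ab.
(* [A] has three vertices, so the degrees inside the two-vertex [B] are odd and its vertices are
   adjacent. *)
have := dB x xB; rewrite degree_inside // => oB.
case: B sB uB xB yB oB {dis u cov ab J eA dB} => [|b1 [|b2 []]] // _ _.
rewrite !inE => /orP[]/eqP ex /orP[]/eqP ey; rewrite ex ey ?eqxx in xy *; move=> //=.
  by rewrite adj_irr addn0; case: (adj b1 b2).
by rewrite adj_irr !addn0; case: (adj b2 b1).
Qed.

End Exceptions.

Lemma join_sides_exist (G G1 G2 : sgraph) : isomorphic G (join G1 G2) ->
  exists A B : seq G, [/\ join_sides A B, size A = #|G1| & size B = #|G2|].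
Proof.
move=> [f [g fK gK] af]; have ig : injective g := can_inj gK.
have ag x y : adj (g x) (g y) = @adj (join G1 G2) x y by rewrite -af !gK.
exists (map (fun a => g (inl a)) (enum G1)), (map (fun b => g (inr b)) (enum G2)).
split; last 2 first.
- by rewrite size_map -cardE.
- by rewrite size_map -cardE.
split.
- rewrite cat_uniq; apply/and3P; split.
  + by rewrite map_inj_uniq ?enum_uniq // => a a' e; case: (ig _ _ e).
  + by apply/hasPn => _ /mapP[b _ ->]; apply/mapP => -[a _ e]; have := ig _ _ e.
  by rewrite map_inj_uniq ?enum_uniq // => b b' e; case: (ig _ _ e).
- move=> x; rewrite -[x]fK; case: (f x) => [a|b]; apply/orP; [left|right].
    by apply/mapP; exists a; rewrite ?mem_enum.
  by apply/mapP; exists b; rewrite ?mem_enum.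
by move=> _ _ /mapP[a _ ->] /mapP[b _ ->]; rewrite ag.
Qed.

Lemma good_edges (G : sgraph) (A B : seq G) (sg : pred {set G}) : eulerian G ->
  join_sides A B -> 1 < size A -> 1 < size B ->
  ~ isomorphic G K5 -> ~ isomorphic G K5_subdivided ->
  ~~ par sg (enum (edges G)) -> good sg (enum (edges G)).
Proof.
move=> eG J A2 B2 n1 n2 ev; have JC := join_sidesC J; have pE := perm_edges_sides J.
apply: good_perm (pE) _; rewrite -(par_perm _ pE) in ev.
have [u _ _] := J.
apply: good_join => //; try exact: graph_on_inside.
- by move=> x xA; have := eG x; rewrite (degree_sides J xA) oddD; case: odd; case: odd.
- by move=> x xB; have := eG x; rewrite (degree_sides JC xB) oddD; case: odd; case: odd.
- by apply/negP => /(bad_join_isomorphic eG J)[].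
by apply/negP => /(bad_join_isomorphic eG JC)[].
Qed.

Lemma isomorphic_subdivision (G K H : sgraph) :
  isomorphic G K -> subdivision K H -> subdivision G H.
Proof.
move=> [h [g hK gK] ah] [f [P S]]; exists (f \o h), (fun u v => P (h u) (h v)).
have ih := can_inj hK.
split=> /=.
- exact: inj_comp (subdiv_inj S) ih.
- by move=> u v; rewrite -ah; apply: (subdiv_rev S).
- by move=> u v; rewrite -ah; apply: (subdiv_uniq S).
- by move=> u v w; rewrite -ah; apply: (subdiv_new S).
- move=> u v u' v' x; rewrite -ah -[adj u' v']ah => a a' xP xP'.
  have := subdiv_disjoint S a a' xP xP'; case/set2_eq => -[/ih-> /ih->] //.
  by rewrite setUC.
- move=> x; case: (subdiv_vertex S x) => [[u ->]|[u [v [a xP]]]].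
    by left; exists (g u); rewrite gK.
  by right; exists (g u), (g v); rewrite -ah !gK.
move=> x y; split=> [/(subdiv_adj S)[u [v [a i]]]|[u [v [a i]]]].
  by exists (g u), (g v); rewrite -ah !gK.
by apply/(subdiv_adj S); exists (h u), (h v); rewrite ah.
Qed.

Lemma subdivision_refl (G : sgraph) : subdivision G G.
Proof.
exists id, (fun _ _ => [::]); split=> //.
- by move=> x; left; exists x.
move=> x y; split=> [a|[u [v [a]]]].
  by exists x, y; rewrite a /= !eqxx.
by rewrite /= !andbT !andbF !orbF => /andP[/eqP-> /eqP->].
Qed.

Section SubdivideEdge.
Variables (G : sgraph) (a b : G).
Hypothesis ab : adj a b.

Definition new_vertex (u v : G) : seq (subdivide_edge a b) :=
  if [set u; v] == [set a; b] then [:: None] else [::].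

Lemma subdivide_edge_via :
  @subdivision_via G (subdivide_edge a b) Some new_vertex.
Proof.
rewrite /new_vertex; split.
- exact: Some_inj.
- by move=> u v _; rewrite setUC; case: ifP.
- by move=> u v _; case: ifP.
- by move=> u v w _; case: ifP.
- by move=> u v u' v' x _ _; case: ifP => // /eqP-> _; case: ifP => // /eqP->.
- move=> [u|]; first by left; exists u.
  by right; exists a, b; rewrite eqxx mem_head.
move=> x y; split.
  have mid u : u \in [set a; b] -> exists v, adj u v /\ [set u; v] = [set a; b].
    rewrite !inE => /orP[]/eqP->; first by exists b.
    by exists a; rewrite adj_sym setUC.
  case: x y => [u|] [v|] //=.
  - by case/andP=> uv n; exists u, v; rewrite uv (negbTE n) /= !eqxx.
  - case/mid=> v [uv e]; exists u, v; rewrite uv e eqxx /= !eqxx; split=> //.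
  by case/mid=> u [vu e]; exists u, v; rewrite adj_sym vu setUC e eqxx /= ?eqxx.
move=> [u [v [uv]]]; case: ifP => [/eqP e|n] /=.
  rewrite !andbT !andbF !orbF => /orP[/andP[/eqP-> /eqP->]|/andP[/eqP-> /eqP->]] /=.
    by rewrite -e !inE eqxx.
  by rewrite -e !inE eqxx orbT.
by rewrite !andbT !andbF !orbF => /andP[/eqP-> /eqP->] /=; rewrite uv n.
Qed.

Lemma card_edges_subdivide : #|edges (subdivide_edge a b)| = #|edges G|.+1.
Proof.
rewrite !cardE -(perm_size (perm_expand subdivide_edge_via)).
have sE e : e \in enum (edges G) ->
    size (@expand G (subdivide_edge a b) Some new_vertex e) = (e == [set a; b]).+1.
  rewrite mem_enum => /edgesP[u [v [uv ->]]].
  rewrite (perm_size (expandE subdivide_edge_via uv)) size_pe size_rcons.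
  by rewrite /new_vertex; case: ifP.
have -> : size (flatten (map (@expand G (subdivide_edge a b) Some new_vertex) (enum (edges G)))) =
    size (enum (edges G)) + count_mem [set a; b] (enum (edges G)).
  elim: (enum _) sE => //= e E IH sE; rewrite size_cat sE ?mem_head // IH; last first.
    by move=> e' e'E; apply: sE; rewrite inE e'E orbT.
  by rewrite !addSn addnCA.
by rewrite count_uniq_mem ?enum_uniq // mem_enum mem_edges ab addn1.
Qed.

End SubdivideEdge.

Lemma card_edges_K5 : #|edges K5| = 10.
Proof.
have -> : edges K5 = [set e : {set 'I_5} | #|e| == 2].
  apply/setP => e; rewrite [RHS]inE; apply/edgesP/cards2P => [[x [y [xy ->]]]|[x [y [xy ->]]]];
    by exists x, y.
by rewrite card_draws card_ord.
Qed.

(** * The exceptional graphs *)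

Section EvenCycles.
Variable H : sgraph.
Implicit Types (c s : seq H) (x y : H).

Lemma card_cycle_edges c : is_cycle c -> #|cycle_edges c| = size c.
Proof.
move=> [sc /andP[_ uc]]; rewrite (eq_card (cycle_edgesE uc)).
by rewrite (card_uniqP _) ?size_ce //; apply: uniq_ce.
Qed.

Lemma order5_not_decomposable : #|H| = 5 -> #|edges H| = 10 ->
  ~ even_cycle_decomposable H.
Proof.
move=> cH cE [P pP cyc]; have := card_uniform_partition (n := 4) _ pP.
rewrite cE => h; suff : 10 = #|P| * 4 by lia.
apply: h => B /cyc[c [cc ec ->]]; rewrite card_cycle_edges //.
have [sc /andP[_ uc]] := cc; have := max_card (mem c); rewrite (card_uniqP uc) cH.
by case: (size c) sc ec => [|[|[|[|[|[|]]]]]].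
Qed.

(** The path through [p], [n], [w], [q] is the one of length three that replaces the edge [pq] of
    K5. *)
Variables n w p q : H.
Hypothesis adj_n : forall x, adj n x = (x == w) || (x == p).
Hypothesis adj_w : forall x, adj w x = (x == n) || (x == q).
Hypothesis npq : ~~ adj p q.
Hypothesis cH : #|H| = 7.

Lemma cycle_through c x : cycle (@adj H) c -> uniq c -> 2 < size c -> x \in c ->
  exists y s z, [/\ perm_eq c (x :: y :: rcons s z),
    perm_eq (ce c) (ce (x :: y :: rcons s z)), path (@adj H) x (y :: rcons s z),
    adj z x & y != z].
Proof.
move=> cc uc sc /rot_to[i s' ec].
have := cc; rewrite -(rot_cycle i) ec /=; have := uc; rewrite -(rot_uniq i) ec.
have := sc; rewrite -(size_rot i) ec.
case: s' ec => [|y s'] // ec; case/lastP: s' ec => [|s z] // ec _.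
rewrite rcons_path /= last_rcons => u /andP[pa az]; exists y, s, z.
split=> //; [by rewrite -ec perm_sym perm_rot|by rewrite -ec perm_sym ce_rot|].
by move: u; rewrite /= mem_rcons inE negb_or => /andP[_ /andP[/andP[]]].
Qed.

Lemma even_cycle_size c : is_cycle c -> ~~ odd (size c) ->
  size c = 4 + 2 * ([set n; w] \in cycle_edges c).
Proof.
move=> [sc /andP[cc uc]] ec; rewrite cycle_edgesE //.
have c7 : size c <= 7 by rewrite -cH -(card_uniqP uc) max_card.
have [nc|nc] := boolP (n \in c).
  have [y [s [z [pc pce]]]] := cycle_through cc uc sc nc.
  rewrite /= rcons_path => /and3P[ny py lz] zn yz; rewrite (perm_mem pce).
  have eE : [set n; w] \in ce [:: n, y & rcons s z].
    move: ny zn yz; rewrite [adj z n]adj_sym !adj_n ce_first pe_cons !in_cons /= last_rcons.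
    move=> /orP[/eqP->|/eqP->] /orP[/eqP->|/eqP->]; rewrite ?eqxx ?orbT //.
    by rewrite [[set w; n]]setUC eqxx.
  rewrite eE; have sc' := perm_size pc; rewrite /= size_rcons in sc'.
  have uc' := uc; rewrite (perm_uniq pc) in uc'.
  (* A cycle through [n] also uses [w], and with at most seven vertices its even length is 4 or 6;
     length 4 would need the missing edge [pq]. *)
  suff s1 : size s != 1.
    by move: c7 ec s1; rewrite sc'; case: (size s) => [|[|[|[|[|k]]]]].
  apply/negP; case: s {pc pce eE sc'} uc' py lz => [|v []] //= uc' /andP[yv _] vz _.
  have vn : v != n.
    by apply: contraTneq uc' => ->; rewrite !inE eqxx !orbT.
  move: ny zn yz yv vz; rewrite [adj z n]adj_sym !adj_n.
  move=> /orP[/eqP->|/eqP->] /orP[/eqP->|/eqP->]; rewrite ?eqxx //.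
    by rewrite adj_w (negbTE vn) => _ /eqP->; rewrite adj_sym (negbTE npq).
  by rewrite [adj v w]adj_sym adj_w (negbTE vn) => _ + /eqP vq; rewrite vq (negbTE npq).
(* The only neighbours of [w] are [n] and [q], so a cycle that avoids [n] avoids [w] too and has at
   most five vertices. *)
have wc : w \notin c.
  apply/negP => wc; have [y [s [z [pc _]]]] := cycle_through cc uc sc wc.
  rewrite /= => /andP[wy _]; rewrite adj_sym => wz.
  have inc x : x \in y :: rcons s z -> x \in c.
    by move=> xs; rewrite (perm_mem pc) inE xs orbT.
  have yc : y \in c by apply: inc; rewrite mem_head.
  have zc : z \in c by apply: inc; rewrite inE mem_rcons mem_head orbT.
  move: wy wz; rewrite !adj_w => /orP[/eqP yn|/eqP->] /orP[/eqP zn|/eqP->].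
  - by rewrite yn (negbTE nc) in yc.
  - by rewrite yn (negbTE nc) in yc.
  - by rewrite zn (negbTE nc) in zc.
  by rewrite eqxx.
have nw : n != w.
  by have := adj_n w; rewrite eqxx; apply: contraTneq => ->; rewrite adj_irr.
have c5 : size c <= 5.
  have u : uniq [:: n, w & c] by rewrite /= inE negb_or nw nc wc uc.
  by have := max_card (mem [:: n, w & c]); rewrite (card_uniqP u) cH.
have -> : ([set n; w] \in ce c) = false.
  by apply: contraNF nc => /mem_ce; apply; rewrite !inE eqxx.
by case: (size c) sc ec c5 => [|[|[|[|[|[|]]]]]].
Qed.

(** Exactly one block contains the edge [nw], so the block sizes add up to two more than a multiple
    of four. *)
Lemma theta_not_decomposable : #|edges H| = 12 -> ~ even_cycle_decomposable H.
Proof.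
move=> cE [P pP cyc]; have := card_partition pP; rewrite cE.
have /and3P[/eqP cov triv _] := pP.
have eH : [set n; w] \in edges H by rewrite mem_edges adj_n eqxx.
have eP : [set n; w] \in cover P by rewrite cov.
have -> : \sum_(B in P) #|B| = \sum_(B in P) (4 + 2 * ([set n; w] \in B)).
  by apply: eq_bigr => B /cyc[c [cc ec ->]]; rewrite card_cycle_edges // even_cycle_size.
rewrite big_split /= sum_nat_const -big_distrr /=.
rewrite (bigD1 (pblock P [set n; w])) ?pblock_mem //= mem_pblock eP big1; first by lia.
move=> B /andP[BP nB]; apply/eqP; rewrite eqb0; apply: contra nB => eB.
by rewrite (def_pblock triv BP eB).
Qed.

End EvenCycles.

Theorem theorem7p3 (G : sgraph) (eulG : eulerian G)
    (joinG : exists G1 G2 : sgraph,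
       [/\ 2 <= #|G1|, 2 <= #|G2| & isomorphic G (join G1 G2)]) :
  strongly_even_cycle_decomposable G <->
  ~ isomorphic G K5 /\ ~ isomorphic G K5_subdivided.
Proof.
split=> [strong|[n1 n2] H [f [P S]] ev]; last first.
  have [G1 [G2 [c1 c2 /join_sides_exist[A [B [J sA sB]]]]]] := joinG.
  apply: (good_subdivision S); apply: (good_edges eulG J); rewrite ?sA ?sB //.
  by rewrite (par_subdivision S).
split=> iso.
  have := strong K5 (isomorphic_subdivision iso (subdivision_refl K5)).
  rewrite card_edges_K5 => /(_ isT); apply: order5_not_decomposable card_edges_K5.
  exact: card_ord.
(* [K5_subdivided] has eleven edges; subdividing one half of its path of length two makes their
   number even and the path of length three. *)
pose a : K5_subdivided := Some ord0; pose b : K5_subdivided := None.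
have ab : adj a b by rewrite [adj _ _]in_set2 eqxx.
have a04 : @adj K5 ord0 ord_max by [].
have cE : #|edges (subdivide_edge a b)| = 12.
  by rewrite card_edges_subdivide // card_edges_subdivide // card_edges_K5.
have := strong _ (isomorphic_subdivision iso
  (ex_intro _ _ (ex_intro _ _ (subdivide_edge_via ab)))).
rewrite cE => /(_ isT).
apply: (@theta_not_decomposable (subdivide_edge a b) None (Some b) (Some a) (Some (Some
  ord_max))) => //.
- by case=> [u|] //; rewrite orbC; exact: in_set2.
- case=> [[i|]|] //=; last by rewrite !inE eqxx orbT.
  rewrite -[RHS]/(i == ord_max) !inE; have [->|i0] := eqVneq i ord0.
    by rewrite [[set Some _; _]]setUC eqxx.
  have [->|//] := eqVneq i ord_max; rewrite orbT /=.
  by apply/eqP => E; case: (@set2_eq K5_subdivided _ _ _ _ E) => -[].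
- by rewrite /= eqxx.
by rewrite !card_option card_ord.
Qed.
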